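(* Let $X_{t,n}$ be a Gaussian locally stationary process. There exist constants $c_1,c_2,c_3>0$, depending on the characteristics of the process $X_{t,n}$ but not on $n$, such that for every $n$ and every $\phi:[0,1]\times[-\pi,\pi]\to\mathbf{R}$ with $\rho_\infty(\phi)<\infty$ and $\tilde v(\phi)<\infty$ the following holds. For all $\eta>0$, $$P(|\tilde E_n(\phi)|\ge\eta)\le c_1\exp\left(-c_2\frac{\eta^2}{\rho_{2,n}(\phi)^2+\frac{\eta\rho_\infty(\phi)}{\sqrt n}}\right)$$ and $$P(|\tilde E_n(\phi)|\ge\eta)\le c_1\exp\left(-c_2\frac{\eta}{\rho_{2,n}(\phi)}\right).$$ Furthermore, $$\sqrt n\,|\mathrm{E}F_n(\phi)-F(\phi)|\le c_3n^{-1/2}(\rho_\infty(\phi)+\tilde v(\phi)).$$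
   Context: Locally stationary process. Fix $\kappa>0$ and let $\ell(j)=1$ for $|j|\le1$, $\ell(j)=|j|\log^{1+\kappa}|j|$ for $|j|>1$. For a function $g$ on $[0,1]$ let $V(g)$ denote its total variation. A triangular array $X_{t,n}$, $t=1,\dots,n$, is a locally stationary process if $X_{t,n}=\sum_{j=-\infty}^{\infty}a_{t,n}(j)\varepsilon_{t-j}$, where the $\varepsilon_t$ are identically distributed with $E\varepsilon_t=0$, $E\varepsilon_s\varepsilon_t=0$ for $s\neq t$, $E\varepsilon_t^2=1$, and there are a constant $K$ (not depending on $n$) and functions $a(\cdot,j):(0,1]\to\mathbf{R}$ with $\sup_t|a_{t,n}(j)|\le K/\ell(j)$, $\sup_u|a(u,j)|\le K/\ell(j)$, $\sup_j\sum_{t=1}^n|a_{t,n}(j)-a(t/n,j)|\le K$, $V(a(\cdot,j))\le K/\ell(j)$. It is Gaussian if $X_{t,n}$ is a Gaussian process (the $\varepsilon_t$ are then Gaussian). Its time-varying spectral density is $f(u,\lambda)=\frac1{2\pi}\bigl|\sum_{j}a(u,j)e^{-i\lambda j}\bigr|^2$. Empirical spectral process. $J_n(\frac tn,\lambda)=\frac1{2\pi}\sum_{k:\,1\le[t+1/2\pm k/2]\le n}X_{[t+1/2+k/2],n}X_{[t+1/2-k/2],n}e^{-i\lambda k}$ ($[x]$ is the largest integer $\le x$), $F_n(\phi)=\frac1n\sum_{t=1}^n\int_{-\pi}^{\pi}\phi(\frac tn,\lambda)J_n(\frac tn,\lambda)\,d\lambda$, $F(\phi)=\int_0^1\int_{-\pi}^{\pi}\phi(u,\lambda)f(u,\lambda)\,d\lambda\,du$,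 and $\tilde E_n(\phi)=\sqrt n\,(F_n(\phi)-\mathrm{E}F_n(\phi))$. Norms. $\hat\phi(u,j)=\int_{-\pi}^{\pi}\phi(u,\lambda)e^{i\lambda j}d\lambda$; $\rho_{2,n}(\phi)=\bigl(\frac1n\sum_{t=1}^n\int_{-\pi}^{\pi}\phi(\frac tn,\lambda)^2d\lambda\bigr)^{1/2}$; $\rho_\infty(\phi)=\sum_{j=-\infty}^\infty\sup_u|\hat\phi(u,j)|$; $\tilde v(\phi)=\sup_jV(\hat\phi(\cdot,j))$. *)

(* Defs.v *)
From mathcomp Require Import all_boot all_order all_algebra.
From mathcomp Require Import all_classical all_reals all_analysis.
From mathcomp Require Import zify lra.

Set Implicit Arguments.
Unset Strict Implicit.
Unset Printing Implicit Defensive.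

Import Order.TTheory GRing.Theory Num.Theory.
Import numFieldNormedType.Exports.
From mathcomp Require Import complex.
Import Normc.

Local Open Scope classical_set_scope.
Local Open Scope complex_scope.
Local Open Scope ring_scope.

Section Complex.
Context {R : realType}.
Implicit Types (x : R) (f : R -> R[i]) (c : int -> R[i]).

(* e^{ix} *)
Definition expi x : R[i] := cos x +i* sin x.

Definition cintegral (D : set R) f : R[i] :=
  (\int[lebesgue_measure]_(x in D) Re (f x)) +i*
  (\int[lebesgue_measure]_(x in D) Im (f x)).

(* \sum_(|j| <= N) c j *)
Definition zpartial (V : nmodType) (c : int -> V) (N : nat) : V :=
  \sum_(i < N.*2.+1) c (i%:Z - N%:Z).

Definition zseries c : R[i] :=
  lim (zpartial (fun j => Re (c j)) @ \oo) +i*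
  lim (zpartial (fun j => Im (c j)) @ \oo).

(* The library's total_variation only covers real-valued functions. *)
Definition ctotal_variation (a b : R) f : \bar R :=
  ereal_sup [set (\sum_(0 <= i < size s)
      normc (f (nth b (a :: s) i.+1) - f (nth b (a :: s) i)))%:E |
    s in itv_partition a b].

End Complex.

(* [t + 1/2 + k/2]; the other index of the preperiodogram is idx t (- k) *)
Definition idx (t k : int) : int :=
  Num.floor (t%:~R + 2^-1 + k%:~R / 2 : rat).

Section LocallyStationary.
Context {R : realType}.

Definition ell (kappa : R) (j : int) : R :=
  if `|j| <= 1 then 1 else `|j|%:~R * (ln (`|j|%:~R : R)) `^ (1 + kappa).

Context {d : measure_display} {T : measurableType d} (P : probability T R).

(* X n t, for 1 <= t <= n, is row n of the triangular array; an n t j and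
   a u j are only constrained for 1 <= t <= n and 0 < u <= 1. The series
   defining X n t converges in mean square. As a _ j lives on ]0, 1], its total
   variation is the supremum of its total variations on the [u, 1], 0 < u. *)
Record locally_stationary (kappa : R) (eps : int -> {RV P >-> R})
    (X : nat -> int -> {RV P >-> R}) (an : nat -> int -> int -> R)
    (a : R -> int -> R) (K : R) : Prop := LocallyStationary {
  ls_ident : forall (s t : int) (A : set R), measurable A ->
    distribution P (eps s) A = distribution P (eps t) A ;
  ls_mean : forall t : int, ('E_P[eps t] = 0)%E ;
  ls_uncorrelated : forall s t : int, s != t ->
    ('E_P[fun w => (eps s w * eps t w)%R] = 0)%E ;
  ls_variance : forall t : int, ('E_P[fun w => (eps t w ^+ 2)%R] = 1)%E ;
  ls_repr : forall (n : nat) (t : int), 1 <= t <= n%:Z ->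
    ('E_P[fun w => ((X n t w -
       zpartial (fun j : int => an n t j * eps (t - j) w) N) ^+ 2)%R])%E
      @[N --> \oo] --> 0%E ;
  ls_an_le : forall (n : nat) (t j : int), 1 <= t <= n%:Z ->
    `|an n t j| <= K / ell kappa j ;
  ls_a_le : forall (u : R) (j : int), 0 < u <= 1 ->
    `|a u j| <= K / ell kappa j ;
  ls_approx : forall (n : nat) (j : int),
    \sum_(1 <= t < n.+1) `|an n t%:Z j - a (t%:R / n%:R) j| <= K ;
  ls_bv : forall (u : R) (j : int), 0 < u <= 1 ->
    (total_variation u 1 (fun x => a x j) <= (K / ell kappa j)%:E)%E }.

(* Normal law with standard deviation `|s|, degenerate when s = 0; the value of
   normal_prob at s = 0 is not a point mass. *)
Definition gaussian (Y : T -> R) : Prop :=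
  exists m s : R, forall A : set R, measurable A ->
    P (Y @^-1` A) = if s == 0 then \d_m A else normal_prob m s A.

Definition gaussian_process (X : nat -> int -> {RV P >-> R}) : Prop :=
  forall (n : nat) (c : nat -> R),
    gaussian (fun w => \sum_(1 <= t < n.+1) c t * X n t%:Z w).

Definition spectral_density (a : R -> int -> R) (u lambda : R) : R :=
  (2 * pi)^-1 *
  normc (zseries (fun j : int => (a u j)%:C * expi (- (lambda * j%:~R)))) ^+ 2.

(* J_n(t/n, lambda) is preperiodogram n x t lambda, x the sample path of row n. *)
Definition preperiodogram (n : nat) (x : int -> R) (t : int) (lambda : R)
    : R[i] :=
  ((2 * pi)^-1)%:C *
  \sum_(k \in [set k : int |
                1 <= idx t k <= n%:Z /\ 1 <= idx t (- k) <= n%:Z])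
     (x (idx t k) * x (idx t (- k)))%:C * expi (- (lambda * k%:~R)).

Definition empF (X : nat -> int -> {RV P >-> R}) (n : nat) (phi : R -> R -> R)
    (w : T) : R :=
  n%:R^-1 * \sum_(1 <= t < n.+1)
    \int[lebesgue_measure]_(lambda in `[- pi, pi])
      (phi (t%:R / n%:R) lambda *
       Re (preperiodogram n (fun s => X n s w) t%:Z lambda)).

Definition specF (a : R -> int -> R) (phi : R -> R -> R) : R :=
  \int[lebesgue_measure]_(u in `[0, 1])
    \int[lebesgue_measure]_(lambda in `[- pi, pi])
      (phi u lambda * spectral_density a u lambda).

Definition EempF (X : nat -> int -> {RV P >-> R}) (n : nat)
    (phi : R -> R -> R) : R := fine ('E_P[empF X n phi])%E.

Definition Etilde (X : nat -> int -> {RV P >-> R}) (n : nat)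
    (phi : R -> R -> R) (w : T) : R :=
  Num.sqrt n%:R * (empF X n phi w - EempF X n phi).

End LocallyStationary.

Section Norms.
Context {R : realType}.
Implicit Types (phi : R -> R -> R).

Definition phihat phi (u : R) (j : int) : R[i] :=
  cintegral `[- pi, pi]
    (fun lambda => (phi u lambda)%:C * expi (lambda * j%:~R)).

Definition rho2 (n : nat) phi : \bar R :=
  sqrte ((n%:R^-1)%:E * \sum_(1 <= t < n.+1)
    \int[lebesgue_measure]_(lambda in `[(- pi)%R, pi%R])
      (phi (t%:R / n%:R)%R lambda ^+ 2)%:E)%E.

Definition rhoinf phi : \bar R :=
  (\esum_(j in [set: int])
    ereal_sup [set (normc (phihat phi u j))%:E | u in `[0%R, 1%R]])%E.

Definition vtilde phi : \bar R :=
  ereal_sup [set ctotal_variation 0 1 (fun u => phihat phi u j) |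
    j in [set: int]].

End Norms.

(* The terms of J_n at k and - k are conjugate, so J_n is real-valued and empF
   loses nothing by taking its real part. *)
Section PreperiodogramReal.
Context {R : realType}.

Lemma idx_set_finite (n : nat) (t : int) :
  finite_set [set k : int | 1 <= idx t k <= n%:Z /\ 1 <= idx t (- k) <= n%:Z].
Proof.
have bound k : idx t k <= n%:Z -> 1 <= idx t (- k) -> k <= n%:Z.
  rewrite /idx -ltzD1 floor_lt_int floor_ge_int !intrD mulrNz => kn nk.
  by rewrite -(ler_int rat); move: kn nk; lra.
apply: (@sub_finite_set _ _ [set i%:Z - n%:Z | i in `I_(n.*2.+1)]).
  move=> k /= [/andP[k1 kn] /andP[nk1 nkn]].
  have kn' := bound _ kn nk1.
  have : - k <= n%:Z by apply: bound; rewrite ?opprK.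
  rewrite lerNl => Mk.
  by exists (absz (k + n%:Z)); rewrite /=; lia.
exact/finite_image/finite_II.
Qed.

Lemma preperiodogram_real (n : nat) (x : int -> R) (t : int) (lambda : R) :
  Im (preperiodogram n x t lambda) = 0.
Proof.
rewrite /preperiodogram; set A := [set k | _].
have finA : finite_set A by exact: idx_set_finite.
pose g k := x (idx t k) * x (idx t (- k)).
have -> : \sum_(k \in A) (g k)%:C * expi (- (lambda * k%:~R)) =
    (\sum_(k \in A) g k * cos (- (lambda * k%:~R))) +i*
    (\sum_(k \in A) g k * sin (- (lambda * k%:~R))).
  rewrite !fsbig_finite//=.
  elim/big_ind3 : _ => //= [_ a b _ a' b' -> ->//|k _].
  by rewrite /expi; simpc.
suff E : \sum_(k \in A) g k * sin (- (lambda * k%:~R)) = 0.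
  by rewrite E /= mulr0 mul0r addr0.
apply/eqP; rewrite -eqNr; apply/eqP.
rewrite [RHS](reindex_fsbig -%R A); last first.
  split => [k [? ?]/=|k l _ _ /oppr_inj//|k [? ?]/=].
    by split; rewrite ?opprK.
  by exists (- k); [split; rewrite ?opprK | exact: opprK].
rewrite !fsbig_finite// -sumrN; apply: eq_bigr => k _.
by rewrite mulrNz mulrN opprK sinN mulrN opprK /g opprK [x _ * _]mulrC.
Qed.

End PreperiodogramReal.

(* Main.v *)
Require Import Defs.
From mathcomp Require Import all_boot all_order all_algebra.
From mathcomp Require Import all_classical all_reals all_analysis.
From mathcomp Require Import measurable_realfun.
From mathcomp Require Import complex.
From mathcomp Require Import zify ring lra.

Set Implicit Arguments.
Unset Strict Implicit.
Unset Printing Implicit Defensive.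

Import Order.TTheory GRing.Theory Num.Theory.
Import numFieldNormedType.Exports.

Local Open Scope classical_set_scope.
Local Open Scope ring_scope.

(** [empF X n phi] is a quadratic form in the Gaussian vector of the observations:
its matrix [A] has as entry at two times the Fourier coefficient of [phi] at the
midpoint and the lag of these times, divided by [2 pi n] ([empF_quadform]). As the
imaginary parts cancel, only cosine coefficients occur.

Tail bounds. Let [Sg] be the covariance matrix, [W = A Sg], and let [Q] be the
quadratic form minus its mean, the trace of [W]. A Gaussian process is only assumed
to have Gaussian linear forms, and the argument never leaves the moments: the
one-dimensional recursion for Gaussian moments, polarised, is Gaussian integration
by parts ([stein_mon_pow]), and applied to [Q ^+ k] it gives a recursion for the
moments of [Q] whose coefficients are the traces of the powers of [W]
([Ex_quadform_pow]). If [F2] bounds the squared Hilbert-Schmidt norm of [W] and [beta]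
its operator norm, these traces are at most [beta ^ m * F2], and the exponential
series of the moments of [Q] at [t] is at most [exp (2 F2 t^2)] when [4 beta t <= 1]
([cumulant_bound]). Chernoff's argument with the Taylor polynomials of the hyperbolic
cosine turns this into a Bernstein inequality ([quadform_tail]). It remains to bound
the norms: Bessel's inequality bounds the Hilbert-Schmidt norm of [A] by [rho2]
([weight_matrix_frob2]); Schur's test bounds the operator norms of [A] and [Sg] by
their row sums, of order [rhoinf / n] and at most a constant since the series of the
[1 / ell j] converges ([covmx_row_sum]). This is the first inequality; taking the
Hilbert-Schmidt norm itself for [beta] gives the second.

Bias. The mean of [empF] and [specF] are limits of finite double sums over the
indices [i], [j] of the coefficients, which are compared term by term. With [k = i - j],
one term is a sum over the pairs of times of lag [k], and the other is [n] times the
integral over ]0, 1] of [a u i * a u j] and the [k]-th Fourier coefficient of [phi u].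
Replacing the coefficients by their limits, moving them to the midpoint, adding the
missing midpoints and passing from a Riemann sum to the integral costs at most a
multiple of [|k| + 1] times the bounds and the variations of the three factors
([lag_sum_riemann]). The factor [|k|] is harmless because [|j| / ell j] is bounded, and
the errors are summable in [i] and [j] since both the [1 / ell j] and the Fourier
coefficients are ([bias_le]). *)

(** * Random variables with moments of all orders *)

Section Moments.
Context {R : realType} {d : measure_display} {T : measurableType d}.
Variable P : probability T R.
Implicit Types f g : T -> R.

Definition all_moments f :=
  measurable_fun setT f /\
  forall k : nat, P.-integrable setT (fun w => (`|f w| ^+ k)%:E).

Lemma all_moments_measurable f : all_moments f -> measurable_fun setT f.
Proof. by case. Qed.

Lemma all_moments_dom f (g : nat -> T -> R) : measurable_fun setT f ->
  (forall k, P.-integrable setT (EFin \o g k)) ->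
  (forall k w, `|f w| ^+ k <= g k w) -> all_moments f.
Proof.
move=> mf ig fg; split=> // k; apply: le_integrable (ig k) => //.
- by apply/measurable_EFinP/measurable_funX/measurableT_comp.
- move=> w _; rewrite lee_fin ger0_norm ?exprn_ge0//.
  exact: le_trans (fg k w) (ler_norm _).
Qed.

Lemma all_moments_integrable f : all_moments f -> P.-integrable setT (EFin \o f).
Proof.
move=> [mf /(_ 1)]; apply: le_integrable => //; first exact/measurable_EFinP.
by move=> w _; rewrite lee_fin normr_id.
Qed.

Lemma all_moments_cst (r : R) : all_moments (cst r).
Proof.
split=> [|k]; first exact: measurable_cst.
by apply: (@finite_measure_integrable_cst _ _ _ P setT (`|r| ^+ k)).
Qed.

Lemma all_momentsM f g : all_moments f -> all_moments g ->
  all_moments (fun w => f w * g w).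
Proof.
move=> [mf fk] [mg gk].
apply: (@all_moments_dom _
    (fun k w => `|f w| ^+ (2 * k) + `|g w| ^+ (2 * k))) => [|k|k w].
- exact: measurable_funM.
- exact: (integrableD measurableT (fk (2 * k)%N) (gk (2 * k)%N)).
- rewrite normrM exprMn !(mulnC 2) !exprM.
  set x := `|f w| ^+ k; set y := `|g w| ^+ k.
  have : 0 <= (x - y) ^+ 2 by exact: sqr_ge0.
  have : 0 <= x * y by rewrite mulr_ge0 ?exprn_ge0.
  nra.
Qed.

Lemma all_momentsD f g : all_moments f -> all_moments g ->
  all_moments (fun w => f w + g w).
Proof.
move=> [mf fk] [mg gk].
apply: (@all_moments_dom _
    (fun k w => 2 ^+ k * (`|f w| ^+ k + `|g w| ^+ k))) => [|k|k w].
- exact: measurable_funD.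
- apply: (@integrableZl _ _ _ P setT measurableT (2 ^+ k)
    (fun w => (`|f w| ^+ k)%:E + (`|g w| ^+ k)%:E)%E).
  exact: (integrableD measurableT (fk k) (gk k)).
- apply: (@le_trans _ _ ((2 * Num.max `|f w| `|g w|) ^+ k)).
    rewrite lerXn2r// ?nnegrE ?mulr_ge0// ?le_max ?normr_ge0//.
    rewrite (le_trans (ler_normD _ _))// mulr_natl mulr2n.
    by rewrite lerD// le_max lexx ?orbT.
  rewrite exprMn ler_pM2l ?exprn_gt0//.
  by case: (leP `|f w| `|g w|) => _; rewrite ?lerDl ?lerDr exprn_ge0.
Qed.

Lemma all_momentsZ (r : R) f : all_moments f -> all_moments (fun w => r * f w).
Proof. by apply: all_momentsM; exact: all_moments_cst. Qed.

Lemma all_momentsB f g : all_moments f -> all_moments g ->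
  all_moments (fun w => f w - g w).
Proof.
move=> mf mg; have := all_momentsD mf (all_momentsZ (-1) mg).
by congr all_moments; apply/funext => w; rewrite mulN1r.
Qed.

Lemma all_momentsX f k : all_moments f -> all_moments (fun w => f w ^+ k).
Proof.
move=> mf; elim: k => [|k ih].
  by under eq_fun do rewrite expr0; exact: all_moments_cst.
by under eq_fun do rewrite exprS; exact: all_momentsM.
Qed.

Lemma all_moments_sum (I : Type) (s : seq I) (Q : pred I) (F : I -> T -> R) :
  (forall i, all_moments (F i)) ->
  all_moments (fun w => \sum_(i <- s | Q i) F i w).
Proof.
move=> mF; elim: s => [|i s ih].
  by under eq_fun do rewrite big_nil; exact: all_moments_cst.
under eq_fun do rewrite big_cons.
by case: (Q i) => //; exact: all_momentsD.
Qed.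

Lemma all_moments_prod (I : Type) (s : seq I) (F : I -> T -> R) :
  (forall i, all_moments (F i)) ->
  all_moments (fun w => \prod_(i <- s) F i w).
Proof.
move=> mF; elim: s => [|i s ih].
  by under eq_fun do rewrite big_nil; exact: all_moments_cst.
by under eq_fun do rewrite big_cons; exact: all_momentsM.
Qed.

Local Notation E f := (\int[P]_w f w).

Lemma ExD f g : all_moments f -> all_moments g ->
  \int[P]_w (f w + g w) = E f + E g.
Proof. by move=> mf mg; rewrite RintegralD//; exact: all_moments_integrable. Qed.

Lemma ExZ (r : R) f : all_moments f -> \int[P]_w (r * f w) = r * E f.
Proof. by move=> mf; rewrite RintegralZl//; exact: all_moments_integrable. Qed.

Lemma ExB f g : all_moments f -> all_moments g ->
  \int[P]_w (f w - g w) = E f - E g.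
Proof. by move=> mf mg; rewrite RintegralB//; exact: all_moments_integrable. Qed.

Lemma Ex_cst (r : R) : \int[P]_w r = r.
Proof. rewrite Rintegral_cst// -[RHS]mulr1; congr (_ * _).
exact: (congr1 fine (probability_setT P)). Qed.

Lemma Ex_sum (I : Type) (s : seq I) (Q : pred I) (F : I -> T -> R) :
  (forall i, all_moments (F i)) ->
  \int[P]_w (\sum_(i <- s | Q i) F i w) = \sum_(i <- s | Q i) E (F i).
Proof.
move=> mF; elim: s => [|i s ih].
  by under eq_Rintegral do rewrite big_nil; rewrite big_nil Ex_cst.
under eq_Rintegral do rewrite big_cons.
rewrite big_cons; case: (Q i) => //.
by rewrite ExD ?ih//; exact: all_moments_sum.
Qed.

Lemma Ex_le f g : all_moments f -> all_moments g -> (forall w, f w <= g w) ->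
  E f <= E g.
Proof.
by move=> mf mg fg; apply: le_Rintegral => //; exact: all_moments_integrable.
Qed.

End Moments.

(** * Integration against the normal law *)

Section NormalDensity.
Context {R : realType}.
Variables (m s : R).
Local Notation mu := (@lebesgue_measure R).
Local Notation N := (normal_prob m s).

Lemma normal_derivative_ae :
  ae_eq mu setT (Radon_Nikodym_SigmaFinite.f N mu) (EFin \o normal_pdf m s).
Proof.
have Nmu := normal_prob_dominates m s.
apply: integral_ae_eq => //.
- exact: Radon_Nikodym_SigmaFinite.f_integrable.
- by apply/measurable_EFinP; exact: measurable_normal_pdf.
- by move=> A AE mA; rewrite -Radon_Nikodym_SigmaFinite.f_integral.
Qed.

Lemma ge0_integral_normal (f : R -> \bar R) : measurable_fun setT f ->
  (forall x, 0 <= f x)%E ->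
  (\int[N]_x f x = \int[mu]_x (f x * (normal_pdf m s x)%:E))%E.
Proof.
move=> mf f0; have Nmu := normal_prob_dominates m s.
rewrite -(Radon_Nikodym_SigmaFinite.change_of_variables Nmu)//.
apply: ae_eq_integral => //.
- apply: emeasurable_funM => //; apply: measurable_int.
  exact: Radon_Nikodym_SigmaFinite.f_integrable.
- apply: emeasurable_funM => //.
  by apply/measurable_EFinP; exact: measurable_normal_pdf.
- by apply: ae_eqe_mul2l; exact: normal_derivative_ae.
Qed.

Lemma integrable_normal (f : R -> R) : measurable_fun setT f ->
  mu.-integrable setT (fun x => (f x * normal_pdf m s x)%:E) ->
  N.-integrable setT (EFin \o f).
Proof.
move=> mf /integrableP[_ ifoo]; apply/integrableP; split.
  exact/measurable_EFinP.
rewrite ge0_integral_normal//; last exact/measurableT_comp/measurable_EFinP.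
apply: le_lt_trans ifoo; rewrite le_eqVlt; apply/orP; left; apply/eqP.
apply: eq_integral => x _ /=.
by rewrite -EFinM normrM (ger0_norm (normal_pdf_ge0 _ _ _)).
Qed.

Lemma Rintegral_normal (f : R -> R) : measurable_fun setT f ->
  mu.-integrable setT (fun x => (f x * normal_pdf m s x)%:E) ->
  \int[N]_x f x = \int[mu]_x (f x * normal_pdf m s x).
Proof.
move=> mf ifp; congr fine.
rewrite integralE [RHS]integralE; congr (_ - _)%E.
- rewrite ge0_integral_normal//; last exact/measurable_funepos/measurable_EFinP.
  apply: eq_integral => x _.
  rewrite !funeposE -!EFin_max -EFinM maxr_pMl ?normal_pdf_ge0//.
  by rewrite mul0r.
- rewrite ge0_integral_normal//; last exact/measurable_funeneg/measurable_EFinP.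
  apply: eq_integral => x _.
  rewrite !funenegE -!EFinN -!EFin_max -EFinM maxr_pMl ?normal_pdf_ge0//.
  by rewrite mul0r mulNr.
Qed.

End NormalDensity.

(** * Moments of the normal law *)

Lemma cvg_div_natr {R : realType} (C : R) : C / n%:R @[n --> \oo] --> 0.
Proof.
rewrite -(mulr0 C); apply: cvgM; first exact: cvg_cst.
by rewrite -(cvg_shiftS (fun n : nat => n%:R^-1 : R)); exact: cvg_harmonic.
Qed.

Section IntegralOfDerivative.
Context {R : realType}.
Variable m : R.
Local Notation mu := (@lebesgue_measure R).

Lemma cvg_integral_symitv (h : R -> R) : mu.-integrable setT (EFin \o h) ->
  (\int[mu]_(x in `[(m - n%:R)%R, (m + n%:R)%R]) (h x)%:E)%E @[n --> \oo] -->
  (\int[mu]_x (h x)%:E)%E.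
Proof.
move=> ih.
have mh := measurable_int _ ih.
pose F n := (EFin \o h) \_ `[(m - n%:R : R), m + n%:R].
have [//||||_ _] := @dominated_convergence _ _ _ mu setT measurableT
  F (EFin \o h) (abse \o (EFin \o h)) _ mh.
- move=> n; apply/(measurable_restrictT (EFin \o h)) => //.
  exact: measurable_funS mh.
- apply: aeW => x _; apply: cvg_near_cst.
  exists (Num.truncn `|x - m|).+1 => // n /= xn.
  rewrite /F patchE mem_set//= in_itv /= -ler_distlC.
  rewrite distrC (le_trans (ltW (truncnS_gt _)))// ler_nat//.
- exact: integrable_abse.
- apply: aeW => x n _; rewrite /F patchE; case: ifPn => // _.
  by rewrite /= normr0 lee_fin.
apply: cvg_trans; apply: near_eq_cvg; apply: nearW => n.
by rewrite /= [RHS]integral_mkcond.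
Qed.

(** The boundary terms vanish because the primitive is O(1/|x - m|). *)
Lemma integral_derive_eq0 (G h : R -> R) (C : R) :
  (forall x : R, is_derive x (1 : R) G (h x)) -> continuous h ->
  mu.-integrable setT (EFin \o h) ->
  (forall x, `|x - m| * `|G x| <= C) -> \int[mu]_x h x = 0.
Proof.
move=> dG ch ih GC.
suff : (\int[mu]_x (h x)%:E)%E = 0%E by rewrite /Rintegral => ->.
have c1 := cvg_integral_symitv ih.
rewrite -(cvg_lim _ c1)//; apply/cvg_lim => //.
have cG : continuous G.
  move=> x; apply: differentiable_continuous; apply/derivable1_diffP.
  by have [] := dG x.
have FTC n : (0 < n)%N ->
    (\int[mu]_(x in `[(m - n%:R)%R, (m + n%:R)%R]) (h x)%:E =
     (G (m + n%:R))%:E - (G (m - n%:R))%:E)%E.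
  move=> n0; apply: continuous_FTC2.
  - by rewrite ler_ltD// gtrN// ltr0n.
  - exact: continuous_subspaceT.
  - split.
    + by move=> x _; have [] := dG x.
    + by apply: cvg_at_right_filter; exact: cG.
    + by apply: cvg_at_left_filter; exact: cG.
  - by move=> x _; rewrite derive1E; have [_ ->] := dG x.
apply: (@squeeze_cvge _ _ _ _ (fun n => (- (2 * C / n%:R))%:E) _
   (fun n => (2 * C / n%:R)%:E)).
- exists 1 => // n /= n0; rewrite FTC// -EFinB !lee_fin -ler_norml.
  rewrite (le_trans (ler_normB _ _))// mulr_natl mulr2n mulrDl lerD//.
    rewrite ler_pdivlMr ?ltr0n// mulrC; have := GC (m + n%:R).
    by rewrite addrAC subrr add0r [`|n%:R|]ger0_norm.
  rewrite ler_pdivlMr ?ltr0n// mulrC; have := GC (m - n%:R).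
  by rewrite addrAC subrr add0r normrN [`|n%:R|]ger0_norm.
- apply: cvg_EFin; first exact: nearW.
  rewrite -oppr0; apply: cvgN; exact: cvg_div_natr.
- by apply: cvg_EFin; [exact: nearW|exact: cvg_div_natr].
Qed.

End IntegralOfDerivative.

Section NormalMoments.
Context {R : realType}.
Variables (m s : R).
Hypothesis s0 : s != 0.
Local Notation mu := (@lebesgue_measure R).
Local Notation N := (normal_prob m s).
Local Notation p := (normal_pdf m s).

Let v := s ^+ 2.
Let v_gt0 : 0 < v. Proof. by rewrite /v exprn_even_gt0. Qed.

Lemma normal_pdf0E (x : R) : p x = normal_peak s * expR (- ((x - m) ^+ 2 / (2 * v))).
Proof.
by rewrite normal_pdfE// /normal_fun mulNr mulr_natl.
Qed.

(** A polynomial factor is absorbed by doubling the variance. *)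
Lemma pow_normal_pdf_le (k : nat) : exists C : R, forall x,
  `|(x - m) ^+ k * p x| <= C * normal_pdf m (s * Num.sqrt 2) x.
Proof.
have w0 : s * Num.sqrt 2 != 0.
  by rewrite mulf_neq0// gt_eqF// sqrtr_gt0.
pose q := normal_peak (s * Num.sqrt 2).
have q0 : 0 < q by exact: normal_peak_gt0.
have e0 : 0 < normal_peak s by exact: normal_peak_gt0.
pose A := 1 + (k`!)%:R * (4 * v) ^+ k.
exists (normal_peak s / q * A) => x.
pose z := (x - m) ^+ 2 / (4 * v).
have z0 : 0 <= z by rewrite /z divr_ge0 ?sqr_ge0// mulr_ge0// ltW.
have -> : normal_pdf m (s * Num.sqrt 2) x = q * expR (- z).
  rewrite (normal_pdfE _ w0) /normal_fun [(s * _) ^+ 2]exprMn sqr_sqrtr//.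
  rewrite mulNr -/v /q /z; congr (_ * expR (- (_ / _))).
  by rewrite mulr2n; ring.
have -> : normal_peak s / q * A * (q * expR (- z)) =
    normal_peak s * (A * expR (- z)).
  by field; rewrite gt_eqF.
have -> : (x - m) ^+ k * p x = normal_peak s * ((x - m) ^+ k * expR (- (z + z))).
  rewrite normal_pdf0E mulrCA; congr (_ * (_ * expR (- _))).
  by rewrite /z; field; rewrite gt_eqF.
rewrite normrM (gtr0_norm e0) ler_pM2l// normrM (gtr0_norm (expR_gt0 _)).
rewrite [- (z + z)]opprD expRD mulrA ler_pM2r ?expR_gt0//.
rewrite expRN ler_pdivrMr ?expR_gt0//.
have ez : 1 <= expR z by rewrite -expR0 ler_expR.
have zk : z ^+ k <= (k`!)%:R * expR z.
  case: (k) => [|j]; first by rewrite expr0 fact0 mul1r.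
  have := expR_ge1Dxn j z0.
  move=> h; rewrite mulrC -ler_pdivrMr ?ltr0n ?fact_gt0//.
  by apply: le_trans h; rewrite lerDr.
have xz : `|x - m| ^+ k ^+ 2 = z ^+ k * (4 * v) ^+ k.
  rewrite -exprMn; have -> : z * (4 * v) = `|x - m| ^+ 2.
    by rewrite real_normK ?num_real// /z divfK// gt_eqF// mulr_gt0.
  by rewrite -[RHS]exprM mulnC exprM.
have hx : `|(x - m) ^+ k| <= 1 + z ^+ k * (4 * v) ^+ k.
  rewrite -xz normrX; set y := `|x - m| ^+ k.
  have : 0 <= y by rewrite exprn_ge0.
  nra.
apply: (le_trans hx).
rewrite /A [leRHS]mulrDl mul1r lerD// mulrAC ler_pM2r// exprn_gt0// mulr_gt0//.
Qed.

Lemma integrable_pow_normal_pdf (k : nat) :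
  mu.-integrable setT (fun x => ((x - m) ^+ k * p x)%:E).
Proof.
have [C hC] := pow_normal_pdf_le k.
apply: (@le_integrable _ _ _ mu setT _ _
   (fun x => C%:E * (normal_pdf m (s * Num.sqrt 2) x)%:E)%E) => //.
- apply/measurable_EFinP/measurable_funM; first by apply: measurable_funX; exact: measurable_funB.
  exact: measurable_normal_pdf.
- move=> x _; rewrite -EFinM !abse_EFin lee_fin (le_trans (hC x))//.
  exact: ler_norm.
- by apply: integrableZl => //; exact: integrable_normal_pdf.
Qed.

Lemma integrable_pow_normal (k : nat) :
  N.-integrable setT (fun x => ((x - m) ^+ k)%:E).
Proof.
apply: integrable_normal; first by apply: measurable_funX; exact: measurable_funB.
exact: integrable_pow_normal_pdf.
Qed.

Let g (k : nat) (x : R) : R := (x - m) ^+ k * p x.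

Let is_derive_pdf (x : R) : is_derive x 1 p (- ((x - m) / v) * p x).
Proof.
have h : is_derive x 1 (- ((@id R - cst m) ^+ 2 * cst (2 * v)^-1)) (- ((x - m) / v)).
  apply: is_derive_eq; rewrite /GRing.scale /= !fctE.
  by field; rewrite gt_eqF.
have -> : p = cst (normal_peak s) *
    (expR \o (- ((@id R - cst m) ^+ 2 * cst (2 * v)^-1))).
  by apply/funext => y; rewrite normal_pdf0E.
apply: is_derive_eq.
rewrite /GRing.scale /= /cst !fctE.
by ring.
Qed.

Let is_derive_g (k : nat) (x : R) :
  is_derive x 1 (g k.+1) (k.+1%:R * g k x - g k.+2 x / v).
Proof.
have -> : g k.+1 = ((@id R - cst m) ^+ k.+1) * p by apply/funext => y; rewrite /g !fctE.
have h := is_derive_pdf x.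
apply: is_derive_eq.
rewrite /g /GRing.scale /= !fctE !exprS /=.
by field; rewrite gt_eqF.
Qed.

Let gi j : mu.-integrable setT (EFin \o g j).
Proof. exact: integrable_pow_normal_pdf. Qed.

Let NE j : \int[N]_x ((x - m) ^+ j) = \int[mu]_x (g j x).
Proof.
rewrite Rintegral_normal//; last exact: integrable_pow_normal_pdf.
by apply: measurable_funX; exact: measurable_funB.
Qed.

Let g_cont j : continuous (g j).
Proof.
move=> x; apply: differentiable_continuous; apply/derivable1_diffP.
case: j => [|j]; last by have [] := is_derive_g j x.
have -> : g 0 = p by apply/funext => y; rewrite /g expr0 mul1r.
by have [] := is_derive_pdf x.
Qed.

Let g_bounded (k : nat) : exists C : R, forall x, `|x - m| * `|g k x| <= C.
Proof.
have [C hC] := pow_normal_pdf_le k.+1.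
exists (`|C| * normal_peak (s * Num.sqrt 2)) => x.
rewrite -normrM /g mulrA -exprS.
apply: (le_trans (hC x)); apply: (le_trans (ler_norm _)).
rewrite normrM ler_wpM2l// ger0_norm ?normal_pdf_ge0// normal_pdf_ub//.
by rewrite mulf_neq0// gt_eqF// sqrtr_gt0.
Qed.

Lemma normal_mean : \int[N]_x (x - m) = 0.
Proof.
have := NE 1; under eq_Rintegral do rewrite expr1; move=> ->.
have [C hC] := g_bounded 0.
have i1 : mu.-integrable setT (EFin \o (fun x => - v^-1 * g 1 x)).
  by have := integrableZl measurableT (- v^-1) (gi 1).
have : \int[mu]_x (- v^-1 * g 1 x) = 0.
  apply: integral_derive_eq0 i1 hC => [x|x].
    have -> : g 0 = p by apply/funext => y; rewrite /g expr0 mul1r.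
    have h := is_derive_pdf x; apply: is_derive_eq.
    by rewrite /g expr1; ring.
  by apply: cvgM; [exact: cvg_cst|exact: g_cont].
rewrite RintegralZl// => /eqP; rewrite mulf_eq0 oppr_eq0 invr_eq0.
by rewrite gt_eqF//= => /eqP.
Qed.

(** Integration by parts against the Gaussian weight. *)
Lemma normal_moment_rec (k : nat) :
  \int[N]_x ((x - m) ^+ k.+2) = k.+1%:R * v * \int[N]_x ((x - m) ^+ k).
Proof.
pose h x := k.+1%:R * g k x - g k.+2 x / v.
have i1 : mu.-integrable setT (EFin \o (fun x => k.+1%:R * g k x)).
  by have := integrableZl measurableT k.+1%:R (gi k).
have i2 : mu.-integrable setT (EFin \o (fun x => g k.+2 x / v)).
  by have := integrableZr measurableT v^-1 (gi k.+2).
have ih : mu.-integrable setT (EFin \o h) := integrableB measurableT i1 i2.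
have [C hC] := g_bounded k.+1.
have h0 : \int[mu]_x (h x) = 0.
  apply: integral_derive_eq0 ih hC => [x|x]; first exact: is_derive_g.
  apply: cvgB.
    by apply: cvgM; [exact: cvg_cst|exact: g_cont].
  by apply: cvgM; [exact: g_cont|exact: cvg_cst].
move: h0; rewrite RintegralB// RintegralZl// RintegralZr// -!NE => /eqP.
by rewrite subr_eq0 => /eqP h1; rewrite mulrAC h1; field; rewrite gt_eqF.
Qed.

End NormalMoments.

(** * Moments of Gaussian random variables *)

Section GaussianLaw.
Context {R : realType} {d : measure_display} {T : measurableType d}.
Variable P : probability T R.

Lemma integrable_law (N : probability (measurableTypeR R) R) (Y : T -> R)
    (f : R -> R) :
  measurable_fun setT Y -> measurable_fun setT f ->
  (forall A : set R, measurable A -> P (Y @^-1` A) = N A) ->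
  N.-integrable setT (EFin \o f) -> P.-integrable setT (EFin \o (f \o Y)).
Proof.
move=> mY mf hN /integrableP[_ ioo]; apply/integrableP; split.
  exact/measurable_EFinP/measurableT_comp.
have := @ge0_integral_pushforward _ _ T (measurableTypeR R) R Y mY P setT (abse \o (EFin \o f)).
rewrite preimage_setT => <-//; last first.
  by move=> y _; exact: abse_ge0.
  apply: measurableT_comp => //; exact/measurable_EFinP.
apply: le_lt_trans ioo; rewrite le_eqVlt; apply/orP; left; apply/eqP.
by apply: eq_measure_integral => A mA _; exact: hN.
Qed.

Lemma Ex_law (N : probability (measurableTypeR R) R) (Y : T -> R)
    (f : R -> R) :
  measurable_fun setT Y -> measurable_fun setT f ->
  (forall A : set R, measurable A -> P (Y @^-1` A) = N A) ->
  N.-integrable setT (EFin \o f) -> \int[P]_w f (Y w) = \int[N]_x f x.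
Proof.
move=> mY mf hN fi; have iP := integrable_law mY mf hN fi.
congr fine.
have mEf : measurable_fun setT (EFin \o f) by exact/measurable_EFinP.
have := @integral_pushforward _ _ T (measurableTypeR R) R Y mY P setT (EFin \o f) mEf.
rewrite preimage_setT => /(_ iP measurableT) <-.
by apply: eq_measure_integral => A mA _; exact: hN.
Qed.

Variable Y : T -> R.
Hypotheses (mY : measurable_fun setT Y) (gY : gaussian P Y).

(** The degenerate law [s = 0] is a Dirac mass and obeys the same recursion as
the normal laws, both sides being zero. *)
Lemma gaussian_moments : exists m s : R,
  [/\ all_moments P Y, \int[P]_w Y w = m &
    forall k, \int[P]_w (Y w - m) ^+ k.+2 =
      k.+1%:R * s ^+ 2 * \int[P]_w (Y w - m) ^+ k].
Proof.
have [m [s hms]] := gY; exists m, s; have [sE|s0] := eqVneq s 0.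
  pose dm : probability (measurableTypeR R) R := @dirac _ (measurableTypeR R) m R.
  have hd A : measurable A -> P (Y @^-1` A) = dm A.
    by move=> mA; rewrite hms// sE eqxx.
  have id f : measurable_fun setT f -> dm.-integrable setT (EFin \o f).
    move=> mf; apply/integrableP; split; first exact/measurable_EFinP.
    rewrite integral_dirac// ?diracT ?mul1e ?ltry//.
    by apply: measurableT_comp => //; exact/measurable_EFinP.
  have Ed f : measurable_fun setT f -> \int[P]_w f (Y w) = f m.
    move=> mf; rewrite (Ex_law mY mf hd (id _ mf)) /Rintegral integral_dirac//=.
      by rewrite indicT mul1r.
    exact/measurable_EFinP.
  split.
  - split=> // k.
    have mk : measurable_fun setT (fun x : R => `|x| ^+ k).
      by apply: measurable_funX; exact: normr_measurable.
    exact: (integrable_law mY mk hd (id _ mk)).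
  - exact: (Ed idfun (@measurable_id _ _ setT)).
  - have mX j : measurable_fun setT (fun x : R => (x - m) ^+ j).
      by apply: measurable_funX; exact: measurable_funB.
  move=> k; rewrite (Ed _ (mX k.+2)) (Ed _ (mX k)) subrr sE.
  by rewrite [0 ^+ 2]expr0n [0 ^+ k.+2]expr0n /= mulr0 mul0r.
have hN A : measurable A -> P (Y @^-1` A) = normal_prob m s A.
  by move=> mA; rewrite hms// (negbTE s0).
have mX j : measurable_fun setT (fun x : R => (x - m) ^+ j).
  by apply: measurable_funX; exact: measurable_funB.
have cX j : \int[P]_w (Y w - m) ^+ j = \int[normal_prob m s]_x (x - m) ^+ j.
  by rewrite (Ex_law mY (mX j) hN)//; exact: integrable_pow_normal.
have aY : all_moments P (fun w => Y w - m).
  apply: (@all_moments_dom _ _ _ _ _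
    (fun k w => 1 + (Y w - m) ^+ (2 * k))) => [|k|k w].
  - exact: measurable_funB.
  - have i1 : P.-integrable setT (EFin \o (cst 1 : T -> R)).
      exact: finite_measure_integrable_cst.
    have i2 := integrable_law mY (mX (2 * k)%N) hN (integrable_pow_normal m s0 (2 * k)).
    exact: (integrableD measurableT i1 i2).
  - rewrite mulnC exprM; set y := Y w - m.
    rewrite -[y ^+ k ^+ 2]real_normK ?num_real// normrX.
    have : 0 <= (`|y| ^+ k - 1) ^+ 2 by exact: sqr_ge0.
    have : 0 <= `|y| ^+ k by rewrite exprn_ge0.
    nra.
have aY' : all_moments P Y.
  have := all_momentsD aY (all_moments_cst P m).
  by congr all_moments; apply/funext => w /=; rewrite subrK.
split=> //.
- have : \int[P]_w (Y w - m) = 0.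
    rewrite -(normal_mean m s0).
    have := cX 1; under eq_Rintegral do rewrite expr1.
    by under [RHS]eq_Rintegral do rewrite expr1.
  rewrite ExB// ?Ex_cst; last exact: all_moments_cst.
  by move=> /eqP; rewrite subr_eq0 => /eqP.
- by move=> k; rewrite !cX normal_moment_rec.
Qed.

Lemma gaussian_all_moments : all_moments P Y.
Proof. by have [m [s []]] := gaussian_moments. Qed.

(** Written without [s], the recursion shows that the moments of a centred
Gaussian variable are functions of its variance. *)
Lemma centered_gaussian_moment_rec (k : nat) : \int[P]_w Y w = 0 ->
  \int[P]_w Y w ^+ k.+2 = k.+1%:R * \int[P]_w Y w ^+ 2 * \int[P]_w Y w ^+ k.
Proof.
have [m [s [aY ->]]] := gaussian_moments => rec m0; move: rec; rewrite m0.
have E0 j : \int[P]_w (Y w - 0) ^+ j = \int[P]_w Y w ^+ j.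
  by under eq_Rintegral do rewrite subr0.
move=> rec; have := rec 0; have := rec k; rewrite !E0 => ->.
under [X in _ = _ * X]eq_Rintegral do rewrite expr0.
by rewrite Ex_cst mulr1 mul1r => ->.
Qed.

End GaussianLaw.

(** * Gaussian integration by parts *)

Section PolynomialCoefficients.
Context {R : realType}.

Lemma poly_funext (p q : {poly R}) : (forall t, p.[t] = q.[t]) -> p = q.
Proof.
move=> pq; apply/eqP; rewrite -subr_eq0; apply/negPn/negP => r0.
have := @max_poly_roots R (p - q) [seq (i%:R : R) | i <- iota 0 (size (p - q))] r0.
rewrite size_map size_iota ltnn => /(_ _ _)/negP; apply => //.
  by apply/allP => t _; rewrite /root hornerD hornerN pq subrr.
rewrite map_inj_uniq ?iota_uniq// => i j /eqP.
by rewrite eqr_nat => /eqP.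
Qed.

Lemma coef1M (p q : {poly R}) : (p * q)`_1 = p`_0 * q`_1 + p`_1 * q`_0.
Proof. by rewrite coefM !big_ord_recl big_ord0 addr0. Qed.

End PolynomialCoefficients.

Section Stein.
Context {R : realType} {d : measure_display} {T : measurableType d}.
Variable P : probability T R.
Variables (V : lmodType R) (Y : V -> T -> R).
Hypothesis YD : forall (t : R) u v w, Y (u + t *: v) w = Y u w + t * Y v w.
Hypothesis Ym : forall v, measurable_fun setT (Y v).
Hypothesis Yg : forall v, gaussian P (Y v).
Hypothesis Y0 : forall v, \int[P]_w Y v w = 0.
Local Notation E f := (\int[P]_w f w).
Local Notation moments := (all_moments P).

Ltac moments :=
  repeat first [assumption | solve [auto] | exact: all_moments_cst
  | apply: all_momentsD | apply: all_momentsB | apply: all_momentsX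
  | apply: all_momentsM].

Let aY v : moments (Y v).
Proof. exact: gaussian_all_moments. Qed.

Definition covform (u v : V) : R := \int[P]_w (Y u w * Y v w).

Definition mon (m : seq V) (w : T) : R := \prod_(v <- m) Y v w.

(** The derivative of [mon m] in the direction of the covector [covform u]. *)
Fixpoint dmon (u : V) (m : seq V) (w : T) : R :=
  if m is v :: m' then covform u v * mon m' w + Y v w * dmon u m' w else 0.

Let amon m : moments (mon m).
Proof. exact: all_moments_prod. Qed.

Let admon u m : moments (dmon u m).
Proof.
elim: m => [|v m ih] /=; first exact: all_moments_cst.
by apply: all_momentsD; [exact: all_momentsZ|exact: all_momentsM].
Qed.

(** The polynomial t |-> E (Y (u + t v) ^ a g). Identities between such moments
that hold for all [t] are compared coefficient by coefficient, which polarises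
statements about the powers of a single variable. *)
Definition shiftpoly (u v : V) (a : nat) (g : T -> R) : {poly R} :=
  \poly_(i < a.+1) (\int[P]_w (Y u w ^+ (a - i) * Y v w ^+ i * g w) *+ 'C(a, i)).

Lemma horner_shiftpoly u v a g t : moments g ->
  (shiftpoly u v a g).[t] = \int[P]_w (Y (u + t *: v) w ^+ a * g w).
Proof.
move=> ag.
have aM i : moments (fun w => Y u w ^+ (a - i) * Y v w ^+ i * g w).
  by apply: all_momentsM => //; apply: all_momentsM; exact: all_momentsX.
rewrite horner_poly.
transitivity (\int[P]_w (\sum_(i < a.+1)
    (t ^+ i * 'C(a, i)%:R) * (Y u w ^+ (a - i) * Y v w ^+ i * g w))).
  rewrite Ex_sum => [|i]; last exact: all_momentsZ.
  by apply: eq_bigr => i _; rewrite ExZ// -mulr_natr; ring.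
apply: eq_Rintegral => w _; rewrite YD exprDn mulr_suml.
apply: eq_bigr => i _; rewrite exprMn -mulr_natr; ring.
Qed.

Lemma shiftpoly_coef0 u v a g :
  (shiftpoly u v a g)`_0 = \int[P]_w (Y u w ^+ a * g w).
Proof.
rewrite coef_poly /= bin0 mulr1n subn0.
by apply: eq_Rintegral => w _; rewrite expr0 mulr1.
Qed.

Lemma shiftpoly_coef1 u v a g :
  (shiftpoly u v a g)`_1 = a%:R * \int[P]_w (Y u w ^+ a.-1 * Y v w * g w).
Proof.
rewrite coef_poly; case: a => [|a] /=; first by rewrite mul0r.
rewrite bin1 -[LHS]mulr_natl; congr (_ * _).
by apply: eq_Rintegral => w _; rewrite subn1.
Qed.

Let m_ (v : V) a := \int[P]_w (Y v w ^+ a).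

Let mrec v a : m_ v a.+2 = a.+1%:R * covform v v * m_ v a.
Proof.
by rewrite /m_ centered_gaussian_moment_rec.
Qed.

(** The left side is, up to a factor, the linear coefficient of the moments of
[Y (v + t u)]. These are functions of the variance, a quadratic polynomial in [t]
with linear coefficient [2 * covform u v]; no joint law is involved. *)
Lemma stein_pow u v a :
  \int[P]_w (Y u w * Y v w ^+ a) = a%:R * covform u v * m_ v a.-1.
Proof.
pose p k := shiftpoly v u k (cst 1).
pose q : {poly R} := Poly [:: covform v v; 2 * covform u v; covform u u].
have a1 : moments (cst 1) by exact: all_moments_cst.
have hp k t : (p k).[t] = m_ (v + t *: u) k.
  by rewrite horner_shiftpoly//; apply: eq_Rintegral => w _; rewrite mulr1.
have hq t : q.[t] = covform (v + t *: u) (v + t *: u).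
  rewrite horner_Poly /= /covform mul0r add0r.
  transitivity (\int[P]_w (t ^+ 2 * (Y u w * Y u w) +
     ((2 * t) * (Y u w * Y v w) + Y v w * Y v w))); last first.
    by apply: eq_Rintegral => w _; rewrite YD; ring.
  have auv x y : moments (fun w => Y x w * Y y w) by exact: all_momentsM.
  have auvZ t' x y : moments (fun w => t' * (Y x w * Y y w)) by exact: all_momentsZ.
  by rewrite !ExD ?ExZ//; [ring|exact: all_momentsD].
have prec k : p k.+2 = k.+1%:R%:P * (q * p k).
  by apply: poly_funext => t; rewrite !hornerM hornerC !hp hq mrec mulrA.
have p0 k : (p k)`_0 = m_ v k.
  by rewrite shiftpoly_coef0; apply: eq_Rintegral => w _; rewrite mulr1.
have p1 k : (p k)`_1 = k%:R * \int[P]_w (Y u w * Y v w ^+ k.-1).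
  rewrite shiftpoly_coef1; congr (_ * _); apply: eq_Rintegral => w _.
  by rewrite mulr1 mulrC.
have drec k : (p k.+2)`_1 = k.+1%:R * (2 * covform u v * m_ v k + covform v v * (p k)`_1).
  rewrite prec coefCM coef1M p0; congr (_ * _).
  by rewrite /q !coef_Poly /=; ring.
have m1 : m_ v 1 = 0 by rewrite -[RHS](Y0 v); apply: eq_Rintegral => w _; rewrite expr1.
have d1 : (p 1)`_1 = 0.
  rewrite p1 mul1r -[RHS](Y0 u); apply: eq_Rintegral => w _.
  by rewrite expr0 mulr1.
have d0 : (p 0)`_1 = 0 by rewrite p1 mul0r.
suff dE k : (p k.+2)`_1 = k.+2%:R * k.+1%:R * covform u v * m_ v k /\
            (p k.+3)`_1 = k.+3%:R * k.+2%:R * covform u v * m_ v k.+1.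
  case: a => [|a]; first by under eq_Rintegral do rewrite expr0 mulr1; rewrite Y0 !mul0r.
  have [h _] := dE a; move: h; rewrite p1 -!mulrA => /mulfI -> //.
elim: k => [|k [ih1 ih2]].
  by rewrite !drec d0 d1 m1 !(mulr0, addr0); split => //; ring.
split=> //; rewrite drec ih1 mrec -!natr1; ring.
Qed.

(** Induction on [m]: replacing [v] by [v + t v'] in the case of [m] and comparing
the coefficients of [t] brings in one more factor [Y v']. *)
Lemma stein_mon_pow m u v a :
  \int[P]_w (Y u w * Y v w ^+ a * mon m w) =
  a%:R * covform u v * \int[P]_w (Y v w ^+ a.-1 * mon m w) +
  \int[P]_w (Y v w ^+ a * dmon u m w).
Proof.
elim: m u v a => [|v' m ih] u v a.
  have -> : \int[P]_w (Y v w ^+ a * dmon u [::] w) = 0.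
    by under eq_Rintegral do rewrite /= mulr0; rewrite Ex_cst.
  rewrite addr0; under eq_Rintegral do rewrite /mon big_nil mulr1.
  rewrite stein_pow; congr (_ * _).
  by apply: eq_Rintegral => w _; rewrite /mon big_nil mulr1.
pose gm w := Y u w * mon m w.
have agm : moments gm by exact: all_momentsM.
pose q : {poly R} := Poly [:: covform u v; covform u v'].
have hq t : q.[t] = covform u (v + t *: v').
  rewrite horner_Poly /= /covform mul0r add0r mulrC.
  have auv x y : moments (fun w => Y x w * Y y w) by exact: all_momentsM.
  rewrite -ExZ// addrC -ExD//; last exact: all_momentsZ.
  by apply: eq_Rintegral => w _; rewrite YD; ring.
have := poly_funext (p := shiftpoly v v' a.+1 gm)
  (q := a.+1%:R%:P * (q * shiftpoly v v' a (mon m)) + shiftpoly v v' a.+1 (dmon u m)).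
move=> /(_ _)/(congr1 (fun p : {poly R} => p`_1)) => H.
have {H} := H _.
rewrite coefD coefCM coef1M !shiftpoly_coef1 !shiftpoly_coef0 /q !coef_Poly /= => H.
apply: (@mulfI _ a.+1%:R); first by rewrite pnatr_eq0.
transitivity (a.+1%:R * \int[P]_w (Y v w ^+ a * Y v' w * gm w)).
  congr (_ * _); apply: eq_Rintegral => w _; rewrite /mon big_cons /gm /mon.
  by ring.
rewrite H => [|t]; last first.
  rewrite hornerD !hornerM hornerC hq !horner_shiftpoly// mulrA -ih.
  by apply: eq_Rintegral => w _; rewrite /gm; ring.
rewrite mulrDr.
have -> : \int[P]_w (Y v w ^+ a * (covform u v' * mon m w + Y v' w * dmon u m w)) =
   covform u v' * \int[P]_w (Y v w ^+ a * mon m w) +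
   \int[P]_w (Y v w ^+ a * Y v' w * dmon u m w).
  have h1 : moments (fun w => Y v w ^+ a * mon m w).
    by apply: all_momentsM => //; exact: all_momentsX.
  rewrite -ExZ// -ExD//; last 2 first.
  - exact: all_momentsZ.
  - by apply: all_momentsM => //; apply: all_momentsM => //; exact: all_momentsX.
  by apply: eq_Rintegral => w _; ring.
have -> : \int[P]_w (Y v w ^+ a.-1 * mon (v' :: m) w) =
  \int[P]_w (Y v w ^+ a.-1 * Y v' w * mon m w).
  by apply: eq_Rintegral => w _; rewrite /mon big_cons mulrA.
ring.
Qed.

(** [dh] is the derivative of [h], seen as a polynomial in the Gaussian
variables; the test against monomials makes the class closed under
multiplication by a Gaussian variable. *)
Definition stein (h : T -> R) (dh : V -> T -> R) :=
  [/\ moments h, forall u, moments (dh u) &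
  forall m u, \int[P]_w (Y u w * h w * mon m w) =
    \int[P]_w (dh u w * mon m w) + \int[P]_w (h w * dmon u m w)].

Lemma stein_cst r : stein (cst r) (fun _ => cst 0).
Proof.
split=> [|u|m u]; [exact: all_moments_cst|exact: all_moments_cst|].
have := stein_mon_pow m u u 0; rewrite mul0r mul0r add0r => h.
transitivity (r * \int[P]_w (Y u w * Y u w ^+ 0 * mon m w)).
  rewrite -ExZ; last by apply: all_momentsM => //; apply: all_momentsM => //; exact: all_momentsX.
  by apply: eq_Rintegral => w _; rewrite /cst expr0; ring.
rewrite h; under [X in _ = X + _]eq_Rintegral do rewrite mul0r.
rewrite Ex_cst add0r -ExZ; last by apply: all_momentsM => //; exact: all_momentsX.
by apply: eq_Rintegral => w _; rewrite expr0 mul1r.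
Qed.

Lemma steinD h1 dh1 h2 dh2 : stein h1 dh1 -> stein h2 dh2 ->
  stein (fun w => h1 w + h2 w) (fun u w => dh1 u w + dh2 u w).
Proof.
move=> [a1 b1 e1] [a2 b2 e2]; split=> [|u|m u]; [by moments|by moments|].
under eq_Rintegral do rewrite mulrDr mulrDl.
under [X in _ = X + _]eq_Rintegral do rewrite mulrDl.
under [X in _ = _ + X]eq_Rintegral do rewrite mulrDl.
rewrite !ExD ?e1 ?e2; try by moments.
ring.
Qed.

Lemma steinM v h dh : stein h dh ->
  stein (fun w => Y v w * h w) (fun u w => covform u v * h w + Y v w * dh u w).
Proof.
move=> [a1 b1 e1].
split=> [|u|m u]; [by moments|by moments|].
transitivity (\int[P]_w (Y u w * h w * mon (v :: m) w)).
  by apply: eq_Rintegral => w _; rewrite /mon big_cons; ring.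
rewrite e1 /=; have -> : \int[P]_w (dh u w * mon (v :: m) w) =
    \int[P]_w (Y v w * dh u w * mon m w).
  by apply: eq_Rintegral => w _; rewrite /mon big_cons; ring.
under [X in _ + X = _]eq_Rintegral do rewrite mulrDr.
under [X in _ = X + _]eq_Rintegral do rewrite mulrDl.
rewrite !ExD; try by moments.
rewrite -[RHS]addrA [RHS]addrCA; congr (_ + (_ + _)).
  by apply: eq_Rintegral => w _; ring.
by apply: eq_Rintegral => w _; ring.
Qed.

Lemma steinE h dh u : stein h dh -> \int[P]_w (Y u w * h w) = \int[P]_w dh u w.
Proof.
move=> [_ _ /(_ [::] u)] /=.
under [X in _ = _ + X -> _]eq_Rintegral do rewrite mulr0.
rewrite Ex_cst addr0 /mon.
under eq_Rintegral do rewrite big_nil mulr1.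
by under [in X in _ = X -> _]eq_Rintegral do rewrite big_nil mulr1.
Qed.

Lemma stein_ext h dh h' dh' : stein h dh -> h =1 h' -> (forall u, dh u =1 dh' u) ->
  stein h' dh'.
Proof.
by move=> st /funext <- dd; have <- : dh = dh' by apply/funext => u; apply/funext.
Qed.

Lemma steinZ r h dh : stein h dh -> stein (fun w => r * h w) (fun u w => r * dh u w).
Proof.
move=> [a1 b1 e1].
split=> [|u|m u]; [by moments|by moments|].
transitivity (r * \int[P]_w (Y u w * h w * mon m w)).
  rewrite -ExZ; last by moments.
  by apply: eq_Rintegral => w _; ring.
rewrite e1 mulrDr -!ExZ; try by moments.
by congr (_ + _); apply: eq_Rintegral => w _; ring.
Qed.

Lemma stein_sum (I : Type) (s : seq I) (h : I -> T -> R) dh :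
  (forall i, stein (h i) (dh i)) ->
  stein (fun w => \sum_(i <- s) h i w) (fun u w => \sum_(i <- s) dh i u w).
Proof.
move=> st; elim: s => [|i s ih].
  apply: (stein_ext (stein_cst 0)) => [w|u w]; by rewrite big_nil.
by apply: (stein_ext (steinD (st i) ih)) => [w|u w]; rewrite big_cons.
Qed.

End Stein.

(** * An exponential bound from a moment recursion *)

Section CumulantRecursion.
Context {R : realType}.

Lemma poly_gronwall (p : {poly R}) (G : R) :
  (forall z, 0 <= z <= 1 -> p^`().[z] <= 2 * G * z * p.[z]) ->
  p.[1] <= p.[0] * expR G.
Proof.
move=> hp.
pose h : R -> R := horner p * (expR \o (- (cst G * (@id R) ^+ 2))).
have dh (z : R) : is_derive z (1 : R) h
    ((p^`().[z] - 2 * G * z * p.[z]) * expR (- (G * z ^+ 2))).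
  apply: is_derive_eq; rewrite /GRing.scale /= !fctE.
  by ring.
have : h 1 <= h 0.
  apply: (@ler0_derive1_le_cc _ h 0 1) => //.
  - move=> x; rewrite in_itv /= => /andP[x0 x1]; rewrite derive1E.
    have [_ ->] := dh x; rewrite mulr_le0_ge0 ?expR_ge0// subr_le0.
    by apply: hp; rewrite !ltW.
  - by apply: derivable_within_continuous => x _; have [] := dh x.
  - by rewrite in_itv /= ler01 lexx.
  - by rewrite in_itv /= ler01 lexx.
rewrite /h !fctE /= expr1n mulr1 expr0n /= mulr0 oppr0 expR0 mulr1 expRN.
by rewrite ler_pdivrMr ?expR_gt0.
Qed.

Variables (M tau : nat -> R) (U : nat -> nat -> R) (beta F2 theta : R).
Hypotheses (M0 : M 0 = 1) (beta0 : 0 <= beta) (F20 : 0 <= F2).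
Hypotheses (theta0 : 0 <= theta) (theta1 : 4 * beta * theta <= 1).
Hypothesis UE : forall m k, U m k = tau m * M k + 2 * k%:R * U m.+1 k.-1.
Hypothesis ME : forall k, M k.+1 = 2 * k%:R * U 1 k.-1.
Hypothesis tau_le : forall m, `|tau m.+1| <= beta ^+ m * F2.

Let a k := `|M k| / (k`!)%:R.

Let a_ge0 k : 0 <= a k. Proof. by rewrite /a divr_ge0. Qed.

(** The sum of the [(2 * beta) ^+ (k - j) * a j] over [j <= k], which majorises
[U] once the recursion [UE] is unfolded down to [k = 0]. *)
Fixpoint discounted_sum k := a k + (if k is j.+1 then 2 * beta * discounted_sum j else 0).
Local Notation s := discounted_sum.

Let U_le m k : `|U m.+1 k| / (k`!)%:R <= beta ^+ m * F2 * s k.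
Proof.
elim: k m => [|k ih] m; rewrite UE.
  rewrite mulr0 mul0r !addr0 normrM -[leLHS]mulrA ler_pM//.
  by rewrite /= addr0.
have f0 : (0 : R) < (k.+1`!)%:R by rewrite ltr0n fact_gt0.
apply: (@le_trans _ _ (`|tau m.+1| * a k.+1 + 2 * (`|U m.+2 k| / (k`!)%:R))).
  rewrite ler_pdivrMr// (le_trans (ler_normD _ _))//.
  rewrite !normrM /= (ger0_norm (ler0n _ 2)) (ger0_norm (ler0n _ _)).
  rewrite [leRHS]mulrDl lerD//.
    by rewrite -[leRHS]mulrA /a divfK ?gt_eqF.
  rewrite factS natrM le_eqVlt; apply/orP; left; apply/eqP; field.
  by rewrite pnatr_eq0 -lt0n fact_gt0.
rewrite /= -/(s k) mulrDr lerD//.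
  by rewrite ler_wpM2r.
apply: (le_trans (ler_wpM2l (ler0n _ 2) (ih m.+1))).
by rewrite exprS le_eqVlt; apply/orP; left; apply/eqP; ring.
Qed.

Let a_rec k : k.+2%:R * a k.+2 <= 2 * F2 * s k.
Proof.
have := U_le 0 k; rewrite expr0 mul1r => h.
rewrite /a ME /= !normrM (ger0_norm (ler0n _ 2)) (ger0_norm (ler0n _ _)).
rewrite -[leRHS]mulrA; apply: le_trans (ler_wpM2l (ler0n _ 2) h).
rewrite !factS !natrM le_eqVlt; apply/orP; left; apply/eqP; field.
by rewrite !gt_eqF ?ltr_wpDr ?ltr0n ?fact_gt0.
Qed.

Let a1 : a 1 = 0. Proof. by rewrite /a ME mulr0 mul0r normr0 mul0r. Qed.

Let s_ge0 k : 0 <= s k.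
Proof.
elim: k => [|k ih] /=; first by rewrite addr0.
by rewrite addr_ge0// mulr_ge0// mulr_ge0.
Qed.

(** A geometric series of ratio at most 1/2, since [2 * beta * theta <= 1/2]. *)
Let discounted_sum_le (z : R) N : 0 <= z <= 1 ->
  \sum_(k < N) s k * theta ^+ k * z ^+ k <=
  2 * \sum_(k < N) a k * theta ^+ k * z ^+ k.
Proof.
move=> /andP[z0 z1]; case: N => [|N]; first by rewrite !big_ord0 mulr0.
set S := \sum_(k < _) s k * _ * _.
have S_le : S <= \sum_(k < N.+1) a k * theta ^+ k * z ^+ k + 2^-1 * S.
  rewrite {1}/S [leLHS]big_ord_recl [X in _ <= X + _]big_ord_recl /= addr0.
  rewrite -addrA lerD// (eq_bigr (fun i : 'I_N =>
    a i.+1 * theta ^+ i.+1 * z ^+ i.+1 +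
    (2 * beta * theta * z) * (s i * theta ^+ i * z ^+ i))); last first.
    by move=> i _; rewrite /bump /= add1n !exprS -/(s i); ring.
  rewrite big_split /= lerD//.
  rewrite -mulr_sumr /S big_ord_recr /=.
  have p0 (i : nat) : 0 <= s i * theta ^+ i * z ^+ i.
    by rewrite !mulr_ge0 ?exprn_ge0.
  apply: (@le_trans _ _ (2^-1 * \sum_(i < N) s i * theta ^+ i * z ^+ i)).
    rewrite ler_wpM2r ?sumr_ge0//.
    have : beta * theta * z <= beta * theta by rewrite ler_piMr// mulr_ge0.
    by have := theta1; lra.
  by rewrite ler_wpM2l ?invr_ge0// lerDl.
lra.
Qed.

(** The truncated generating function [p] of the [`|M k| / k`! * theta ^+ k]
satisfies the differential inequality [p' z <= 4 * F2 * theta ^+ 2 * z * p z],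
which is integrated from 0 to 1. *)
Lemma cumulant_bound N :
  \sum_(k < N) `|M k| / (k`!)%:R * theta ^+ k <= expR (2 * F2 * theta ^+ 2).
Proof.
case: N => [|N]; first by rewrite big_ord0 expR_ge0.
pose p := \poly_(k < N.+1) (a k * theta ^+ k).
have pE z : p.[z] = \sum_(k < N.+1) a k * theta ^+ k * z ^+ k.
  by rewrite horner_poly.
have p1 : \sum_(k < N.+1) `|M k| / (k`!)%:R * theta ^+ k = p.[1].
  by rewrite pE; apply: eq_bigr => i _; rewrite expr1n mulr1.
have p0 : p.[0] = 1.
  by rewrite horner_coef0 coef_poly /= /a M0 normr1 fact0 divr1 mulr1.
rewrite p1; have := @poly_gronwall p (2 * F2 * theta ^+ 2).
rewrite p0 mul1r; apply => z z01.
have z0 : 0 <= z by case/andP: z01.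
rewrite pE.
have -> : p^`().[z] = \sum_(k < N) k.+1%:R * a k.+1 * theta ^+ k.+1 * z ^+ k.
  rewrite /p poly_def linear_sum horner_sum big_ord_recl /= expr0 derivZ.
  rewrite (_ : (1 : {poly R})^`() = 0) ?scaler0 ?horner0 ?add0r; last first.
    by rewrite -[1]/(1%:P) derivC.
  apply: eq_bigr => i _; rewrite /bump /= add1n derivZ derivXn hornerZ.
  by rewrite hornerMn hornerXn -pred_Sn -mulr_natl; ring.
have sl := discounted_sum_le N.+1 z01.
apply: (@le_trans _ _ (2 * F2 * theta ^+ 2 * z *
    \sum_(k < N.+1) s k * theta ^+ k * z ^+ k)); last first.
  apply: (le_trans (ler_wpM2l _ sl)); last by rewrite le_eqVlt; apply/orP; left; apply/eqP; ring.
  by rewrite !mulr_ge0// sqr_ge0.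
case: N {p pE p1 p0 sl} => [|N].
  rewrite big_ord0 !mulr_ge0 ?sqr_ge0// sumr_ge0// => i _.
  by rewrite !mulr_ge0 ?exprn_ge0.
rewrite big_ord_recl /= a1 mulr0 !mul0r add0r.
have p0 (i : nat) : 0 <= s i * theta ^+ i * z ^+ i.
  by rewrite !mulr_ge0 ?exprn_ge0.
apply: (@le_trans _ _ (2 * F2 * theta ^+ 2 * z *
    \sum_(k < N) s k * theta ^+ k * z ^+ k)); last first.
  rewrite ler_wpM2l ?mulr_ge0 ?sqr_ge0// !big_ord_recr /=.
  by rewrite -addrA lerDl addr_ge0//; exact: (p0 N.+1).
rewrite mulr_sumr ler_sum// => i _; rewrite /bump /= add1n.
have tz : 0 <= theta ^+ i.+2 * z ^+ i.+1 by rewrite mulr_ge0 ?exprn_ge0.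
have := ler_wpM2r tz (a_rec i); rewrite !exprS.
move=> h; apply: le_trans (le_trans _ h) _;
  by rewrite le_eqVlt; apply/orP; left; apply/eqP; ring.
Qed.

End CumulantRecursion.

(** * Quadratic forms in a Gaussian vector *)

Section QuadraticForm.
Context {R : realType} {d : measure_display} {T : measurableType d}.
Variable P : probability T R.
Variables (n : nat) (X : 'I_n -> T -> R).

Definition linform (c : 'rV[R]_n) (w : T) : R := \sum_i c 0 i * X i w.

Definition quadform (S : 'M[R]_n) (w : T) : R :=
  \sum_i X i w * linform (row i S) w.

Definition covmx : 'M[R]_n := \matrix_(i, j) \int[P]_w (X i w * X j w).

Hypothesis Xm : forall i, measurable_fun setT (X i).
Hypothesis Xg : forall c, gaussian P (linform c).
Hypothesis X0 : forall i, \int[P]_w X i w = 0.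

Local Notation moments := (all_moments P).
Local Notation Sg := covmx.

Lemma linform_delta i w : linform (delta_mx 0 i) w = X i w.
Proof.
rewrite /linform (bigD1 i)//= mxE !eqxx mul1r big1 ?addr0// => j ji.
by rewrite mxE eqxx (negbTE ji) mul0r.
Qed.

Lemma linformD t u v w : linform (u + t *: v) w = linform u w + t * linform v w.
Proof.
rewrite /linform mulr_sumr -big_split; apply: eq_bigr => i _ /=.
by rewrite !mxE mulrDl mulrA.
Qed.

Lemma measurable_linform c : measurable_fun setT (linform c).
Proof.
apply: measurable_sum => i; apply: measurable_funM => //.
Qed.

Let aL c : moments (linform c).
Proof. exact: (gaussian_all_moments (measurable_linform c)). Qed.

Let aX i : moments (X i).
Proof. by have := aL (delta_mx 0 i); congr all_moments; apply/funext => w; rewrite linform_delta. Qed.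

Let linform0 c : \int[P]_w linform c w = 0.
Proof.
rewrite Ex_sum => [|i]; last exact: all_momentsZ.
by rewrite big1// => i _; rewrite ExZ// X0 mulr0.
Qed.

Lemma covform_linform u v : covform P linform u v = (u *m Sg *m v^T) 0 0.
Proof.
rewrite /covform.
transitivity (\int[P]_w (\sum_j \sum_i (u 0 i * v 0 j) * (X i w * X j w))).
  apply: eq_Rintegral => w _; rewrite /linform mulr_sumr.
  by apply: eq_bigr => j _; rewrite mulr_suml; apply: eq_bigr => i _; ring.
have aXX i j : moments (fun w => X i w * X j w) by exact: all_momentsM.
rewrite Ex_sum => [|j]; last by apply: all_moments_sum => i; exact: all_momentsZ.
rewrite !mxE; apply: eq_bigr => j _; rewrite !mxE mulr_suml.
rewrite Ex_sum => [|i]; last exact: all_momentsZ.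
by apply: eq_bigr => i _; rewrite ExZ// mxE; ring.
Qed.

Lemma covmx_sym : Sg^T = Sg.
Proof. by apply/matrixP => i j; rewrite !mxE; apply: eq_Rintegral => w _; rewrite mulrC. Qed.

Lemma quadform_sum S w : quadform S w = \sum_i \sum_j S i j * (X i w * X j w).
Proof.
apply: eq_bigr => i _; rewrite /linform mulr_sumr; apply: eq_bigr => j _.
by rewrite mxE; ring.
Qed.

Let aQ S : moments (quadform S).
Proof. by apply: all_moments_sum => i; exact: all_momentsM. Qed.

Variables (A : 'M[R]_n) (r : R).
Hypothesis Asym : A^T = A.
Let Q w := quadform A w - r.
Let aQr k : moments (fun w => Q w ^+ k).
Proof. by apply: all_momentsX; apply: all_momentsB => //; exact: all_moments_cst. Qed.

Lemma linform_mulmx u (S : 'M[R]_n) w :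
  linform (u *m S) w = \sum_i u 0 i * linform (row i S) w.
Proof.
rewrite /linform (eq_bigr (fun j => \sum_i u 0 i * S i j * X j w)); last first.
  by move=> j _; rewrite mxE mulr_suml.
rewrite exchange_big; apply: eq_bigr => i _; rewrite mulr_sumr.
by apply: eq_bigr => j _; rewrite mxE mulrA.
Qed.

Lemma stein_quadform_pow k :
  stein P linform (fun w => Q w ^+ k)
    (fun u w => k%:R * Q w ^+ k.-1 * (2 * linform (u *m Sg *m A) w)).
Proof.
have lD := linformD; have lm := measurable_linform; have l0 := linform0.
elim: k => [|k ih].
  apply: (stein_ext (stein_cst lD lm Xg l0 1)) => [w|u w]; first by rewrite expr0.
  by rewrite !mul0r.
pose e i : 'rV[R]_n := delta_mx 0 i.
have st := steinD lm Xg
  (stein_sum lD lm Xg l0 (index_enum 'I_n) (fun i => steinM lm Xg (e i) (steinM lm Xg (row i A) ih)))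
  (steinZ lm Xg (- r) ih).
apply: (stein_ext st) => [w|u w].
  rewrite exprS /Q mulrBl mulNr; congr (_ - _).
  rewrite /quadform mulr_suml; apply: eq_bigr => i _.
  by rewrite linform_delta mulrA.
set D := k%:R * _ * _.
have -> : \sum_i (covform P linform u (e i) * (linform (row i A) w * Q w ^+ k) +
    linform (e i) w * (covform P linform u (row i A) * Q w ^+ k + linform (row i A) w * D)) =
  2 * linform (u *m Sg *m A) w * Q w ^+ k + quadform A w * D.
  rewrite mulr_natl mulr2n mulrDl -addrA /quadform mulr_suml.
  rewrite {1}linform_mulmx {1}/linform !mulr_suml -!big_split /=.
  apply: eq_bigr => i _; rewrite !covform_linform linform_delta.
  have -> : (u *m Sg *m (e i)^T) 0 0 = (u *m Sg) 0 i.
    by rewrite /e trmx_delta -colE mxE.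
  have -> : (u *m Sg *m (row i A)^T) 0 0 = (u *m Sg *m A) 0 i.
    by rewrite tr_row Asym mxE [RHS]mxE; apply: eq_bigr => j _; rewrite [col _ _ _ _]mxE.
  by ring.
have -> : quadform A w = Q w + r by rewrite /Q subrK.
case: k @D {ih st} => [|k] D; rewrite /D -?natr1 /=; first by ring.
by rewrite !exprS; ring.
Qed.

(** Integration by parts in the left factor of each [X i * linform (row i S)]:
differentiating the right factor gives the trace, differentiating [Q ^+ k] gives
a quadratic form again, with the matrix [S^T Sg A]. *)
Lemma Ex_quadform_pow (S : 'M[R]_n) k :
  \int[P]_w (quadform S w * Q w ^+ k) =
  \tr (S *m Sg) * \int[P]_w (Q w ^+ k) +
  2 * k%:R * \int[P]_w (quadform (S^T *m Sg *m A) w * Q w ^+ k.-1).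
Proof.
have lD := linformD; have lm := measurable_linform; have l0 := linform0.
pose e i : 'rV[R]_n := delta_mx 0 i.
transitivity (\sum_i \int[P]_w (linform (e i) w * (linform (row i S) w * Q w ^+ k))).
  rewrite -Ex_sum => [|i]; last first.
    by apply: all_momentsM => //; apply: all_momentsM.
  apply: eq_Rintegral => w _; rewrite /quadform mulr_suml.
  by apply: eq_bigr => i _; rewrite linform_delta mulrA.
have st i := steinE (e i) (steinM lm Xg (row i S) (stein_quadform_pow k)).
under eq_bigr do rewrite st.
rewrite -ExZ// -ExZ; last by apply: all_momentsM.
rewrite -ExD; [|by apply: all_momentsZ|by apply: all_momentsZ; apply: all_momentsM].
rewrite -Ex_sum => [|i]; last first.
  apply: all_momentsD; first exact: all_momentsZ.
  apply: all_momentsM => //; apply: all_momentsM; first exact: all_momentsZ.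
  exact: all_momentsZ.
apply: eq_Rintegral => w _.
rewrite big_split /= -mulr_suml; congr (_ * _ + _).
  rewrite /mxtrace; apply: eq_bigr => i _; rewrite covform_linform.
  rewrite -mulmxA -rowE !mxE; apply: eq_bigr => j _; rewrite !mxE.
  rewrite mulrC; congr (_ * _).
  by apply: eq_Rintegral => w' _; rewrite mulrC.
rewrite (eq_bigr (fun i => 2 * k%:R * Q w ^+ k.-1 *
   (linform (row i S) w * linform (row i (Sg *m A)) w))); last first.
  move=> i _; rewrite -mulmxA -rowE; ring.
rewrite -mulr_sumr -!mulrA; congr (_ * (_ * _)); rewrite mulrC; congr (_ * _).
rewrite /quadform -mulmxA.
under eq_bigr do rewrite {1}/linform mulr_suml.
rewrite exchange_big; apply: eq_bigr => j _ /=.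
rewrite row_mul linform_mulmx mulr_sumr; apply: eq_bigr => i _.
by rewrite !mxE; ring.
Qed.

End QuadraticForm.

(** * Frobenius norms *)

Section MatrixNorms.
Context {R : realType} (n : nat).
Implicit Types (A B S : 'M[R]_n).

Definition frob2 A : R := \sum_i \sum_j A i j ^+ 2.

Lemma frob2_ge0 A : 0 <= frob2 A.
Proof. by apply: sumr_ge0 => i _; apply: sumr_ge0 => j _; exact: sqr_ge0. Qed.

Lemma frob2_tr A : frob2 A^T = frob2 A.
Proof.
by rewrite /frob2 exchange_big; apply: eq_bigr => i _; apply: eq_bigr => j _; rewrite mxE.
Qed.

Lemma discriminant_le (F C H : R) : 0 <= F -> 0 <= H ->
  (forall t, 0 <= F - 2 * t * C + t ^+ 2 * H) -> C ^+ 2 <= F * H.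
Proof.
move=> F0 H0 pos.
have [H0'|Hn0] := eqVneq H 0.
  have C0 : C = 0.
    apply/eqP; apply/negPn/negP => Cn0.
    have := pos ((F + 1) / (2 * C)); rewrite H0' mulr0 addr0.
    have -> : 2 * ((F + 1) / (2 * C)) * C = F + 1 by field.
    by rewrite opprD addrA subrr add0r oppr_ge0 ler10.
  by rewrite C0 H0' expr0n /= mulr0.
have Hp : 0 < H by rewrite lt_neqAle eq_sym Hn0.
have := pos (C / H).
have -> : F - 2 * (C / H) * C + (C / H) ^+ 2 * H = (F * H - C ^+ 2) / H by field.
by rewrite pmulr_lge0 ?invr_gt0// subr_ge0.
Qed.

Lemma sum_cauchy_schwarz (I : finType) (f g : I -> R) :
  (\sum_i f i * g i) ^+ 2 <= (\sum_i f i ^+ 2) * (\sum_i g i ^+ 2).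
Proof.
apply: discriminant_le => [||t].
- by apply: sumr_ge0 => i _; exact: sqr_ge0.
- by apply: sumr_ge0 => i _; exact: sqr_ge0.
rewrite (_ : _ + _ = \sum_i (f i - t * g i) ^+ 2).
  by apply: sumr_ge0 => i _; exact: sqr_ge0.
rewrite !mulr_sumr -sumrN -!big_split /=.
by apply: eq_bigr => i _; ring.
Qed.

(** Cauchy-Schwarz in each entry of the product. *)
Lemma frob2M A B : frob2 (A *m B) <= frob2 A * frob2 B.
Proof.
rewrite /frob2 mulr_suml; apply: ler_sum => i _.
rewrite [X in _ * X]exchange_big /= mulr_sumr.
by apply: ler_sum => j _; rewrite mxE; exact: sum_cauchy_schwarz.
Qed.

(** Schur's test. *)
Lemma frob2_mulr A B b : 0 <= b -> (forall i, \sum_j `|B i j| <= b) ->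
  (forall j, \sum_i `|B i j| <= b) -> frob2 (A *m B) <= b ^+ 2 * frob2 A.
Proof.
move=> b0 hr hc; rewrite /frob2 mulr_sumr; apply: ler_sum => i _.
apply: (@le_trans _ _ (\sum_j b * (\sum_k A i k ^+ 2 * `|B k j|))).
  apply: ler_sum => j _; rewrite mxE.
  pose g k := Num.sqrt `|B k j|.
  apply: (@le_trans _ _ ((\sum_k (`|A i k| * g k) * g k) ^+ 2)).
    rewrite -[leLHS]real_normK ?num_real// lerXn2r ?nnegrE//.
      by apply: sumr_ge0 => k _; rewrite !mulr_ge0 ?sqrtr_ge0.
    apply: (le_trans (ler_norm_sum _ _ _)); apply: ler_sum => k _.
    by rewrite normrM -mulrA -expr2 sqr_sqrtr.
  apply: (le_trans (sum_cauchy_schwarz _ _)); rewrite mulrC.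
  apply: ler_pM.
  - by apply: sumr_ge0 => k _; exact: sqr_ge0.
  - by apply: sumr_ge0 => k _; exact: sqr_ge0.
  - apply: le_trans (hc j); apply: ler_sum => k _.
    by rewrite sqr_sqrtr.
  - apply: ler_sum => k _.
    by rewrite exprMn sqr_sqrtr// real_normK ?num_real.
rewrite -mulr_sumr exchange_big /= expr2 -mulrA ler_wpM2l//.
rewrite mulr_sumr; apply: ler_sum => k _.
by rewrite -mulr_sumr mulrC ler_wpM2r ?sqr_ge0.
Qed.

Lemma mxtrace_mul_le A B : `|\tr (A *m B)| ^+ 2 <= frob2 A * frob2 B.
Proof.
rewrite real_normK ?num_real// /mxtrace -(frob2_tr B) /frob2.
rewrite (eq_bigr (fun i => \sum_j A i j * B^T i j)); last first.
  by move=> i _; rewrite mxE; apply: eq_bigr => j _; rewrite mxE.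
by rewrite !pair_bigA /=; exact: sum_cauchy_schwarz.
Qed.

End MatrixNorms.

(** * Tails of Gaussian quadratic forms *)

Section QuadraticTail.
Context {R : realType} {d : measure_display} {T : measurableType d}.
Variable P : probability T R.

Definition exp_partial (n : nat) (x : R) : R := \sum_(j < n) x ^+ j / (j`!)%:R.

Lemma cvg_exp_partial x : exp_partial n x @[n --> \oo] --> expR x.
Proof.
have -> : exp_partial^~ x = series (exp_coeff x).
  by apply/funext => n; rewrite /series /= big_mkord.
exact: is_cvg_series_exp_coeff.
Qed.

Lemma sym_exp_partialE n (t x : R) : 0 <= t ->
  exp_partial n (t * x) + exp_partial n (- (t * x)) =
  \sum_(j < n) (1 + (-1) ^+ j) * (t * `|x|) ^+ j / (j`!)%:R.
Proof.
move=> t0; rewrite /exp_partial -big_split; apply: eq_bigr => j _ /=.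
rewrite -[- (t * x)]mulN1r [(-1 * _) ^+ j]exprMn -mulrDl; congr (_ / _).
case: (ger0P x) => x0; first by ring.
have -> : t * x = -1 * (t * - x) by ring.
rewrite [(-1 * _) ^+ j]exprMn -signr_odd.
by case: (odd j); rewrite ?expr0 ?expr1; ring.
Qed.

(** Chernoff's bound when only the moments are under control: the hyperbolic
cosine is replaced by its Taylor polynomials, then the degree goes to infinity. *)
Lemma moment_tail (Q : T -> R) (t s B : R) : all_moments P Q ->
  0 <= t -> 0 <= s ->
  (forall n, \sum_(j < n) `|\int[P]_w Q w ^+ j| / (j`!)%:R * t ^+ j <= B) ->
  (P [set w | (s <= `|Q w|)%R] <= (2 * B * expR (- (t * s)))%:E)%E.
Proof.
move=> aQ t0 s0 hB; set S := [set w | _].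
have mQ := all_moments_measurable aQ.
have mS : measurable S.
  have -> : S = (fun w => `|Q w|) @^-1` `[s, +oo[.
    by apply/seteqP; split=> w; rewrite /S /= in_itv /= andbT.
  rewrite -[X in measurable X]setTI.
  exact: (measurableT_comp (@normr_measurable R setT) mQ).
pose p := fine (P S).
have PS : P S = p%:E by rewrite /p fineK// fin_num_measure.
have pE : \int[P]_w (\1_S w) = p.
  rewrite /p /Rintegral; congr fine.
  by rewrite integral_indic// setIT.
have aS : all_moments P (\1_S : T -> R).
  apply: (@all_moments_dom _ _ _ _ _ (fun _ _ => 1)) => [|k|k w].
  - exact: measurable_indic.
  - exact: finite_measure_integrable_cst.
  - by rewrite indicE; case: (w \in S); rewrite ?normr1 ?expr1n// normr0 expr0n; case: k.
have aD n : all_moments P (fun w => exp_partial n (t * Q w) + exp_partial n (- (t * Q w))).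
  have ae f : all_moments P f -> all_moments P (fun w => exp_partial n (f w)).
    move=> af; apply: all_moments_sum => j.
    by apply: all_momentsM; [exact: all_momentsX|exact: all_moments_cst].
  apply: all_momentsD; apply: ae; first exact: all_momentsZ.
  have := all_momentsZ (-1) (all_momentsZ t aQ).
  by congr all_moments; apply/funext => w; rewrite mulN1r.
have step n : (exp_partial n (t * s) + exp_partial n (- (t * s))) * p <= 2 * B.
  apply: (@le_trans _ _ (\int[P]_w (exp_partial n (t * Q w) + exp_partial n (- (t * Q w))))).
    rewrite -pE -ExZ//; apply: Ex_le => //; first exact: all_momentsZ.
    move=> w; rewrite !sym_exp_partialE// indicE.
    have pos j (x : R) : 0 <= (1 + (-1) ^+ j) * (t * `|x|) ^+ j / (j`!)%:R.
      rewrite mulr_ge0 ?invr_ge0// mulr_ge0 ?exprn_ge0// ?mulr_ge0//.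
      by rewrite -signr_odd; case: (odd j); rewrite ?expr1 ?subrr ?expr0// addr_ge0.
    case: (boolP (w \in S)) => // wS; rewrite ?mulr1 ?mulr0; last first.
      by apply: sumr_ge0 => j _; exact: pos.
    apply: ler_sum => j _; rewrite ler_wpM2r ?invr_ge0// ler_wpM2l//.
      by rewrite -signr_odd; case: (odd j); rewrite ?expr1 ?subrr ?expr0// addr_ge0.
    rewrite lerXn2r ?nnegrE ?mulr_ge0// ler_wpM2l// (ger0_norm s0).
    by move: wS; rewrite inE.
  have -> : (fun w => exp_partial n (t * Q w) + exp_partial n (- (t * Q w))) =
      (fun w => \sum_(j < n) ((1 + (-1) ^+ j) * t ^+ j / (j`!)%:R) * Q w ^+ j).
    apply/funext => w; rewrite /exp_partial -big_split; apply: eq_bigr => j _ /=.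
    by rewrite -[- (t * _)]mulN1r [(-1 * _) ^+ j]exprMn exprMn; ring.
  rewrite Ex_sum => [|j]; last by apply: all_momentsZ; exact: all_momentsX.
  apply: le_trans (ler_wpM2l (ler0n _ 2) (hB n)); rewrite mulr_sumr.
  apply: ler_sum => j _; rewrite ExZ; last exact: all_momentsX.
  apply: (le_trans (ler_norm _)); rewrite !normrM normfV (ger0_norm (ler0n _ _)).
  rewrite (ger0_norm (exprn_ge0 _ t0)) -!mulrA.
  apply: ler_pM => //; first by rewrite !mulr_ge0 ?exprn_ge0 ?invr_ge0.
    by rewrite -signr_odd; case: (odd j); rewrite ?expr1 ?expr0 ?subrr ?normr0// ger0_norm.
  by rewrite le_eqVlt; apply/orP; left; apply/eqP; ring.
have e0 : 0 < expR (t * s) + expR (- (t * s)) by rewrite addr_gt0 ?expR_gt0.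
have lim : (expR (t * s) + expR (- (t * s))) * p <= 2 * B.
  have c : (exp_partial n (t * s) + exp_partial n (- (t * s))) * p @[n --> \oo] -->
    (expR (t * s) + expR (- (t * s))) * p.
    by apply: cvgM; [apply: cvgD; exact: cvg_exp_partial|exact: cvg_cst].
  rewrite -(cvg_lim _ c)//; apply: limr_le; first exact: (cvgP _ c).
  exact: nearW.
rewrite PS lee_fin expRN ler_pdivlMr ?expR_gt0// mulrC.
apply: le_trans lim; rewrite ler_wpM2r ?lerDl ?expR_ge0//.
by rewrite -lee_fin -PS.
Qed.

Variables (n : nat) (X : 'I_n -> T -> R).
Hypothesis Xm : forall i, measurable_fun setT (X i).
Hypothesis Xg : forall c, gaussian P (linform X c).
Hypothesis X0 : forall i, \int[P]_w X i w = 0.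
Local Notation Sg := (covmx P X).

Lemma all_moments_quadform S : all_moments P (quadform X S).
Proof.
have aL c : all_moments P (linform X c).
  exact: (gaussian_all_moments (measurable_linform Xm c)).
apply: all_moments_sum => i; apply: all_momentsM => //.
by have := aL (delta_mx 0 i); congr all_moments; apply/funext => w; rewrite linform_delta.
Qed.

Lemma Ex_quadform S : \int[P]_w quadform X S w = \tr (S *m Sg).
Proof.
have := Ex_quadform_pow Xm Xg X0 0 (trmx0 _ n n) S 0.
rewrite mulr0 mul0r addr0.
under eq_Rintegral do rewrite expr0 mulr1.
under [X in _ = _ * X -> _]eq_Rintegral do rewrite expr0.
by rewrite Ex_cst mulr1.
Qed.

Variable A : 'M[R]_n.
Hypothesis Asym : A^T = A.
Local Notation W := (A *m Sg).
Variables (beta F2 : R).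
Hypotheses (beta0 : 0 <= beta) (F20 : 0 <= F2).
Hypothesis W_F2 : frob2 W <= F2.
Hypothesis W_beta : forall B : 'M[R]_n, frob2 (B *m W) <= beta ^+ 2 * frob2 B.

Let r := \tr W.
Let Q w := quadform X A w - r.

(* [(A *m Sg) ^+ m *m A]: integration by parts sends [Sm m] to [Sm m.+1]. *)
Let Sm m := iter m (fun S => S *m Sg *m A) A.

Let SmE m : Sm m *m Sg *m A = A *m Sg *m Sm m.
Proof. by elim: m => [//|m ih]; rewrite /= -/(Sm m) {1}ih !mulmxA. Qed.

Let Sm_sym m : (Sm m)^T = Sm m.
Proof.
elim: m => [//|m ih]; rewrite /= -/(Sm m) !trmx_mul Asym covmx_sym ih.
by rewrite mulmxA -SmE.
Qed.

Let SmSg m : Sm m.+1 *m Sg = Sm m *m Sg *m W.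
Proof. by rewrite /= -/(Sm m) !mulmxA. Qed.

Let frob2_SmSg m : frob2 (Sm m *m Sg) <= (beta ^+ m) ^+ 2 * F2.
Proof.
elim: m => [|m ih]; first by rewrite expr0 expr1n mul1r.
rewrite SmSg (le_trans (W_beta _))//.
have -> : (beta ^+ m.+1) ^+ 2 * F2 = beta ^+ 2 * ((beta ^+ m) ^+ 2 * F2).
  by rewrite [beta ^+ m.+1]exprS exprMn mulrA.
by rewrite ler_wpM2l// sqr_ge0.
Qed.

(* The trace of [W ^+ m.+2] pairs [W ^+ m.+1] with [W]. *)
Let trace_le m : `|\tr (Sm m.+1 *m Sg)| <= beta ^+ m * F2.
Proof.
rewrite -ler_sqr ?nnegrE// ?mulr_ge0 ?exprn_ge0//.
rewrite SmSg (le_trans (mxtrace_mul_le _ _))// exprMn [F2 ^+ 2]expr2 mulrA.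
by apply: ler_pM; rewrite ?frob2_ge0 ?frob2_SmSg.
Qed.

Lemma quadform_exp_tail (t s : R) : 0 <= t -> 4 * beta * t <= 1 -> 0 <= s ->
  (P [set w | (s <= `|Q w|)%R] <= (2 * expR (2 * F2 * t ^+ 2 - t * s))%:E)%E.
Proof.
move=> t0 t1 s0; rewrite expRD mulrA.
have aQ : all_moments P Q.
  by apply: all_momentsB; [exact: all_moments_quadform|exact: all_moments_cst].
apply: moment_tail => // N.
apply: (@cumulant_bound _ (fun k => \int[P]_w Q w ^+ k) (fun m => \tr (Sm m *m Sg))
  (fun m k => \int[P]_w (quadform X (Sm m) w * Q w ^+ k)) beta F2 t) => //.
- by under eq_Rintegral do rewrite expr0; exact: Ex_cst.
- by move=> m k; rewrite (Ex_quadform_pow Xm Xg X0 r Asym) Sm_sym.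
- move=> k; have := Ex_quadform_pow Xm Xg X0 r Asym A k; rewrite Asym => h.
  apply: (@addrI _ (\tr W * \int[P]_w (Q w ^+ k))); rewrite -h.
  rewrite -ExZ; last exact: all_momentsX.
  rewrite -ExD; [|by apply: all_momentsZ; exact: all_momentsX|exact: all_momentsX].
  by apply: eq_Rintegral => w _; rewrite exprS /Q /r; ring.
Qed.

(** [F2] bounds the squared Hilbert-Schmidt norm of [W] and [beta] its operator
norm. The exponent [s / (4 * (F2 + beta * s))] is of the order of the optimum,
[s / (4 * F2)], cut off so that [4 * beta * t <= 1]. *)
Lemma quadform_tail (s : R) : 0 < F2 -> 0 < s ->
  (P [set w | (s <= `|Q w|)%R] <=
    (2 * expR (- (s ^+ 2 / (8 * (F2 + beta * s)))))%:E)%E.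
Proof.
move=> F2p s0.
have bs : 0 <= beta * s by rewrite mulr_ge0// ltW.
have D0 : 0 < F2 + beta * s by rewrite ltr_pwDl.
pose t := s / (4 * (F2 + beta * s)).
have t0 : 0 <= t by rewrite divr_ge0// ?ltW// mulr_gt0.
have t1 : 4 * beta * t <= 1.
  have -> : 4 * beta * t = (beta * s) / (F2 + beta * s) by rewrite /t; field; rewrite gt_eqF.
  by rewrite ler_pdivrMr// mul1r lerDr.
apply: (le_trans (quadform_exp_tail t0 t1 (ltW s0))).
rewrite lee_fin ler_pM2l// ler_expR.
have -> : 2 * F2 * t ^+ 2 - t * s =
    - (s ^+ 2 / (8 * (F2 + beta * s))) * (1 + beta * s / (F2 + beta * s)).
  by rewrite /t; field; rewrite gt_eqF.
rewrite mulNr lerN2 ler_peMr//.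
  by rewrite divr_ge0 ?sqr_ge0// mulr_ge0// ltW.
by rewrite lerDl divr_ge0// ltW.
Qed.

End QuadraticTail.

(** * Fourier cosine coefficients *)

Section FourierCosine.
Context {R : realType}.
Local Notation mu := (@lebesgue_measure R).
Local Notation circle := (`[(- pi : R)%R, pi%R]%classic).

Definition fourier_cos (f : R -> R) (k : int) : R :=
  \int[mu]_(x in circle) (f x * cos (x * k%:~R)).

Lemma measurable_circle : measurable (circle : set (measurableTypeR R)).
Proof. exact: measurable_itv. Qed.
Local Notation mC := measurable_circle.

Lemma circle_measure : mu circle = (2 * pi)%:E.
Proof.
rewrite lebesgue_measure_itv/= lte_fin gtrN ?pi_gt0// -EFinB opprK.
by rewrite mulr_natl mulr2n.
Qed.

Lemma measurable_cosk (k : int) (D : set R) : measurable_fun D (fun x : R => cos (x * k%:~R)).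
Proof.
apply: measurable_funTS; apply: measurableT_comp; last exact: measurable_funM.
by apply: continuous_measurable_fun; exact: continuous_cos.
Qed.

Lemma bounded_integrable (f : R -> R) (M : R) : measurable_fun circle f ->
  (forall x, `|f x| <= M) -> mu.-integrable circle (EFin \o f).
Proof.
move=> mf fM; apply: measurable_bounded_integrable => //.
  by apply: (@le_lt_trans _ _ (2 * pi)%:E); rewrite ?ltry// -circle_measure.
exists M; split; first exact: num_real.
by move=> y My x _ /=; exact: le_trans (fM x) (ltW My).
Qed.

Lemma integrable_mul_bounded (f h : R -> R) (M : R) :
  mu.-integrable circle (EFin \o f) -> measurable_fun circle h ->
  (forall x, `|h x| <= M) ->
  mu.-integrable circle (EFin \o (fun x => f x * h x)).
Proof.
move=> fi mh hM.
have := @integrableMl _ _ _ mu circle mC (EFin \o f) h fi mh.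
apply; exists M; split; first exact: num_real.
by move=> y My x _ /=; exact: le_trans (hM x) (ltW My).
Qed.

Lemma integrable_mul_cos (f : R -> R) (k : int) :
  mu.-integrable circle (EFin \o f) ->
  mu.-integrable circle (EFin \o (fun x => f x * cos (x * k%:~R))).
Proof.
move=> fi; apply: (@integrable_mul_bounded _ _ 1 fi) => [|x].
  exact: measurable_cosk.
exact: cos_max.
Qed.

Lemma integrable_cosk (k : int) :
  mu.-integrable circle (EFin \o (fun x => cos (x * k%:~R))).
Proof.
apply: (@bounded_integrable _ 1) => [|x]; first exact: measurable_cosk.
exact: cos_max.
Qed.

Lemma sin_natpi (n : nat) : sin (pi * n%:R) = 0 :> R.
Proof.
elim: n => [|n ih]; first by rewrite mulr0 sin0.
by rewrite -natr1 mulrDr mulr1 sinDpi ih oppr0.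
Qed.

Lemma sin_intpi (m : int) : sin (pi * m%:~R) = 0 :> R.
Proof.
case: (intP m) => [|n|n]; first by rewrite mulr0 sin0.
  by rewrite -[n.+1%:~R]/(n.+1%:R) sin_natpi.
by rewrite mulrNz mulrN sinN -[n.+1%:~R]/(n.+1%:R) sin_natpi oppr0.
Qed.

Lemma Rintegral_cosk (m : int) :
  \int[mu]_(x in circle) cos (x * m%:~R) = if m == 0 then 2 * pi else 0.
Proof.
have [->|m0] := eqVneq m 0.
  under eq_Rintegral do rewrite mulr0 cos0.
  rewrite Rintegral_cst// mul1r; exact: (congr1 fine circle_measure).
have m0' : m%:~R != 0 :> R by rewrite intr_eq0.
pose F : R -> R := fun x => sin (x * m%:~R) / m%:~R.
have dF (x : R) : is_derive x (1 : R) F (cos (x * m%:~R)).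
  have -> : F = (sin \o (@id R * cst m%:~R)) * cst (m%:~R)^-1 by [].
  apply: is_derive_eq; rewrite /GRing.scale /= !fctE.
  by field.
have cF : continuous F.
  move=> x; apply: differentiable_continuous; apply/derivable1_diffP.
  by have [] := dF x.
rewrite /Rintegral (@continuous_FTC2 _ _ F); last 4 first.
- by rewrite gtrN ?pi_gt0.
- apply: continuous_subspaceT => x.
  apply: (@continuous_comp _ _ _ (fun x : R => x * m%:~R) cos); last exact: continuous_cos.
  by apply: cvgM; [exact: cvg_id|exact: cvg_cst].
- split.
  + by move=> x _; have [] := dF x.
  + by apply: cvg_at_right_filter; exact: cF.
  + by apply: cvg_at_left_filter; exact: cF.
- by move=> x _; rewrite derive1E; have [_ ->] := dF x.
by rewrite /F mulNr sinN sin_intpi oppr0 !mul0r -EFinB subr0.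
Qed.

Lemma cosM (x y : R) : cos x * cos y = 2^-1 * (cos (x - y) + cos (x + y)).
Proof. by rewrite cosB cosD; field. Qed.

Lemma Rintegral_cos_mul (k l : int) :
  \int[mu]_(x in circle) (cos (x * k%:~R) * cos (x * l%:~R)) =
  pi * ((k == l)%:R + (k == - l)%:R).
Proof.
transitivity (\int[mu]_(x in circle) (2^-1 * (cos (x * (k - l)%:~R) + cos (x * (k + l)%:~R)))).
  by apply: eq_Rintegral => x _; rewrite cosM !intrD mulrNz !mulrDr mulrN.
have i1 := integrable_cosk (k - l); have i2 := integrable_cosk (k + l).
rewrite RintegralZl//; last exact: (integrableD mC i1 i2).
rewrite RintegralD// !Rintegral_cosk subr_eq0 addr_eq0.
by case: (k == l); case: (k == - l); rewrite /=; field.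
Qed.

Lemma fourier_cosN f k : fourier_cos f (- k) = fourier_cos f k.
Proof. by apply: eq_Rintegral => x _; rewrite mulrNz mulrN cosN. Qed.

Lemma Rintegral_sum (D : set (measurableTypeR R)) (mD : measurable D)
    (I : Type) (s : seq I) (Q : pred I) (F : I -> R -> R) :
  (forall i, mu.-integrable D (EFin \o F i)) ->
  mu.-integrable D (EFin \o (fun x => \sum_(i <- s | Q i) F i x)) /\
  \int[mu]_(x in D) (\sum_(i <- s | Q i) F i x) =
  \sum_(i <- s | Q i) \int[mu]_(x in D) F i x.
Proof.
move=> iF; elim: s => [|i s [ih1 ih2]].
  have -> : (fun x => \sum_(i <- [::] | Q i) F i x) = cst 0.
    by apply/funext => x; rewrite big_nil.
  split; last by rewrite big_nil Rintegral_cst// mul0r.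
  exact: (integrable0 mu D).
have -> : (fun x => \sum_(j <- i :: s | Q j) F j x) =
    (fun x => if Q i then F i x + \sum_(j <- s | Q j) F j x else
       \sum_(j <- s | Q j) F j x).
  by apply/funext => x; rewrite big_cons.
rewrite big_cons.
case: (Q i) => //; split; first exact: (integrableD mD (iF i) ih1).
by rewrite RintegralD// ih2.
Qed.

(** Integrate the square of [f - (2 pi)^-1 g], where [g] is the sum of the
[r k * cos (k x)] over [|k| <= N]. A nonzero frequency occurs twice in [g], at [k] and at
[- k], and the frequency 0 has twice the norm of the others. *)
Lemma bessel_cos (f : R -> R) (N : nat) :
  mu.-integrable circle (EFin \o f) ->
  ((\sum_(i < N.*2.+1) fourier_cos f (i%:Z - N%:Z) ^+ 2)%:E <=
   (2 * pi)%:E * \int[mu]_(x in circle) (f x ^+ 2)%:E)%E.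
Proof.
move=> fi.
have mf : measurable_fun circle f by apply/measurable_EFinP; exact: measurable_int fi.
have f20 : (0 <= \int[mu]_(x in circle) (f x ^+ 2)%:E)%E.
  by apply: integral_ge0 => x _; rewrite lee_fin sqr_ge0.
have pi0 : 0 < (pi : R) by exact: pi_gt0.
have [foo|] := eqVneq (\int[mu]_(x in circle) (f x ^+ 2)%:E)%E +oo%E.
  by rewrite foo gt0_muley ?leey// lte_fin mulr_gt0.
rewrite -ltey => ffin.
have f2i : mu.-integrable circle (EFin \o (fun x => f x ^+ 2)).
  apply/integrableP; split; first exact/measurable_EFinP/measurable_funX.
  by under eq_integral do rewrite /= ger0_norm ?sqr_ge0//.
have -> : (\int[mu]_(x in circle) (f x ^+ 2)%:E =
    (\int[mu]_(x in circle) (f x ^+ 2))%:E)%E.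
  by rewrite /Rintegral fineK// ge0_fin_numE.
rewrite -EFinM lee_fin.
pose k (i : 'I_N.*2.+1) : int := i%:Z - N%:Z.
pose r i := fourier_cos f (k i).
pose g x := \sum_i r i * cos (x * (k i)%:~R).
have ig : forall i, mu.-integrable circle (EFin \o (fun x => r i * cos (x * (k i)%:~R))).
  by move=> i; have := integrableZl mC (r i) (integrable_cosk (k i)).
have ifg i : mu.-integrable circle (EFin \o (fun x => r i * (f x * cos (x * (k i)%:~R)))).
  by have := integrableZl mC (r i) (integrable_mul_cos (k i) fi).
have icc i j : mu.-integrable circle (EFin \o (fun x => cos (x * (k i)%:~R) * cos (x * (k j)%:~R))).
  exact: integrable_mul_cos (integrable_cosk _).
have igg i j : mu.-integrable circle (EFin \o (fun x =>
    (r i * r j) * (cos (x * (k i)%:~R) * cos (x * (k j)%:~R)))).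
  by have := integrableZl mC (r i * r j) (icc i j).
have [ifgs fgE] := Rintegral_sum mC (index_enum _) xpredT ifg.
have igg' i := Rintegral_sum mC (index_enum 'I_N.*2.+1) xpredT (igg i).
have [iggs ggE] := Rintegral_sum mC (index_enum 'I_N.*2.+1) xpredT (fun i => (igg' i).1).
set S := \sum_(i < _) _ ^+ 2.
have fgS : \int[mu]_(x in circle) (\sum_i r i * (f x * cos (x * (k i)%:~R))) = S.
  rewrite fgE; apply: eq_bigr => i _; rewrite RintegralZl ?expr2//.
  exact: integrable_mul_cos.
have ggS : \int[mu]_(x in circle) (\sum_i \sum_j
    (r i * r j) * (cos (x * (k i)%:~R) * cos (x * (k j)%:~R))) = 2 * pi * S.
  rewrite ggE mulr_sumr; apply: eq_bigr => i _; rewrite (igg' i).2.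
  under eq_bigr do rewrite RintegralZl// Rintegral_cos_mul.
  rewrite (eq_bigr (fun j => pi * r i * (r j * (k i == k j)%:R) +
     pi * r i * (r j * (k i == - k j)%:R))); last by move=> j _; ring.
  rewrite big_split -!mulr_sumr /=.
  rewrite (bigD1 i)//= eqxx mulr1 big1 ?addr0; last first.
    move=> j ji; case: eqP => [kk|]; rewrite ?mulr0//.
    by case/eqP: ji; apply/val_inj; move: kk; rewrite /k /=; lia.
  rewrite (bigD1 (rev_ord i))//= big1 ?addr0; last first.
    move=> j ji; case: eqP => [kk|]; rewrite ?mulr0//.
    case/eqP: ji; apply/val_inj; move: kk; rewrite /k /=; have := ltn_ord i; lia.
  have kr : k i = - k (rev_ord i) by rewrite /k /=; have := ltn_ord i; lia.
  have -> : r (rev_ord i) = r i by rewrite /r kr fourier_cosN.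
  by rewrite -kr eqxx mulr1 -[fourier_cos _ _]/(r i); ring.
have i1 : mu.-integrable circle (EFin \o (fun x =>
    pi^-1 * \sum_i r i * (f x * cos (x * (k i)%:~R)))).
  by have := integrableZl mC pi^-1 ifgs.
have i2 : mu.-integrable circle (EFin \o (fun x => (2 * pi) ^- 2 *
    \sum_i \sum_j (r i * r j) * (cos (x * (k i)%:~R) * cos (x * (k j)%:~R)))).
  by have := integrableZl mC ((2 * pi) ^- 2) iggs.
have : 0 <= \int[mu]_(x in circle) (f x ^+ 2 -
    pi^-1 * (\sum_i r i * (f x * cos (x * (k i)%:~R))) +
    (2 * pi) ^- 2 * (\sum_i \sum_j (r i * r j) * (cos (x * (k i)%:~R) * cos (x * (k j)%:~R)))).
  apply: Rintegral_ge0 => x _.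
  have -> : \sum_i r i * (f x * cos (x * (k i)%:~R)) = f x * g x.
    by rewrite /g mulr_sumr; apply: eq_bigr => i _; ring.
  have -> : \sum_i \sum_j (r i * r j) * (cos (x * (k i)%:~R) * cos (x * (k j)%:~R)) = g x ^+ 2.
    rewrite /g expr2 mulr_suml; apply: eq_bigr => i _; rewrite mulr_sumr.
    by apply: eq_bigr => j _; ring.
  have sq (c a b : R) : c != 0 -> a ^+ 2 - c^-1 * (a * b) + (2 * c) ^- 2 * b ^+ 2 =
    (a - (2 * c)^-1 * b) ^+ 2 by move=> c0; field.
  by rewrite sq ?gt_eqF// sqr_ge0.
rewrite RintegralD//; last exact: (integrableB mC f2i i1).
rewrite RintegralB// RintegralZl// RintegralZl// fgS ggS.
have e1 (c : R) : c != 0 -> (2 * c) ^- 2 * (2 * c * S) = (2 * c)^-1 * S.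
  by move=> c0; field.
have e2 (c : R) : c != 0 -> c^-1 * S = (2 * c)^-1 * S + (2 * c)^-1 * S.
  by move=> c0; field.
have pin0 : pi != 0 :> R by rewrite gt_eqF.
rewrite (e1 pi pin0) (e2 pi pin0).
rewrite -ler_pdivrMl ?mulr_gt0//; set v := (2 * pi)^-1 * S.
set J := \int[mu]_(x in _) _; lra.
Qed.

End FourierCosine.

(** * Pairs of times with a given midpoint and lag *)

Section IndexPairs.

(** The elements of ['I_n] stand for the times 1, ..., n, hence the successor in
[mid]: the pair [(i, j)] consists of the times [i.+1] and [j.+1]. *)
Definition mid (n : nat) (p : 'I_n * 'I_n) : nat := ((p.1 + p.2)./2).+1.

Definition lag (n : nat) (p : 'I_n * 'I_n) : int := p.1%:Z - p.2%:Z.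

Lemma idxE (t k : int) : idx t k = t + ((k + 1) %/ 2)%Z.
Proof.
apply: floor_def; set q := ((k + 1) %/ 2)%Z.
have q1 : (2 * q)%:~R <= (k + 1)%:~R :> rat by rewrite ler_int /q; lia.
have q2 : (k + 2)%:~R <= (2 * q + 2)%:~R :> rat by rewrite ler_int /q; lia.
by move: q1 q2; rewrite !intrD !intrM => q1 q2; apply/andP; split; lra.
Qed.

Lemma int_ord (n : nat) (a : int) : 1 <= a <= n%:Z -> exists i : 'I_n, a = i.+1%:Z.
Proof.
move=> an; have h : (absz (a - 1) < n)%N by lia.
by exists (Ordinal h) => /=; lia.
Qed.

Lemma mid_range n (p : 'I_n * 'I_n) : (1 <= mid p <= n)%N.
Proof. by case: p => i j; rewrite /mid /=; have := ltn_ord i; have := ltn_ord j; lia. Qed.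

Lemma idx_mid_lag n (p : 'I_n * 'I_n) :
  idx (mid p)%:Z (lag p) = p.1.+1%:Z /\ idx (mid p)%:Z (- lag p) = p.2.+1%:Z.
Proof.
case: p => i j; rewrite !idxE /mid /lag /=; split; lia.
Qed.

Lemma mid_lag_inj n (p q : 'I_n * 'I_n) : mid p = mid q -> lag p = lag q -> p = q.
Proof.
move=> mpq lpq; have [p1 p2] := idx_mid_lag p; have [q1 q2] := idx_mid_lag q.
move: p1 p2; rewrite mpq lpq q1 q2 => /eqP + /eqP.
case: p q {mpq lpq q1 q2} => [i j] [i' j'] /=.
rewrite !eqz_nat !eqSS => /eqP h1 /eqP h2.
by congr pair; apply/val_inj; rewrite /= -?h1 -?h2.
Qed.

Lemma big_mid (V : nmodType) n (p : 'I_n * 'I_n) (F : nat -> V) :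
  \sum_(1 <= t < n.+1 | mid p == t) F t = F (mid p).
Proof.
rewrite -big_filter (eq_filter (a2 := pred1 (mid p))); last first.
  by move=> t; rewrite /= eq_sym.
rewrite filter_pred1_uniq ?big_seq1 ?iota_uniq// mem_index_iota ltnS.
exact: mid_range.
Qed.

(** At time [t] the preperiodogram runs over the lags [k] for which [idx t k] and
[idx t (- k)] are observed times; these lags are in bijection with the pairs of times
of midpoint [t]. *)
Lemma sum_valid_lag (V : nmodType) (n t : nat) (G : int -> V) : (0 < t)%N ->
  \sum_(k \in [set k : int | 1 <= idx t%:Z k <= n%:Z /\ 1 <= idx t%:Z (- k) <= n%:Z]) G k =
  \sum_(p : 'I_n * 'I_n | mid p == t) G (lag p).
Proof.
move=> t0; set A := [set k | _].
have fA : finite_set A by exact: idx_set_finite.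
rewrite fsbig_finite//.
transitivity (\sum_(k <- [seq lag p | p : 'I_n * 'I_n <- index_enum _ & mid p == t]) G k);
  last by rewrite big_map big_filter.
apply: perm_big; apply: uniq_perm.
- exact: finmap.fset_uniq.
- rewrite map_inj_in_uniq ?filter_uniq ?index_enum_uniq// => p q.
  rewrite !mem_filter => /andP[/eqP <- _] /andP[/eqP qp _].
  by apply: mid_lag_inj.
move=> k; rewrite in_fset_set//; apply/idP/mapP.
  rewrite inE /A /= => -[/int_ord [i ki] /int_ord [j kj]].
  move: (ki) (kj); rewrite !idxE => ki' kj'.
  exists (i, j); last by rewrite /lag /=; lia.
  by rewrite mem_filter mem_index_enum andbT /mid /=; apply/eqP; lia.
move=> [p]; rewrite mem_filter => /andP[/eqP pt _] ->; rewrite inE /A /= -pt.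
have [-> ->] := idx_mid_lag p.
by case: p pt => i j _ /=; have := ltn_ord i; have := ltn_ord j; split; lia.
Qed.

End IndexPairs.

(** * The empirical spectral process as a quadratic form *)

Section EmpiricalQuadraticForm.
Context {R : realType} {d : measure_display} {T : measurableType d}.
Variable P : probability T R.
Variables (X : nat -> int -> {RV P >-> R}) (n : nat) (phi : R -> R -> R).
Hypothesis n0 : (0 < n)%N.
Hypothesis iphi : forall u : R, 0 <= u <= 1 ->
  lebesgue_measure.-integrable `[- pi, pi] (EFin \o phi u).
Local Notation mu := (@lebesgue_measure R).

Definition sample (i : 'I_n) (w : T) : R := X n i.+1%:Z w.

Definition weight_matrix : 'M[R]_n := \matrix_(i, j)
  ((2 * pi * n%:R)^-1 * fourier_cos (phi ((mid (i, j))%:R / n%:R)) (lag (i, j))).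

Lemma Re_preperiodogram (x : int -> R) (t : nat) (l : R) : (0 < t)%N ->
  complex.Re (preperiodogram n x t%:Z l) =
  (2 * pi)^-1 * \sum_(p : 'I_n * 'I_n | mid p == t)
    x p.1.+1%:Z * x p.2.+1%:Z * cos (l * (lag p)%:~R).
Proof.
move=> t0; rewrite /preperiodogram sum_valid_lag//.
rewrite (_ : \sum_(p | _) _ =
  (complex.Complex (\sum_(p : 'I_n * 'I_n | mid p == t)
    x p.1.+1%:Z * x p.2.+1%:Z * cos (l * (lag p)%:~R))
  (\sum_(p : 'I_n * 'I_n | mid p == t)
    x p.1.+1%:Z * x p.2.+1%:Z * sin (- (l * (lag p)%:~R))) : R[i])).
  by rewrite /= mul0r subr0.
elim/big_ind3 : _ => //= [a1 b1 c1 a2 b2 c2 -> ->//|p /eqP <-].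
have [-> ->] := idx_mid_lag p.
by rewrite /expi cosN; congr Complex; rewrite ?mul0r ?subr0 ?addr0.
Qed.

Lemma empF_quadform w : empF X n phi w = quadform sample weight_matrix w.
Proof.
rewrite /empF quadform_sum pair_bigA /=.
transitivity (n%:R^-1 * \sum_(1 <= t < n.+1) \sum_(p : 'I_n * 'I_n | mid p == t)
   ((2 * pi)^-1 * fourier_cos (phi ((mid p)%:R / n%:R)) (lag p) * (sample p.1 w * sample p.2 w))).
  congr (_ * _); rewrite !big_nat; apply: eq_bigr => t /andP[t1 tn].
  transitivity (\int[mu]_(l in `[- pi, pi]) (\sum_(p : 'I_n * 'I_n | mid p == t)
     ((2 * pi)^-1 * (sample p.1 w * sample p.2 w)) * (phi (t%:R / n%:R) l * cos (l * (lag p)%:~R)))).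
    apply: eq_Rintegral => l _; rewrite Re_preperiodogram// !mulr_sumr.
    by apply: eq_bigr => p _; rewrite /sample; ring.
  have tn01 : 0 <= (t%:R / n%:R : R) <= 1.
    by rewrite divr_ge0//= ler_pdivrMr ?ltr0n// mul1r ler_nat.
  have ic (p : 'I_n * 'I_n) := integrable_mul_cos (lag p) (iphi tn01).
  rewrite (Rintegral_sum measurable_circle _ _ _).2 => [|p]; last first.
    by have := integrableZl (measurable_circle) ((2 * pi)^-1 * (sample p.1 w * sample p.2 w)) (ic p).
  apply: eq_bigr => p /eqP pt; rewrite RintegralZl; [|exact: measurable_circle|exact: ic].
  by rewrite pt -/(fourier_cos _ _); ring.
rewrite (exchange_big_dep xpredT) //= mulr_sumr; apply: eq_bigr => p _.
rewrite big_mid.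
rewrite mxE; case: p => i j /=.
have e (c f y : R) : c != 0 -> n%:R^-1 * ((2 * c)^-1 * f * y) =
    (2 * c * n%:R)^-1 * f * y.
  by move=> c0; field; rewrite c0 pnatr_eq0 -lt0n n0.
by rewrite e// gt_eqF// pi_gt0.
Qed.

Hypothesis rhofin : (rhoinf phi < +oo)%E.

Definition lagsup (k : int) : R :=
  fine (ereal_sup [set (Normc.normc (phihat phi u k))%:E | u in `[0%R, 1%R]]).

Lemma normc_ge0 (z : R[i]) : 0 <= Normc.normc z.
Proof. by case: z => a b; exact: sqrtr_ge0. Qed.

Lemma normr_Re_le (z : R[i]) : `|complex.Re z| <= Normc.normc z.
Proof.
case: z => a b /=; rewrite -sqrtr_sqr ler_wsqrtr// lerDl; exact: sqr_ge0.
Qed.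

Lemma Re_phihat u k : complex.Re (phihat phi u k) = fourier_cos (phi u) k.
Proof.
by rewrite /phihat /=; apply: eq_Rintegral => l _; rewrite /expi /= mul0r subr0.
Qed.

Let sup_ge0 k :
  (0 <= ereal_sup [set (Normc.normc (phihat phi u k))%:E | u in `[0%R, 1%R]])%E.
Proof.
apply: ereal_sup_ge; exists (Normc.normc (phihat phi 0 k))%:E.
  by exists 0 => //=; rewrite in_itv /= lexx ler01.
by rewrite lee_fin normc_ge0.
Qed.

Let sup_sum_le (s : seq int) : uniq s ->
  (\sum_(k <- s) ereal_sup [set (Normc.normc (phihat phi u k))%:E | u in `[0%R, 1%R]]
    <= rhoinf phi)%E.
Proof.
move=> us; rewrite /rhoinf; apply: esum_ge; exists [set` s].
  by split; [exact: finite_seq|].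
rewrite fsbig_seq//.
Qed.

Let sup_fin k :
  ereal_sup [set (Normc.normc (phihat phi u k))%:E | u in `[0%R, 1%R]] \is a fin_num.
Proof.
rewrite ge0_fin_numE//; apply: le_lt_trans rhofin.
by have := @sup_sum_le [:: k] isT; rewrite big_seq1.
Qed.

Lemma lagsup_ge0 k : 0 <= lagsup k.
Proof. exact: fine_ge0. Qed.

Lemma lagsup_ge u k : 0 <= u <= 1 -> `|fourier_cos (phi u) k| <= lagsup k.
Proof.
move=> u01; rewrite -Re_phihat (le_trans (normr_Re_le _))// -lee_fin /lagsup fineK//.
by apply: ereal_sup_ubound; exists u => //=; rewrite in_itv.
Qed.

Lemma rhoinf_fin : rhoinf phi \is a fin_num.
Proof.
by rewrite ge0_fin_numE//; apply: esum_ge0 => k _; exact: sup_ge0.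
Qed.

Lemma sum_lagsup_le (s : seq int) : uniq s ->
  \sum_(k <- s) lagsup k <= fine (rhoinf phi).
Proof.
move=> us; rewrite -lee_fin fineK ?rhoinf_fin//.
apply: le_trans (sup_sum_le us); rewrite le_eqVlt; apply/orP; left; apply/eqP.
by rewrite -sumEFin; apply: eq_bigr => k _; rewrite fineK.
Qed.

Lemma weight_matrix_sym : weight_matrix^T = weight_matrix.
Proof.
apply/matrixP => i j; rewrite !mxE /mid /lag /= addnC.
by rewrite -(fourier_cosN _ (i%:Z - j%:Z)) opprB.
Qed.

Let mid01 (p : 'I_n * 'I_n) : 0 <= ((mid p)%:R / n%:R : R) <= 1.
Proof.
have /andP[m1 mn] := mid_range p.
by rewrite divr_ge0//= ler_pdivrMr ?ltr0n// mul1r ler_nat.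
Qed.

Let twopin : 0 < (2 * pi * n%:R)^-1 :> R.
Proof. by rewrite invr_gt0 !mulr_gt0 ?pi_gt0 ?ltr0n. Qed.

(** The entries of a row have distinct lags. *)
Lemma weight_matrix_row_sum i :
  \sum_j `|weight_matrix i j| <= (2 * pi * n%:R)^-1 * fine (rhoinf phi).
Proof.
apply: (@le_trans _ _ (\sum_(j < n) (2 * pi * n%:R)^-1 * lagsup (lag (i, j)))).
  apply: ler_sum => j _; rewrite mxE normrM (gtr0_norm twopin) ler_wpM2l ?(ltW twopin)//.
  exact: lagsup_ge.
rewrite -mulr_sumr ler_wpM2l ?(ltW twopin)//.
rewrite -(big_map (fun j => lag (i, j)) xpredT lagsup); apply: sum_lagsup_le.
rewrite map_inj_in_uniq ?index_enum_uniq// => j k _ _; rewrite /lag /= => h.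
by apply/val_inj => /=; lia.
Qed.

(** The entries with midpoint [t] have distinct lags, so that Bessel's inequality
bounds their square sum by the norm of [phi (t / n)]. *)
Lemma weight_matrix_frob2 :
  ((frob2 weight_matrix)%:E <= ((2 * pi * n%:R)^-1)%:E * rho2 n phi ^+ 2)%E.
Proof.
have pi0 : 0 < (pi : R) by exact: pi_gt0.
have nR : 0 < n%:R :> R by rewrite ltr0n.
have -> : frob2 weight_matrix = (2 * pi * n%:R)^-1 ^+ 2 *
    \sum_(1 <= t < n.+1) \sum_(p : 'I_n * 'I_n | mid p == t)
      fourier_cos (phi (t%:R / n%:R)) (lag p) ^+ 2.
  rewrite /frob2 pair_bigA /= (exchange_big_dep xpredT)//= mulr_sumr.
  apply: eq_bigr => p _; rewrite mxE exprMn; congr (_ * _).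
  rewrite big_mid.
  by case: p.
rewrite /rho2 sqr_sqrte; last first.
  apply: mule_ge0; first by rewrite lee_fin invr_ge0.
  by apply: sume_ge0 => t _; apply: integral_ge0 => l _; rewrite lee_fin sqr_ge0.
set c := (2 * pi * n%:R)^-1.
have lag_le (t : nat) (g : int -> R) : (forall k, 0 <= g k) ->
    \sum_(p : 'I_n * 'I_n | mid p == t) g (lag p) <=
    \sum_(i < n.*2.+1) g (i%:Z - n%:Z).
  move=> g0; pose f (p : 'I_n * 'I_n) : 'I_n.*2.+1 := inord (absz (lag p + n%:Z)).
  have fE p : (f p)%:Z = lag p + n%:Z.
    by rewrite /f inordK; case: p => i j; rewrite /lag /=;
      have := ltn_ord i; have := ltn_ord j; lia.
  rewrite (eq_bigr (fun p => g ((f p)%:Z - n%:Z))); last first.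
    by move=> p _; rewrite fE addrK.
  rewrite -(big_imset (fun i : 'I_n.*2.+1 => g (i%:Z - n%:Z))) /=; last first.
    move=> p q; rewrite !unfold_in => /eqP pt /eqP qt fpq.
    apply: mid_lag_inj; first by rewrite pt.
    by apply: (addIr n%:Z); rewrite -!fE fpq.
  by set J := imset _ _; rewrite [leRHS](bigID (mem J)) /= lerDl sumr_ge0.
apply: (@le_trans _ _ ((c ^+ 2)%:E * ((2 * pi)%:E * \sum_(1 <= t < n.+1)
    \int[mu]_(l in `[(- pi)%R, pi%R]) (phi (t%:R / n%:R)%R l ^+ 2)%:E))%E).
  rewrite EFinM lee_pmul2l ?lte_fin ?exprn_gt0//.
  rewrite ge0_sume_distrr => [|t _]; last first.
    by apply: integral_ge0 => l _; rewrite lee_fin sqr_ge0.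
  rewrite -sumEFin !big_nat; apply: lee_sum => t /andP[t1 tn].
  have tn01 : 0 <= (t%:R / n%:R : R) <= 1.
    by rewrite divr_ge0//= ler_pdivrMr ?ltr0n// mul1r ler_nat.
  apply: le_trans (bessel_cos n (iphi tn01)); rewrite lee_fin.
  by apply: (lag_le t (fun k => fourier_cos (phi (t%:R / n%:R)) k ^+ 2)) => k; exact: sqr_ge0.
rewrite !muleA -!EFinM le_eqVlt; apply/orP; left; apply/eqP; congr (_%:E * _)%E.
have e (x : R) : x != 0 -> (2 * x * n%:R)^-1 ^+ 2 * (2 * x) = (2 * x * n%:R)^-1 * n%:R^-1.
  by move=> x0; field; rewrite x0 gt_eqF.
by rewrite /c e// gt_eqF.
Qed.

End EmpiricalQuadraticForm.

(** * Summability of the weights 1 / ell *)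

Lemma zpartialS (V : nmodType) (c : int -> V) N :
  zpartial c N.+1 = zpartial c N + (c N.+1%:Z + c (- N.+1%:Z)).
Proof.
rewrite /zpartial doubleS big_ord_recl big_ord_recr /= [RHS]addrA [RHS]addrC.
congr (_ + (_ + _)); last by congr c; rewrite /bump /=; lia.
  by congr c; lia.
by apply: eq_bigr => i _; congr c; rewrite /bump /=; lia.
Qed.

Lemma zpartial0 (V : nmodType) (c : int -> V) : zpartial c 0 = c 0.
Proof. by rewrite /zpartial big_ord1. Qed.

Section LagWeights.
Context {R : realType}.
Variable kappa : R.
Hypothesis kappa0 : 0 < kappa.
Local Notation g j := (ell kappa j)^-1.

Lemma ellN j : ell kappa (- j) = ell kappa j.
Proof. by rewrite /ell normrN. Qed.

Lemma ln_int_gt0 (j : int) : 1 < `|j| -> 0 < ln (`|j|%:~R : R).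
Proof. by move=> j1; rewrite ln_gt0// -[1]/(1%:~R) ltr_int. Qed.

Lemma ell_gt0 j : 0 < ell kappa j.
Proof.
rewrite /ell; case: ifPn => [//|]; rewrite -ltNge => j1.
by rewrite mulr_gt0 ?powR_gt0 ?ln_int_gt0// ltr0z; lia.
Qed.

Lemma inv_ell_ge0 j : 0 <= g j.
Proof. by rewrite invr_ge0 ltW// ell_gt0. Qed.

(** The boundedness of [|j| / ell j] is what absorbs the factors [|i - j|] in the
estimate of the bias. *)
Lemma norm_inv_ell_le : exists M : R, 0 < M /\
  forall j : int, g j <= M /\ `|j|%:~R * g j <= M.
Proof.
pose l2 := (ln 2 : R) `^ (1 + kappa).
have ln2 : 0 < ln 2 :> R by rewrite ln_gt0// ltr1n.
have l20 : 0 < l2 by exact: powR_gt0.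
have l20' : 0 < l2^-1 by rewrite invr_gt0.
exists (1 + l2^-1); split; first by rewrite addr_gt0.
move=> j.
have [j1|j1] := leP `|j| 1.
  rewrite /ell j1 invr1 mulr1 lerDl ltW//; split=> //.
  have : (`|j|%:~R : R) <= 1%:~R by rewrite ler_int.
  by move=> h; rewrite (le_trans h)// lerDl ltW.
have lj : l2 <= (ln (`|j|%:~R : R)) `^ (1 + kappa).
  apply: ge0_ler_powR; rewrite ?nnegrE.
  - by rewrite addr_ge0// ltW.
  - exact: ltW.
  - by rewrite ltW// ln_int_gt0.
  by rewrite ler_ln ?posrE ?ltr0n ?ltr0z//; [rewrite -[2]/(2%:~R) ler_int; lia|lia].
have jR : 1 <= `|j|%:~R :> R by rewrite -[1]/(1%:~R) ler_int; lia.
have jg : `|j|%:~R * g j <= 1 + l2^-1.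
  rewrite /ell ifF; last by apply/negbTE; rewrite -ltNge.
  rewrite invfM mulrA divff ?mul1r; last first.
    by rewrite gt_eqF// (lt_le_trans ltr01).
  rewrite (@le_trans _ _ l2^-1)// ?lerDr//.
  by rewrite lef_pV2 ?posrE// (lt_le_trans l20).
split=> //; apply: le_trans jg; rewrite ler_peMl//.
exact: inv_ell_ge0.
Qed.

(** Comparison with the telescoping series of [(ln x) `^ (- kappa) / kappa]. *)
Lemma inv_ell_telescope (n : nat) : (2 <= n)%N ->
  g n.+1%:Z <= kappa^-1 * ((ln n%:R) `^ (- kappa) - (ln n.+1%:R) `^ (- kappa)).
Proof.
move=> n2.
have n0 : 1 < n%:R :> R by rewrite ltr1n.
have nn : n%:R < n.+1%:R :> R by rewrite ltr_nat.
pose h : R -> R := (fun y : R => y `^ (- kappa)) \o (@ln R).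
have dh (x : R) : 1 < x -> is_derive x (1 : R) h (- kappa * (ln x) `^ (- kappa - 1) * x^-1).
  move=> x1; have lx : 0 < ln x by exact: ln_gt0.
  have d1 := is_derive1_ln (lt_trans ltr01 x1).
  have d2 := is_derive1_powR (- kappa) lx.
  exact: (is_derive1_comp d2 d1).
have [||c] := MVT nn (f := h) (df := fun x => - kappa * (ln x) `^ (- kappa - 1) * x^-1).
- by move=> x; rewrite in_itv /= => /andP[nx _]; apply: dh; exact: lt_trans nx.
- apply: derivable_within_continuous => x; rewrite in_itv /= => /andP[nx _].
  by have [] := dh x (lt_le_trans n0 nx).
rewrite in_itv /= => /andP[nc cn] hE.
have c1 : 1 < c by exact: lt_trans nc.
have c0 : 0 < c by rewrite (lt_trans ltr01).
have lc : 0 < ln c by exact: ln_gt0.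
have -> : (ln n%:R) `^ (- kappa) - (ln n.+1%:R) `^ (- kappa) =
    kappa * (ln c) `^ (- kappa - 1) * c^-1.
  rewrite -opprB -/(h _) -/(h _) hE -natr1 addrAC subrr add0r mulr1.
  by rewrite !mulNr opprK.
rewrite !mulrA mulVf ?gt_eqF// mul1r /ell ifF; last by apply/negbTE; rewrite -ltNge; lia.
have -> : `|n.+1%:Z|%:~R = n.+1%:R :> R by [].
rewrite invfM mulrC; apply: ler_pM.
- by rewrite invr_ge0 powR_ge0.
- by rewrite invr_ge0.
- rewrite -opprD addrC powRN lef_pV2 ?posrE ?powR_gt0//; last first.
    by rewrite ln_gt0// (lt_trans c1).
  rewrite addrC; apply: ge0_ler_powR; rewrite ?nnegrE.
  - by rewrite addr_ge0// ltW.
  - exact: ltW.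
  - by rewrite ltW// ln_gt0// (lt_trans c1).
  by rewrite ler_ln ?posrE ?ltW// (lt_trans c0).
- by rewrite lef_pV2 ?posrE ?ltW// (lt_trans c0).
Qed.

Lemma zpartial_inv_ell_le : exists L : R, 0 < L /\
  forall N, zpartial (fun j => g j) N <= L.
Proof.
pose t n : R := 2 * kappa^-1 * (ln n%:R) `^ (- kappa).
have t0 n : 0 <= t n by rewrite !mulr_ge0 ?invr_ge0 ?powR_ge0// ltW.
pose z := zpartial (fun j => g j).
have zS N : z N.+1 = z N + 2 * g N.+1%:Z.
  by rewrite /z zpartialS ellN mulr_natl mulr2n.
have zmon N : z N <= z N.+1 by rewrite zS lerDl mulr_ge0// inv_ell_ge0.
have z0 : 0 < z 0 by rewrite /z zpartial0 invr_gt0 ell_gt0.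
have zle N : z N.+2 + t N.+2 <= z 2 + t 2.
  elim: N => [//|N ih]; apply: le_trans ih; rewrite zS.
  have := inv_ell_telescope (ltn0Sn N.+1 : (2 <= N.+2)%N).
  rewrite /t => h; have : 2 * g N.+3%:Z <=
    2 * kappa^-1 * ((ln N.+2%:R) `^ (- kappa) - (ln N.+3%:R) `^ (- kappa)).
    by rewrite -mulrA ler_pM2l.
  by rewrite mulrBr; lra.
have z02 : z 0 <= z 2 by apply: le_trans (zmon 0) (zmon 1).
exists (z 2 + t 2); split; first by rewrite ltr_pwDl// (lt_le_trans z0).
case=> [|[|N]].
- by rewrite (le_trans z02)// lerDl.
- by rewrite (le_trans (zmon 1))// lerDl.
- by apply: le_trans (zle N); rewrite lerDl.
Qed.

End LagWeights.

(** * Covariances of the process *)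

Section SquareIntegrable.
Context {R : realType} {d : measure_display} {T : measurableType d}.
Variable P : probability T R.
Implicit Types f g h : T -> R.

Definition sqint f :=
  measurable_fun setT f /\ P.-integrable setT (EFin \o (fun w => f w ^+ 2)).

Definition inner f g : R := \int[P]_w (f w * g w).

Lemma sqint_mul f g : sqint f -> sqint g ->
  P.-integrable setT (EFin \o (fun w => f w * g w)).
Proof.
move=> [mf f2] [mg g2].
apply: le_integrable (integrableD measurableT f2 g2) => //.
  exact/measurable_EFinP/measurable_funM.
move=> w _ /=; rewrite lee_fin [leRHS]ger0_norm ?addr_ge0 ?sqr_ge0// normrM.
have := sqr_ge0 (`|f w| - `|g w|).
rewrite -[f w ^+ 2]real_normK ?num_real// -[g w ^+ 2]real_normK ?num_real//.
have : 0 <= `|f w| * `|g w| by rewrite mulr_ge0.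
nra.
Qed.

Lemma sqintD f g : sqint f -> sqint g -> sqint (fun w => f w + g w).
Proof.
move=> sf sg; have fg := sqint_mul sf sg; case: sf sg => mf f2 [mg g2].
split; first exact: measurable_funD.
have := integrableD measurableT (integrableD measurableT f2 g2)
  (integrableZl measurableT 2 fg).
by apply: eq_integrable => // w _ /=; rewrite -!EFinM -!EFinD; congr _%:E; ring.
Qed.

Lemma sqintZ (r : R) f : sqint f -> sqint (fun w => r * f w).
Proof.
move=> [mf f2]; split; first exact: measurable_funM.
have := integrableZl measurableT (r ^+ 2) f2.
by apply: eq_integrable => // w _ /=; rewrite exprMn.
Qed.

Lemma sqintB f g : sqint f -> sqint g -> sqint (fun w => f w - g w).
Proof.
move=> sf sg; have := sqintD sf (sqintZ (-1) sg).
by congr sqint; apply/funext => w; rewrite mulN1r.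
Qed.

Lemma sqint_cst (r : R) : sqint (cst r).
Proof.
split; first exact: measurable_cst.
exact: (@finite_measure_integrable_cst _ _ _ P setT (r ^+ 2)).
Qed.

Lemma sqint_sum (I : Type) (s : seq I) (F : I -> T -> R) :
  (forall i, sqint (F i)) -> sqint (fun w => \sum_(i <- s) F i w).
Proof.
move=> sF; elim: s => [|i s ih].
  have -> : (fun w => \sum_(i <- [::]) F i w) = cst 0.
    by apply/funext => w; rewrite big_nil.
  exact: sqint_cst.
have -> : (fun w => \sum_(j <- i :: s) F j w) =
    (fun w => F i w + \sum_(j <- s) F j w).
  by apply/funext => w; rewrite big_cons.
exact: sqintD.
Qed.

Lemma innerC f g : inner f g = inner g f.
Proof. by apply: eq_Rintegral => w _; rewrite mulrC. Qed.

Lemma innerDl f g h : sqint f -> sqint g -> sqint h ->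
  inner (fun w => f w + g w) h = inner f h + inner g h.
Proof.
move=> sf sg sh; rewrite /inner -RintegralD//; try exact: sqint_mul.
by apply: eq_Rintegral => w _; rewrite mulrDl.
Qed.

Lemma innerZl r f g : sqint f -> sqint g ->
  inner (fun w => r * f w) g = r * inner f g.
Proof.
move=> sf sg; rewrite /inner -RintegralZl//; last exact: sqint_mul.
by apply: eq_Rintegral => w _; rewrite mulrA.
Qed.

Lemma innerBl f g h : sqint f -> sqint g -> sqint h ->
  inner (fun w => f w - g w) h = inner f h - inner g h.
Proof.
move=> sf sg sh; rewrite /inner -RintegralB//; try exact: sqint_mul.
by apply: eq_Rintegral => w _; rewrite mulrBl.
Qed.

Lemma inner_suml (I : Type) (s : seq I) (F : I -> T -> R) g :
  (forall i, sqint (F i)) -> sqint g ->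
  inner (fun w => \sum_(i <- s) F i w) g = \sum_(i <- s) inner (F i) g.
Proof.
move=> sF sg; elim: s => [|i s ih].
  rewrite big_nil /inner; under eq_Rintegral do rewrite big_nil mul0r.
  exact: Ex_cst.
rewrite big_cons -ih -innerDl//; last exact: sqint_sum.
by apply: eq_Rintegral => w _; rewrite big_cons.
Qed.

Lemma inner_ge0 f : 0 <= inner f f.
Proof. by apply: Rintegral_ge0 => w _; rewrite -expr2 sqr_ge0. Qed.

Lemma inner_cauchy_schwarz f g : sqint f -> sqint g ->
  inner f g ^+ 2 <= inner f f * inner g g.
Proof.
move=> sf sg; apply: discriminant_le; rewrite ?inner_ge0// => t.
have stg := sqintZ t sg; have sfg := sqintB sf stg.
have := inner_ge0 (fun w => f w - t * g w).
rewrite innerBl// innerZl// ![inner _ (fun w => _ - _)]innerC !innerBl//.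
by rewrite ![inner (fun w => t * _) _]innerZl// (innerC g f); congr (_ <= _); ring.
Qed.

End SquareIntegrable.

Lemma cvg_sqr0 {R : realType} (u v : nat -> R) : (forall n, u n ^+ 2 <= v n) ->
  v n @[n --> \oo] --> 0 -> u n @[n --> \oo] --> 0.
Proof.
move=> uv v0; apply/cvgr0Pnorm_lt => e e0.
have e2 : 0 < e ^+ 2 by rewrite exprn_gt0.
have /cvgr0Pnorm_lt/(_ _ e2) := v0; apply: filterS => n h.
rewrite -ltr_sqr ?nnegrE ?(ltW e0)// (le_lt_trans _ h)//.
by rewrite real_normK ?num_real// (le_trans (uv n))// ler_norm.
Qed.

Lemma cvg_sumr {R : realType} (I : Type) (s : seq I) (F : I -> nat -> R) (l : I -> R) :
  (forall i, F i N @[N --> \oo] --> l i) ->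
  \sum_(i <- s) F i N @[N --> \oo] --> \sum_(i <- s) l i.
Proof.
move=> Fl; elim: s => [|i s ih].
  by rewrite big_nil; under eq_fun do rewrite big_nil; exact: cvg_cst.
rewrite big_cons; under eq_fun do rewrite big_cons.
by apply: cvgD; [exact: Fl|exact: ih].
Qed.

Section Covariance.
Context {R : realType} {d : measure_display} {T : measurableType d}.
Variable P : probability T R.
Variables (kappa : R) (eps : int -> {RV P >-> R}) (X : nat -> int -> {RV P >-> R}).
Variables (an : nat -> int -> int -> R) (a : R -> int -> R) (K : R).
Hypothesis ls : locally_stationary kappa eps X an a K.
Hypothesis Xg : gaussian_process X.
Local Notation sq := (sqint P).
Local Notation ip := (inner P).
Local Notation Xs n := (@sample R d T P X n).

Lemma expectationE (f : T -> R) : ('E_P[f] = \int[P]_w (f w)%:E)%E.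
Proof. by rewrite unlock. Qed.

Lemma sqint_eps t : sq (eps t).
Proof.
split; first exact: measurable_funPT.
apply/integrableP; split.
  apply/measurable_EFinP/measurable_funX; exact: measurable_funPT.
have := ls_variance ls t; rewrite expectationE.
under [X in (X < _)%E]eq_integral do rewrite /= ger0_norm ?sqr_ge0//.
by move=> ->; rewrite ltry.
Qed.

Lemma inner_eps s t : ip (eps s) (eps t) = (s == t)%:R.
Proof.
rewrite /inner /Rintegral; have [<-|st] := eqVneq s t.
  have := ls_variance ls s; rewrite expectationE => /(congr1 fine).
  exact.
by have := ls_uncorrelated ls st; rewrite expectationE => ->.
Qed.

Lemma Ex_eps t : \int[P]_w eps t w = 0.
Proof. by have := ls_mean ls t; rewrite /Rintegral expectationE => ->. Qed.

Lemma gaussian_linform n (c : 'rV[R]_n) : gaussian P (linform (Xs n) c).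
Proof.
have := Xg n (fun t => if insub t.-1 is Some i then c 0 i else 0).
congr gaussian; apply/funext => w; rewrite big_add1 /= big_mkord.
by apply: eq_bigr => i _; rewrite valK.
Qed.

Definition Xtrunc (n : nat) (t : int) (N : nat) (w : T) : R :=
  zpartial (fun j => an n t j * eps (t - j) w) N.

Lemma sqint_Xtrunc n t N : sq (Xtrunc n t N).
Proof. by apply: sqint_sum => i; apply: sqintZ; exact: sqint_eps. Qed.

Lemma sqint_sample n i : sq (Xs n i).
Proof.
have m : all_moments P (Xs n i).
  apply: gaussian_all_moments; first exact: measurable_funPT.
  have := gaussian_linform (delta_mx 0 i); congr gaussian.
  by apply/funext => w; rewrite linform_delta.
split; first exact: measurable_funPT.
exact: all_moments_integrable (all_momentsX 2 m).
Qed.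

Local Notation diff n i N := (fun w => Xs n i w - Xtrunc n i.+1%:Z N w).

Lemma cvg_Xtrunc n (i : 'I_n) : ip (diff n i N) (diff n i N) @[N --> \oo] --> 0.
Proof.
have h : 1 <= i.+1%:Z <= n%:Z by have := ltn_ord i; lia.
have := ls_repr ls h.
have -> : (fun N => 'E_P[fun w => ((X n i.+1%:Z w -
    zpartial (fun j : int => an n i.+1%:Z j * eps (i.+1%:Z - j) w) N) ^+ 2)%R]%E) =
  (fun N => (ip (diff n i N) (diff n i N))%:E).
  apply/funext => N; rewrite expectationE /inner /Rintegral fineK.
    by apply: eq_integral => w _; rewrite expr2.
  apply: integrable_fin_num => //; have s := sqintB (sqint_sample i) (sqint_Xtrunc n i.+1%:Z N).
  exact: (sqint_mul s s).
by move/fine_cvgP => [_].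
Qed.

(** The means pass to the limit in mean square. *)
Lemma Ex_sample n i : \int[P]_w Xs n i w = 0.
Proof.
have s1 := sqint_cst P 1.
have E1 f : sq f -> \int[P]_w f w = ip f (cst 1).
  by move=> _; apply: eq_Rintegral => w _; rewrite mulr1.
have sD N := sqintB (sqint_sample i) (sqint_Xtrunc n i.+1%:Z N).
have h N : (\int[P]_w Xs n i w) ^+ 2 <= ip (diff n i N) (diff n i N).
  have -> : \int[P]_w Xs n i w = ip (diff n i N) (cst 1).
    rewrite innerBl//; [|exact: sqint_sample|exact: sqint_Xtrunc].
    rewrite -!E1; [|exact: sqint_Xtrunc|exact: sqint_sample].
    rewrite [X in _ - X](_ : _ = 0) ?subr0// E1; last exact: sqint_Xtrunc.
    rewrite inner_suml//; last by move=> j; apply: sqintZ; exact: sqint_eps.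
    rewrite big1// => j _; rewrite innerZl//; last exact: sqint_eps.
    by rewrite -E1 ?Ex_eps ?mulr0//; exact: sqint_eps.
  apply: le_trans (inner_cauchy_schwarz (sD N) s1) _.
  rewrite -(E1 (cst 1))// Ex_cst mulr1//.
have := cvg_sqr0 h (@cvg_Xtrunc n i) => c.
have /cvg_lim <- // := c; apply/esym/cvg_lim => //; exact: cvg_cst.
Qed.

Lemma inner_Xtrunc n s t N :
  ip (Xtrunc n s N) (Xtrunc n t N) =
  zpartial (fun i => zpartial (fun j => an n s i * an n t j * (s - i == t - j)%:R) N) N.
Proof.
have se u (j : int) : sq (fun w => an n u j * eps (u - j) w).
  by apply: sqintZ; exact: sqint_eps.
rewrite inner_suml//; last exact: sqint_Xtrunc.
apply: eq_bigr => i _; rewrite innerC inner_suml//; apply: eq_bigr => j _.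
rewrite innerC innerZl//; last exact: sqint_eps.
by rewrite innerC innerZl ?inner_eps 1?eq_sym ?mulrA//; exact: sqint_eps.
Qed.

(** Write each truncation as the variable minus a remainder that is small in mean
square, and expand. *)
Lemma cvg_inner_Xtrunc n (i j : 'I_n) :
  ip (Xtrunc n i.+1%:Z N) (Xtrunc n j.+1%:Z N) @[N --> \oo] -->
  covmx P (Xs n) i j.
Proof.
have sD (k : 'I_n) N := sqintB (sqint_sample k) (sqint_Xtrunc n k.+1%:Z N).
have sX k := @sqint_sample n k.
have c0 k := @cvg_Xtrunc n k.
have h1 : ip (diff n i N) (Xs n j) @[N --> \oo] --> 0.
  refine (cvg_sqr0 (fun N => inner_cauchy_schwarz (sD i N) (sX j)) _).
  by rewrite -(mul0r (ip (Xs n j) (Xs n j))); apply: cvgM; [exact: c0|exact: cvg_cst].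
have h2 : ip (diff n j N) (Xs n i) @[N --> \oo] --> 0.
  refine (cvg_sqr0 (fun N => inner_cauchy_schwarz (sD j N) (sX i)) _).
  by rewrite -(mul0r (ip (Xs n i) (Xs n i))); apply: cvgM; [exact: c0|exact: cvg_cst].
have h3 : ip (diff n i N) (diff n j N) @[N --> \oo] --> 0.
  refine (cvg_sqr0 (fun N => inner_cauchy_schwarz (sD i N) (sD j N)) _).
  by rewrite -(mul0r 0); apply: cvgM; exact: c0.
have -> : (fun N => ip (Xtrunc n i.+1%:Z N) (Xtrunc n j.+1%:Z N)) =
  (fun N => covmx P (Xs n) i j - ip (diff n i N) (Xs n j) -
    ip (diff n j N) (Xs n i) + ip (diff n i N) (diff n j N)).
  apply/funext => N; rewrite mxE -/(inner P _ _).
  have st k := sqint_Xtrunc n k N.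
  rewrite !innerBl// ![inner P _ (fun w => _ - _)]innerC !innerBl//.
  rewrite (innerC P (Xs n j) (Xs n i)).
  rewrite (innerC P (Xtrunc n j.+1%:Z N) (Xtrunc n i.+1%:Z N)).
  rewrite (innerC P (Xtrunc n i.+1%:Z N) (Xs n j)).
  rewrite (innerC P (Xtrunc n j.+1%:Z N) (Xs n i)).
  ring.
rewrite -[X in _ --> X](_ : covmx P (Xs n) i j - 0 - 0 + 0 = _); last by rewrite !subr0 addr0.
by apply: cvgD => //; apply: cvgB => //; apply: cvgB => //; exact: cvg_cst.
Qed.

End Covariance.

Section CovarianceRowSums.
Context {R : realType} {d : measure_display} {T : measurableType d}.
Variable P : probability T R.
Variables (kappa : R) (eps : int -> {RV P >-> R}) (X : nat -> int -> {RV P >-> R}).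
Variables (an : nat -> int -> int -> R) (a : R -> int -> R) (K L : R).
Hypothesis kappa0 : 0 < kappa.
Hypothesis ls : locally_stationary kappa eps X an a K.
Hypothesis Xg : gaussian_process X.
Hypothesis hL : forall N, zpartial (fun j => (ell kappa j)^-1) N <= L.
Local Notation Xs n := (@sample R d T P X n).
Local Notation g j := (ell kappa j)^-1.

Lemma ls_K_ge0 : 0 <= K.
Proof.
have := ls_an_le ls (n := 1) (t := 1) 0 isT.
by rewrite /ell normr0 ler01 divr1; exact: le_trans.
Qed.

Lemma ls_L_ge0 : 0 <= L.
Proof.
apply: le_trans (hL 0); rewrite zpartial0; exact: inv_ell_ge0.
Qed.

(** For the truncated process the row sum is at most the sum of the products
[K / ell p * (K / ell q)]: each pair of coefficients [p], [q] correlates the time [i]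
with at most one time [j]. *)
Lemma covmx_row_sum n (i : 'I_n) : \sum_j `|covmx P (Xs n) i j| <= (K * L) ^+ 2.
Proof.
have K0 := ls_K_ge0; have L0 := ls_L_ge0.
have bound N : \sum_(j < n) `|inner P (Xtrunc eps an n i.+1%:Z N) (Xtrunc eps an n j.+1%:Z N)|
    <= (K * L) ^+ 2.
  have ran (j : 'I_n) : 1 <= j.+1%:Z <= n%:Z by have := ltn_ord j; lia.
  apply: (@le_trans _ _ (\sum_(j < n) \sum_(p < N.*2.+1) \sum_(q < N.*2.+1)
     (K * g (p%:Z - N%:Z)) * (K * g (q%:Z - N%:Z)) *
      (i.+1%:Z - (p%:Z - N%:Z) == j.+1%:Z - (q%:Z - N%:Z))%:R)).
    apply: ler_sum => j _; rewrite (inner_Xtrunc ls).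
    apply: le_trans (ler_norm_sum _ _ _) _; apply: ler_sum => p _.
    apply: le_trans (ler_norm_sum _ _ _) _; apply: ler_sum => q _.
    rewrite normrM [`|_%:R|]ger0_norm// ler_wpM2r// normrM; apply: ler_pM => //.
      exact: (ls_an_le ls _ (ran i)).
    exact: (ls_an_le ls _ (ran j)).
  rewrite exchange_big /=.
  have -> : (K * L) ^+ 2 = (K * L) * (K * L) by rewrite expr2.
  have zK : \sum_(p < N.*2.+1) K * g (p%:Z - N%:Z) <= K * L.
    by rewrite -mulr_sumr ler_wpM2l//; exact: hL.
  have pos (k : int) : 0 <= K * g k by rewrite mulr_ge0// inv_ell_ge0.
  apply: (@le_trans _ _ ((\sum_(p < N.*2.+1) K * g (p%:Z - N%:Z)) *
      (\sum_(q < N.*2.+1) K * g (q%:Z - N%:Z)))); last first.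
    by apply: ler_pM => //; apply: sumr_ge0 => p _; exact: pos.
  rewrite mulr_suml; apply: ler_sum => p _; rewrite exchange_big mulr_sumr /=.
  apply: ler_sum => q _; rewrite -mulr_sumr ler_piMr//.
    by apply: mulr_ge0; exact: pos.
  have [[j0 hj0]|none] := pselect (exists j0 : 'I_n,
      i.+1%:Z - (p%:Z - N%:Z) = j0.+1%:Z - (q%:Z - N%:Z)).
    rewrite (bigD1 j0)//= hj0 eqxx big1 ?addr0// => j jj0.
    case: eqP => // h; case/eqP: jj0; apply/val_inj => /=; lia.
  by rewrite big1// => j _; case: eqP => // h; case: none; exists j.
have c : (fun N => \sum_(j < n) `|inner P (Xtrunc eps an n i.+1%:Z N) (Xtrunc eps an n j.+1%:Z N)|)
   @ \oo --> \sum_j `|covmx P (Xs n) i j|.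
  apply: cvg_sumr => j; apply: cvg_norm.
  exact: (cvg_inner_Xtrunc ls Xg).
rewrite -(cvg_lim _ c)//; apply: limr_le; first exact: (cvgP _ c).
exact: nearW.
Qed.

End CovarianceRowSums.

(** * Functions of bounded variation on a grid *)

Section VariationMajorant.
Context {R : realType}.
Local Notation mu := (@lebesgue_measure R).
Local Notation unit_itv := (`]0%R, 1%R]%classic : set R).
Implicit Types f g : R -> R.

(** [W x] is a substitute for the total variation of [f] on [[x, 1]]. A monotone
majorant of the increments is all that products, grid sums and integrals ask for, and
it spares the manipulation of partitions. *)
Definition variation_at_most f (V : R) := exists W : R -> R,
  (forall x, 0 < x <= 1 -> 0 <= W x <= V) /\
  (forall x y, 0 < x -> x <= y -> y <= 1 -> `|f x - f y| <= W x - W y).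

Lemma total_variation_at_most f V :
  (forall u, 0 < u <= 1 -> (total_variation u 1 f <= V%:E)%E) -> variation_at_most f V.
Proof.
move=> h; exists (fun u => fine (total_variation u 1 f)).
have fin u : 0 < u <= 1 -> total_variation u 1 f \is a fin_num.
  move=> u01; rewrite ge0_fin_numE; last by apply: total_variation_ge0; case/andP: u01.
  by apply: le_lt_trans (h u u01) _; rewrite ltry.
split=> [x x01|x y x0 xy y1].
  rewrite -!lee_fin fineK ?fin// h// total_variation_ge0//; by case/andP: x01.
have x01 : 0 < x <= 1 by rewrite x0 (le_trans xy).
have y01 : 0 < y <= 1 by rewrite y1 (lt_le_trans x0).
have := fin x x01; rewrite (total_variationD f xy y1) fin_numD => /andP[fxy fy].
rewrite fineD// addrK -lee_fin fineK// -normrN opprB.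
exact: total_variation_ge.
Qed.

Lemma variation_at_mostM f g (Mf Mg Vf Vg : R) :
  (forall x, 0 < x <= 1 -> `|f x| <= Mf) -> (forall x, 0 < x <= 1 -> `|g x| <= Mg) ->
  variation_at_most f Vf -> variation_at_most g Vg ->
  variation_at_most (fun x => f x * g x) (Mg * Vf + Mf * Vg).
Proof.
move=> fM gM [Wf [Wf0 hf]] [Wg [Wg0 hg]].
have one : (0 < (1 : R)) && ((1 : R) <= 1) by rewrite ltr01 /=.
have Mf0 : 0 <= Mf := le_trans (normr_ge0 _) (fM 1 one).
have Mg0 : 0 <= Mg := le_trans (normr_ge0 _) (gM 1 one).
exists (fun x => Mg * Wf x + Mf * Wg x); split=> [x x01|x y x0 xy y1].
  have /andP[f0 fV] := Wf0 x x01; have /andP[g0 gV] := Wg0 x x01.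
  by rewrite addr_ge0 ?mulr_ge0// lerD// ler_wpM2l.
have x01 : 0 < x <= 1 by rewrite x0 (le_trans xy).
have y01 : 0 < y <= 1 by rewrite y1 (lt_le_trans x0).
have -> : f x * g x - f y * g y = g x * (f x - f y) + f y * (g x - g y) by ring.
apply: le_trans (ler_normD _ _) _; rewrite !normrM.
have -> : Mg * Wf x + Mf * Wg x - (Mg * Wf y + Mf * Wg y) =
  Mg * (Wf x - Wf y) + Mf * (Wg x - Wg y) by ring.
by apply: lerD; apply: ler_pM => //; [exact: gM|exact: hf|exact: fM|exact: hg].
Qed.

Let monotone_measurable (h : R -> R) :
  (forall x y, 0 < x -> x <= y -> y <= 1 -> h y <= h x) ->
  measurable_fun unit_itv h.
Proof.
move=> hm; apply: (measurability (@RGenCInfty.G R)) => [|/= _ [_] [r] -> <-].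
  exact: RGenCInfty.measurableE.
apply: is_interval_measurable => s t/=.
rewrite !in_itv/= !andbT => -[/andP[s0 s1] hs] [/andP[t0 t1] ht] u /andP[su ut].
rewrite in_itv /= (lt_le_trans s0 su) (le_trans ut t1); split=> //.
by rewrite in_itv /= andbT (le_trans ht)// hm// (lt_le_trans s0).
Qed.

(** [f] is the difference of the monotone functions [f + W] and [W]. *)
Lemma variation_at_most_measurable f V : variation_at_most f V -> measurable_fun unit_itv f.
Proof.
move=> [W [W0 hW]].
have mW : measurable_fun unit_itv W.
  apply: monotone_measurable => x y x0 xy y1; rewrite -subr_ge0.
  by apply: le_trans (hW x y x0 xy y1).
have mfW : measurable_fun unit_itv (fun x => f x + W x).
  apply: monotone_measurable => x y x0 xy y1; have := hW x y x0 xy y1.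
  by rewrite ler_norml; lra.
have -> : f = (fun x => f x + W x) \- W by apply/funext => x /=; rewrite addrK.
exact: measurable_funB.
Qed.

Let bounded_itv_integrable (a b : R) (f : R -> R) (M : R) : a < b ->
  measurable_fun (`]a, b]%classic : set R) f ->
  (forall x, a < x <= b -> `|f x| <= M) ->
  mu.-integrable `]a, b] (EFin \o f).
Proof.
move=> ab mf fM; apply: measurable_bounded_integrable => //.
  have h : (mu `]a, b] < +oo)%E by rewrite lebesgue_measure_itv /= lte_fin ab -EFinB ltry.
  exact: h.
exists M; split; first exact: num_real.
move=> y My x; rewrite /= in_itv /= => xab; exact: le_trans (fM x xab) (ltW My).
Qed.

Lemma bounded_variation_integrable f (M V : R) : (forall x, 0 < x <= 1 -> `|f x| <= M) ->
  variation_at_most f V -> mu.-integrable unit_itv (EFin \o f).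
Proof.
move=> fM fV; apply: (bounded_itv_integrable ltr01 _ fM).
exact: variation_at_most_measurable fV.
Qed.

Lemma sum_inj_le (I : finType) (Q : pred I) (al : I -> nat) (h : nat -> R) (N : nat) :
  (forall t, 0 <= h t) -> (forall i, Q i -> (al i < N)%N) ->
  {in Q &, injective al} -> \sum_(i | Q i) h (al i) <= \sum_(t < N) h t.
Proof.
move=> h0 aN ainj.
rewrite (eq_bigr (fun i => \sum_(t < N | t == al i :> nat) h t)); last first.
  move=> i Qi; rewrite (eq_bigl (pred1 (Ordinal (aN i Qi)))) ?big_pred1_eq//.
rewrite (exchange_big_dep xpredT)//=; apply: ler_sum => t _.
have [[i /andP[Qi ti]]|none] := pselect (exists i, Q i && (t == al i :> nat)).
  rewrite (bigD1 i) ?Qi//= big1 ?addr0// => j /andP[/andP[Qj tj] /eqP[]].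
  by apply: ainj => //; rewrite -(eqP tj) (eqP ti).
by rewrite big1// => i Qi; case: none; exists i.
Qed.

Variables (n : nat).
Hypothesis n0 : (0 < n)%N.

Lemma grid01 t : (t < n)%N -> 0 < (t.+1%:R / n%:R : R) <= 1.
Proof.
move=> tn; rewrite divr_gt0 ?ltr0n//=.
by rewrite ler_pdivrMr ?ltr0n// mul1r ler_nat.
Qed.

Let grid_le s t : (s <= t)%N -> s%:R / n%:R <= t%:R / n%:R :> R.
Proof. by move=> st; rewrite ler_wpM2r ?invr_ge0// ler_nat. Qed.

(** The differences [w t - w (t + m)] of the monotone sequence [w] overlap at most
[m] times. *)
Lemma variation_at_most_shift f V (m : nat) : 0 <= V -> variation_at_most f V ->
  \sum_(t < n - m) `|f (t.+1%:R / n%:R) - f ((t + m).+1%:R / n%:R)| <= m%:R * V.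
Proof.
move=> V0 [W [W0 hW]]; pose w t := W (t.+1%:R / n%:R).
have wdec s t : (s <= t)%N -> (t < n)%N ->
    `|f (s.+1%:R / n%:R) - f (t.+1%:R / n%:R)| <= w s - w t.
  move=> st tn; apply: hW; [|exact: grid_le|].
    by have /andP[] := grid01 (leq_ltn_trans st tn).
  by have /andP[] := grid01 tn.
apply: (@le_trans _ _ (\sum_(t < n - m) (w t - w (t + m)%N))).
  by apply: ler_sum => t _; apply: wdec; have := ltn_ord t; lia.
elim: m => [|m ih]; first by rewrite mul0r big1// => t _; rewrite addn0 subrr.
have [nm|mn] := leqP n m.
  have -> : (n - m.+1)%N = 0%N by lia.
  by rewrite big_ord0 mulr_ge0.
have E : (n - m)%N = (n - m.+1).+1 by lia.
rewrite (eq_bigr (fun t : 'I_(n - m.+1) => (w t - w (t + m)%N) + (w (t + m)%N - w (t + m.+1)%N)));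
  last by move=> t _; rewrite addrA subrK.
rewrite big_split -natr1 mulrDl mul1r /=; apply: lerD.
  apply: le_trans ih; rewrite E big_ord_recr /= lerDl.
  apply: le_trans (wdec _ (n - m.+1 + m)%N _ _) => //; lia.
have -> : \sum_(t < n - m.+1) (w (t + m)%N - w (t + m.+1)%N) = w m - w (n.-1)%N.
  rewrite -(big_mkord xpredT (fun t => w (t + m)%N - w (t + m.+1)%N)).
  rewrite (eq_bigr (fun t => - (w (t.+1 + m)%N - w (t + m)%N))); last first.
    by move=> t _; rewrite opprB addSnnS.
  rewrite sumrN telescope_sumr// opprB add0n; congr (_ - w _); lia.
have /andP[_ h1] := W0 _ (grid01 mn).
have n1 : (n.-1 < n)%N by lia.
by have /andP[h2 _] := W0 _ (grid01 n1); rewrite lerBlDr (le_trans h1)// lerDl.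
Qed.

(** On the cell between [t / n] and [t.+1 / n], [f] differs from its value at the
right end by at most the decrease of [W] across the cell, and these decreases
telescope. *)
Lemma riemann_sum f (M V : R) : (forall x, 0 < x <= 1 -> `|f x| <= M) ->
  variation_at_most f V ->
  `|\sum_(t < n) f (t.+1%:R / n%:R) - n%:R * \int[mu]_(x in `]0, 1]) f x| <= V.
Proof.
move=> fM fV; have fi := bounded_variation_integrable fM fV.
have nR : 0 < n%:R :> R by rewrite ltr0n.
have nR0 : n%:R != 0 :> R by rewrite gt_eqF.
case: fV => [W [W0 hW]].
pose cell t := `](t%:R / n%:R), (t.+1%:R / n%:R)]%classic : set (measurableTypeR R).
have cell01 t : (t < n)%N -> cell t `<=` unit_itv.
  move=> tn x; rewrite /cell /= !in_itv /= => /andP[tx xt].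
  rewrite (le_lt_trans _ tx) ?divr_ge0//= (le_trans xt)//.
  by have /andP[] := grid01 tn.
have icell t (tn : (t < n)%N) : mu.-integrable (cell t) (EFin \o f).
  by apply: integrableS fi => //; [exact: measurable_itv|exact: cell01].
have mcell t : mu (cell t) = (n%:R^-1)%:E.
  rewrite lebesgue_measure_itv /= lte_fin ltr_pM2r ?invr_gt0// ltr_nat leqnn.
  by rewrite -EFinB -natr1 mulrDl mul1r addrAC subrr add0r.
have split m : (m <= n)%N ->
    \int[mu]_(x in `]0, (m%:R / n%:R)]) f x = \sum_(t < m) \int[mu]_(x in cell t) f x.
  elim: m => [|m ih] mn; first by rewrite big_ord0 mul0r set_itvoc0 Rintegral_set0.
  rewrite big_ord_recr /= -ih; last exact: ltnW.
  apply/eqP; rewrite addrC -subr_eq; apply/eqP.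
  apply: Rintegral_itvB.
  - apply: integrableS fi => // x /=; rewrite !in_itv /= => /andP[-> h] /=.
    by apply: le_trans h _; have /andP[] := grid01 mn.
  - by rewrite bnd_simp divr_ge0.
  - by rewrite bnd_simp grid_le.
have -> : \int[mu]_(x in `]0, 1]) f x = \sum_(t < n) \int[mu]_(x in cell t) f x.
  by rewrite -split// divff.
(* [W] is not controlled at 0, where the bound [V] takes its place. *)
pose w t := if t is 0%N then V else W (t%:R / n%:R).
have osc t x : (t < n)%N -> cell t x -> `|f (t.+1%:R / n%:R) - f x| <= w t - w t.+1.
  move=> tn; rewrite /cell /= in_itv /= => /andP[tx xt].
  have x0 : 0 < x by apply: le_lt_trans tx; rewrite divr_ge0.
  have /andP[_ t1] := grid01 tn.
  rewrite -normrN opprB (le_trans (hW x _ x0 xt t1))// lerD2r.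
  case: t tn tx xt t1 => [|t] tn tx xt t1.
    have xx : 0 < x <= 1 by rewrite x0 (le_trans xt).
    by have /andP[] := W0 x xx.
  rewrite -subr_ge0; apply: le_trans (hW (t.+1%:R / n%:R) x _ (ltW tx) _) => //.
    by rewrite divr_gt0 ?ltr0n.
  exact: le_trans t1.
have cellE t : (t < n)%N -> `|f (t.+1%:R / n%:R) - n%:R * \int[mu]_(x in cell t) f x| <= w t - w t.+1.
  move=> tn; set c := f _.
  have mc : measurable (cell t) by exact: measurable_itv.
  have ic (r : R) : mu.-integrable (cell t) (EFin \o cst r).
    have h : t%:R / n%:R < t.+1%:R / n%:R :> R by rewrite ltr_pM2r ?invr_gt0// ltr_nat.
    by apply: (bounded_itv_integrable h (measurable_cst r) (M := `|r|)).
  have cE (r : R) : \int[mu]_(x in cell t) r = r * n%:R^-1.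
    by rewrite Rintegral_cst//; congr (_ * _); exact: (congr1 fine (mcell t)).
  have -> : c - n%:R * \int[mu]_(x in cell t) f x =
      n%:R * \int[mu]_(x in cell t) (c - f x).
    have -> : \int[mu]_(x in cell t) (c - f x) = c / n%:R - \int[mu]_(x in cell t) f x.
      by rewrite -cE; exact: (RintegralB mc (ic c) (icell t tn)).
    by rewrite mulrBr mulrCA divff// mulr1.
  rewrite normrM gtr0_norm// -ler_pdivlMl// mulrC -cE.
  have icf : mu.-integrable (cell t) (EFin \o (fun x => c - f x)).
    by have := integrableB mc (ic c) (icell t tn).
  apply: le_trans (le_normr_Rintegral mc icf) _.
  apply: le_Rintegral => //; [|exact: ic|by move=> x xc; apply: osc].
  by have := integrable_norm icf; apply: eq_integrable.
rewrite mulr_sumr -sumrB; apply: le_trans (ler_norm_sum _ _ _) _.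
apply: (@le_trans _ _ (\sum_(t < n) (w t - w t.+1))).
  by apply: ler_sum => t _; exact: cellE.
rewrite -(big_mkord xpredT (fun t => w t - w t.+1)).
rewrite (eq_bigr (fun t => - (w t.+1 - w t))); last by move=> t _; rewrite opprB.
rewrite sumrN telescope_sumr// opprB lerBlDr lerDl.
have n1 : (n.-1 < n)%N by lia.
have /andP[] := W0 _ (grid01 n1).
by rewrite /w prednK//; case: (n) n0.
Qed.

End VariationMajorant.

(** * Sums along a fixed lag *)

Section LagSums.
Context {R : realType}.
Local Notation mu := (@lebesgue_measure R).
Variable n : nat.
Hypothesis n0 : (0 < n)%N.
Implicit Types (f g r : R -> R) (k : int) (p : 'I_n * 'I_n).

Lemma sum_shift_le f (V : R) (I : finType) (Q : pred I) (al be : I -> nat) (c : nat) :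
  0 <= V -> variation_at_most f V -> {in Q &, injective al} ->
  (forall i, Q i -> be i = (al i + c)%N /\ (be i < n)%N) ->
  \sum_(i | Q i) `|f ((al i).+1%:R / n%:R) - f ((be i).+1%:R / n%:R)| <= c%:R * V.
Proof.
move=> V0 fV ainj h; apply: le_trans (variation_at_most_shift n0 c V0 fV).
rewrite (eq_bigr (fun i => `|f ((al i).+1%:R / n%:R) - f ((al i + c).+1%:R / n%:R)|)); last first.
  by move=> i /h[->].
apply: (sum_inj_le (h := fun t => `|f (t.+1%:R / n%:R) - f ((t + c).+1%:R / n%:R)|)) => //.
by move=> i /h[-> ]; lia.
Qed.

Let fst_inj k : {in (fun p => lag p == k) &, injective (fun p => p.1 : nat)}.
Proof.
move=> [i j] [i' j']; rewrite !unfold_in /lag /= => /eqP h1 /eqP h2 h3.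
by congr pair; apply/val_inj => /=; lia.
Qed.

Let snd_inj k : {in (fun p => lag p == k) &, injective (fun p => p.2 : nat)}.
Proof.
move=> [i j] [i' j']; rewrite !unfold_in /lag /= => /eqP h1 /eqP h2 h3.
by congr pair; apply/val_inj => /=; lia.
Qed.

Let mid_inj k : {in (fun p => lag p == k) &, injective (fun p => (mid p).-1)}.
Proof.
move=> p q; rewrite !unfold_in => /eqP h1 /eqP h2 /= h.
by apply: mid_lag_inj; [move: h; rewrite /mid /= => ->|rewrite h1 h2].
Qed.

Lemma sum_shift_fst f (V : R) k : 0 <= V -> variation_at_most f V ->
  \sum_(p : 'I_n * 'I_n | lag p == k) `|f (p.1.+1%:R / n%:R) - f ((mid p)%:R / n%:R)| <= (absz k)%:R * V.
Proof.
move=> V0 fV; have [k0|k0] := leP 0 k.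
  apply: (@le_trans _ _ ((uphalf (absz k))%:R * V)); last first.
    by rewrite ler_wpM2r// ler_nat; lia.
  under eq_bigr do rewrite distrC.
  apply: (sum_shift_le (al := fun p => (mid p).-1) (be := fun p => p.1 : nat) V0 fV).
    exact: mid_inj.
  move=> [i j]; rewrite /lag /mid /= => /eqP kE; have := ltn_ord i; split=> //; lia.
apply: (@le_trans _ _ ((half (absz k))%:R * V)); last first.
  by rewrite ler_wpM2r// ler_nat; lia.
apply: (sum_shift_le (be := fun p => (mid p).-1) (al := fun p => p.1 : nat) V0 fV).
  exact: fst_inj.
move=> [i j]; rewrite /lag /mid /= => /eqP kE; have := ltn_ord i; have := ltn_ord j.
by split; lia.
Qed.

Lemma sum_shift_snd f (V : R) k : 0 <= V -> variation_at_most f V ->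
  \sum_(p : 'I_n * 'I_n | lag p == k) `|f (p.2.+1%:R / n%:R) - f ((mid p)%:R / n%:R)| <= (absz k)%:R * V.
Proof.
move=> V0 fV; rewrite (reindex_inj (h := fun p => (p.2, p.1))); last first.
  by move=> [? ?] [? ?] [-> ->].
rewrite -abszN; apply: le_trans (sum_shift_fst (- k) V0 fV).
rewrite le_eqVlt; apply/orP; left; apply/eqP; apply: eq_big => -[i j].
  by rewrite /lag /=; lia.
by move=> _; rewrite /mid /= addnC.
Qed.

(** The midpoints of the pairs with lag [k] miss at most [|k|] points of the grid,
    half of them at each end. *)
Lemma sum_midpoints (H : nat -> R) (M : R) k : (forall t, (t < n)%N -> `|H t| <= M) ->
  `|\sum_(p : 'I_n * 'I_n | lag p == k) H (mid p).-1 - \sum_(t < n) H t| <= (absz k)%:R * M.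
Proof.
move=> HM; have M0 : 0 <= M := le_trans (normr_ge0 _) (HM 0%N n0).
pose c := absz k.
have mlt p : ((mid p).-1 < n)%N by have := mid_range p; lia.
rewrite (eq_bigr (fun p => \sum_(t < n | t == (mid p).-1 :> nat) H t)); last first.
  move=> p _; rewrite (eq_bigl (pred1 (Ordinal (mlt p)))) ?big_pred1_eq//.
rewrite (exchange_big_dep xpredT)//= -sumrB; apply: le_trans (ler_norm_sum _ _ _) _.
apply: (@le_trans _ _ (\sum_(t < n) (((t < c./2) + (n - uphalf c <= t))%N)%:R * M)).
  apply: ler_sum => t _.
  have [bad|] := boolP ((t < c./2) || (n - uphalf c <= t))%N.
    have [[p /andP[Qp tp]]|none] := pselect (exists p, (lag p == k) && (t == (mid p).-1 :> nat)).
      rewrite (bigD1 p) ?Qp//= big1 ?addr0 ?subrr ?normr0 ?mulr_ge0// => q /andP[/andP[Qq tq] /eqP[]].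
      apply: (@mid_inj k) => //.
    by transitivity (t : nat); [apply/esym/eqP|apply/eqP].
    rewrite big1 ?sub0r ?normrN; last by move=> p h; case: none; exists p.
    apply: le_trans (HM t (ltn_ord t)) _; rewrite ler_peMl// ler1n addn_gt0.
    by move: bad; case: (t < c./2)%N; case: (n - uphalf c <= t)%N.
  rewrite negb_or -!ltnNge => /andP[h1 h2].
  have [p Qp] : exists p, (lag p == k) && (t == (mid p).-1 :> nat).
    have l1 : (t - c./2 < n)%N by have := ltn_ord t; lia.
    have l2 : (t + uphalf c < n)%N by have := ltn_ord t; lia.
    have [k0|k0] := leP 0 k.
      exists (Ordinal l2, Ordinal l1); rewrite /lag /mid /=.
      apply/andP; split; apply/eqP; rewrite /c in h1 *; lia.
    exists (Ordinal l1, Ordinal l2); rewrite /lag /mid /=.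
    apply/andP; split; apply/eqP; rewrite /c in h1 *; lia.
  case/andP: Qp => Qp tp.
  rewrite (bigD1 p) ?Qp//= big1 ?addr0 ?subrr ?normr0 ?mulr_ge0// => q /andP[/andP[Qq tq] /eqP[]].
  apply: (@mid_inj k) => //.
    by transitivity (t : nat); [apply/esym/eqP|apply/eqP].
rewrite -mulr_suml ler_wpM2r// -natr_sum ler_nat big_split /=.
have s1 (N x : nat) : (\sum_(t < N) (t < x) <= x)%N.
  suff : (\sum_(t < N) (t < x) <= minn N x)%N by lia.
  elim: N => [|N ih]; first by rewrite big_ord0.
  rewrite big_ord_recr /=; move: ih; set s := (\sum_(t < N) _)%N.
  by case: (ltnP N x); lia.
have s2 (N x : nat) : (\sum_(t < N) (x <= t) <= N - x)%N.
  elim: N => [|N ih]; first by rewrite big_ord0.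
  rewrite big_ord_recr /=; move: ih; set s := (\sum_(t < N) _)%N.
  by case: (leqP x N); lia.
by apply: leq_trans (leq_add (s1 n c./2) (s2 n (n - uphalf c)%N)) _; rewrite -/c; lia.
Qed.

(** Four errors: the coefficients [al], [be] are replaced by the limit functions,
at a cost [K] each; these are moved from the two times of a pair to their midpoint, a
shift of at most [|k|] grid points; the missing midpoints are added; and the Riemann
sum is replaced by the integral. *)
Lemma lag_sum_riemann (al be : nat -> R) f g r (A B rho v K : R) k :
  (forall t, (t < n)%N -> `|al t| <= A) -> (forall t, (t < n)%N -> `|be t| <= B) ->
  (forall x, 0 < x <= 1 -> `|f x| <= A) -> (forall x, 0 < x <= 1 -> `|g x| <= B) ->
  (forall x, 0 < x <= 1 -> `|r x| <= rho) ->
  variation_at_most f A -> variation_at_most g B -> variation_at_most r v ->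
  \sum_(t < n) `|al t - f (t.+1%:R / n%:R)| <= K ->
  \sum_(t < n) `|be t - g (t.+1%:R / n%:R)| <= K ->
  `|\sum_(p : 'I_n * 'I_n | lag p == k) r ((mid p)%:R / n%:R) * (al p.1 * be p.2) -
     n%:R * \int[mu]_(x in `]0, 1]) (f x * (g x * r x))| <=
  rho * (K * (A + B) + 3 * (absz k)%:R * (A * B)) + A * B * (2 * rho + v).
Proof.
move=> alA beB fA gB rr fV gV rV alK beK.
have g01 t : (t < n)%N -> 0 < (t.+1%:R / n%:R : R) <= 1 by exact: grid01.
have one := g01 0%N n0.
have A0 : 0 <= A := le_trans (normr_ge0 _) (fA _ one).
have B0 : 0 <= B := le_trans (normr_ge0 _) (gB _ one).
have r0 : 0 <= rho := le_trans (normr_ge0 _) (rr _ one).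
have grM x : 0 < x <= 1 -> `|g x * r x| <= B * rho.
  by move=> x01; rewrite normrM ler_pM// ?gB ?rr.
have fgrM x : 0 < x <= 1 -> `|f x * (g x * r x)| <= A * (B * rho).
  by move=> x01; rewrite normrM ler_pM// ?fA ?grM.
have fgrV := variation_at_mostM fA grM fV (variation_at_mostM gB rr gV rV).
have riem := riemann_sum n0 fgrM fgrV.
have mids := @sum_midpoints (fun t => f (t.+1%:R / n%:R) * (g (t.+1%:R / n%:R) * r (t.+1%:R / n%:R)))
  _ k (fun t tn => fgrM _ (g01 t tn)).
set S := \sum_(p | _) _; set J := \int[mu]_(x in _) _.
set S1 := \sum_(p | _) _ in mids; set S2 := \sum_(t < n) _ in mids riem.
have mE p : (mid p).-1.+1 = mid p by rewrite /mid.
have mid01 p : 0 < ((mid p)%:R / n%:R : R) <= 1.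
  by rewrite -mE; apply: g01; have := mid_range p; lia.
have e1 : `|S - S1| <= rho * (K * (A + B) + 2 * (absz k)%:R * (A * B)).
  have sK1 : \sum_(p : 'I_n * 'I_n | lag p == k) `|al p.1 - f (p.1.+1%:R / n%:R)| <= K.
    apply: le_trans alK.
    apply: (sum_inj_le (al := fun p => p.1 : nat) (h := fun t => `|al t - f (t.+1%:R / n%:R)|)) => //.
  have sK2 : \sum_(p : 'I_n * 'I_n | lag p == k) `|be p.2 - g (p.2.+1%:R / n%:R)| <= K.
    apply: le_trans beK.
    apply: (sum_inj_le (al := fun p => p.2 : nat) (h := fun t => `|be t - g (t.+1%:R / n%:R)|)) => //.
  have sf := sum_shift_fst k A0 fV; have sg := sum_shift_snd k B0 gV.
  apply: (@le_trans _ _ (\sum_(p : 'I_n * 'I_n | lag p == k) rho *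
     (`|al p.1 - f (p.1.+1%:R / n%:R)| * B + A * `|be p.2 - g (p.2.+1%:R / n%:R)| +
      `|f (p.1.+1%:R / n%:R) - f ((mid p)%:R / n%:R)| * B +
      A * `|g (p.2.+1%:R / n%:R) - g ((mid p)%:R / n%:R)|))).
    rewrite /S /S1 -sumrB; apply: le_trans (ler_norm_sum _ _ _) _.
    apply: ler_sum => p _; rewrite mE.
    set F1 := f (p.1.+1%:R / _); set G2 := g (p.2.+1%:R / _).
    set Fm := f ((mid p)%:R / _); set Gm := g ((mid p)%:R / _).
    have -> : r ((mid p)%:R / n%:R) * (al p.1 * be p.2) - Fm * (Gm * r ((mid p)%:R / n%:R)) =
      r ((mid p)%:R / n%:R) * ((al p.1 - F1) * be p.2 + F1 * (be p.2 - G2) +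
        (F1 - Fm) * G2 + Fm * (G2 - Gm)) by ring.
    rewrite normrM; apply: ler_pM => //; first exact: rr.
    apply: le_trans (ler_normD _ _) _; apply: lerD; last first.
      by rewrite normrM ler_wpM2r// fA.
    apply: le_trans (ler_normD _ _) _; apply: lerD; last first.
      by rewrite normrM ler_wpM2l// gB// g01.
    apply: le_trans (ler_normD _ _) _; apply: lerD; last first.
      by rewrite normrM ler_wpM2r// fA// g01.
    by rewrite normrM ler_wpM2l// beB.
  rewrite -mulr_sumr ler_wpM2l// !big_split /= -!mulr_suml -!mulr_sumr.
  have h1 := ler_wpM2r B0 sK1; have h2 := ler_wpM2l A0 sK2.
  have h3 := ler_wpM2r B0 sf; have h4 := ler_wpM2l A0 sg.
  apply: le_trans (lerD (lerD (lerD h1 h2) h3) h4) _.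
  by rewrite le_eqVlt; apply/orP; left; apply/eqP; ring.
have -> : S - n%:R * J = (S - S1) + (S1 - S2) + (S2 - n%:R * J) by ring.
apply: le_trans (ler_normD _ _) _.
apply: le_trans (lerD (ler_normD _ _) (lexx _)) _.
apply: le_trans (lerD (lerD e1 mids) riem) _.
by rewrite le_eqVlt; apply/orP; left; apply/eqP; ring.
Qed.

End LagSums.

(** * The spectral density as a limit of Toeplitz forms *)

Section DominatedRintegral.
Context {R : realType} {d : measure_display} {T : measurableType d}.
Variable mu : {measure set T -> \bar R}.

Lemma cvg_Rintegral_dominated (D : set T) (F : nat -> T -> R) (f g : T -> R) :
  measurable D -> (forall n, measurable_fun D (F n)) ->
  (forall x, D x -> F n x @[n --> \oo] --> f x) ->
  mu.-integrable D (EFin \o g) ->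
  (forall n x, D x -> `|F n x| <= g x) ->
  mu.-integrable D (EFin \o f) /\
  \int[mu]_(x in D) F n x @[n --> \oo] --> \int[mu]_(x in D) f x.
Proof.
move=> mD mF Ff ig Fg.
have mf : measurable_fun D f by exact: measurable_fun_cvg mF Ff.
have [|||||i _ c] := @dominated_convergence _ _ _ mu D mD
  (fun n => EFin \o F n) (EFin \o f) (EFin \o g).
- by move=> n; apply/measurable_EFinP.
- exact/measurable_EFinP.
- by apply: aeW => x Dx; apply: cvg_EFin; [exact: nearW|exact: Ff].
- exact: ig.
- by apply: aeW => x n Dx; rewrite /= lee_fin; exact: Fg.
split=> //; apply: fine_cvg; rewrite fineK; last exact: integrable_fin_num.
exact: c.
Qed.

End DominatedRintegral.

Section SpectralDensity.
Context {R : realType}.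
Local Notation mu := (@lebesgue_measure R).
Local Notation circle := (`[(- pi : R)%R, pi%R]%classic).
Implicit Types (c r : int -> R).

Lemma zpartial_ler c c' N : (forall j, c j <= c' j) -> zpartial c N <= zpartial c' N.
Proof. by move=> h; apply: ler_sum. Qed.

(** A bounded series with positive terms converges, and [c] is the difference of
[`|c| + c] and [`|c|]. *)
Lemma is_cvg_zpartial c (C : R) :
  (forall N, zpartial (fun j => `|c j|) N <= C) -> cvg (zpartial c @ \oo).
Proof.
move=> hC.
have pos c' C' : (forall j, 0 <= c' j) -> (forall N, zpartial c' N <= C') ->
    cvg (zpartial c' @ \oo).
  move=> c0 cC; apply: nondecreasing_is_cvgn; last by exists C' => _ [N _ <-].
  by apply/nondecreasing_seqP => N; rewrite zpartialS lerDl addr_ge0.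
have -> : zpartial c = (fun N => zpartial (fun j => `|c j| + c j) N - zpartial (fun j => `|c j|) N).
  by apply/funext => N; rewrite /zpartial big_split /= addrC addKr.
apply: is_cvgB; last exact: pos hC.
apply: (pos _ (C + C)) => [j|N].
  by rewrite -lerBlDl sub0r lerNl -normrN ler_norm.
rewrite /zpartial big_split; apply: lerD; first exact: hC.
by apply: le_trans (hC N); apply: zpartial_ler => j; exact: ler_norm.
Qed.

Definition toeplitz_form c r N : R :=
  zpartial (fun i => zpartial (fun j => c i * c j * r (i - j)) N) N.

Lemma toeplitz_form_le c r (C m : R) N : (forall k, `|r k| <= m) ->
  zpartial (fun j => `|c j|) N <= C -> `|toeplitz_form c r N| <= C ^+ 2 * m.
Proof.
move=> rm cC; have m0 : 0 <= m := le_trans (normr_ge0 _) (rm 0).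
apply: (@le_trans _ _ (zpartial (fun j => `|c j|) N ^+ 2 * m)); last first.
  rewrite ler_wpM2r// lerXn2r ?nnegrE//.
    by apply: sumr_ge0.
  by apply: le_trans cC; apply: sumr_ge0.
rewrite expr2 -mulrA /zpartial !mulr_suml; apply: le_trans (ler_norm_sum _ _ _) _.
apply: ler_sum => i _; rewrite mulr_sumr; apply: le_trans (ler_norm_sum _ _ _) _.
by apply: ler_sum => j _; rewrite !normrM mulrA ler_wpM2l ?mulr_ge0.
Qed.

(** The squared modulus of a partial sum is the sum of the squares of its cosine
and sine parts, and [cos (i x) cos (j x) + sin (i x) sin (j x) = cos ((i - j) x)]. *)
Lemma cvg_sqr_norm_fourier c (C x : R) :
  (forall N, zpartial (fun j => `|c j|) N <= C) ->
  toeplitz_form c (fun k => cos (x * k%:~R)) N @[N --> \oo] -->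
  Normc.normc (zseries (fun j => (c j)%:C%C * expi (- (x * j%:~R)))) ^+ 2.
Proof.
move=> hC.
pose re j := c j * cos (x * j%:~R); pose im j := - (c j * sin (x * j%:~R)).
have cre : cvg (zpartial re @ \oo).
  apply: (@is_cvg_zpartial _ C) => N; apply: le_trans (hC N).
  by apply: zpartial_ler => j; rewrite normrM ler_piMr// cos_max.
have cim : cvg (zpartial im @ \oo).
  apply: (@is_cvg_zpartial _ C) => N; apply: le_trans (hC N).
  by apply: zpartial_ler => j; rewrite normrN normrM ler_piMr// sin_max.
have -> : zseries (fun j => (c j)%:C%C * expi (- (x * j%:~R))) =
    (lim (zpartial re @ \oo) +i* lim (zpartial im @ \oo))%C.
  rewrite /zseries /expi; congr Complex; congr (lim (_ @ \oo));
    congr zpartial; apply/funext => j /=; rewrite cosN sinN mul0r.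
    by rewrite subr0.
  by rewrite addr0 mulrN.
rewrite /= sqr_sqrtr ?addr_ge0 ?sqr_ge0//.
have -> : (fun N => toeplitz_form c (fun k => cos (x * k%:~R)) N) =
    (fun N => zpartial re N ^+ 2 + zpartial im N ^+ 2).
  apply/funext => N; rewrite !expr2 /toeplitz_form /zpartial !mulr_suml -big_split.
  apply: eq_bigr => i _ /=; rewrite !mulr_sumr -big_split; apply: eq_bigr => j _ /=.
  by rewrite intrD mulrNz mulrBr cosB /re /im; ring.
by apply: cvgD; rewrite expr2; apply: cvgM.
Qed.

Lemma cvg_Rintegral_spectral (f : R -> R) c (C : R) :
  mu.-integrable circle (EFin \o f) ->
  (forall N, zpartial (fun j => `|c j|) N <= C) ->
  (2 * pi)^-1 * toeplitz_form c (fourier_cos f) N @[N --> \oo] -->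
  \int[mu]_(x in circle) (f x * ((2 * pi)^-1 *
     Normc.normc (zseries (fun j => (c j)%:C%C * expi (- (x * j%:~R)))) ^+ 2)).
Proof.
move=> fi hC; have mC := @measurable_circle R.
have C0 : 0 <= C by apply: le_trans (hC 0); apply: sumr_ge0.
have pi0 : 0 <= (2 * pi : R)^-1 by rewrite invr_ge0 mulr_ge0// ltW// pi_gt0.
pose h (i j : int) x := (2 * pi)^-1 * (c i * c j) * (f x * cos (x * (i - j)%:~R)).
have ih i j : mu.-integrable circle (EFin \o h i j).
  by have := integrableZl mC ((2 * pi)^-1 * (c i * c j)) (integrable_mul_cos (i - j) fi).
pose F N x := zpartial (fun i => zpartial (fun j => h i j x) N) N.
have iF1 N i := Rintegral_sum mC (index_enum 'I_N.*2.+1) xpredT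
   (fun q => ih (i%:Z - N%:Z) (q%:Z - N%:Z)).
have iF N := Rintegral_sum mC (index_enum 'I_N.*2.+1) xpredT (fun i : 'I_N.*2.+1 => (iF1 N i).1).
have FE N x : F N x = f x * ((2 * pi)^-1 * toeplitz_form c (fun k => cos (x * k%:~R)) N).
  rewrite /F /toeplitz_form /zpartial !mulr_sumr; apply: eq_bigr => i _.
  by rewrite !mulr_sumr; apply: eq_bigr => j _; rewrite /h; ring.
have <- : (fun N => \int[mu]_(x in circle) F N x) =
    (fun N => (2 * pi)^-1 * toeplitz_form c (fourier_cos f) N).
  apply/funext => N; rewrite (iF N).2 /toeplitz_form /zpartial mulr_sumr.
  apply: eq_bigr => i _; rewrite (iF1 N i).2 mulr_sumr; apply: eq_bigr => j _.
  rewrite RintegralZl//; last exact: integrable_mul_cos.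
  by symmetry; exact: mulrA.
have [||||//] := @cvg_Rintegral_dominated _ _ _ mu circle F
  (fun x => f x * ((2 * pi)^-1 *
     Normc.normc (zseries (fun j => (c j)%:C%C * expi (- (x * j%:~R)))) ^+ 2))
  (fun x => `|f x| * ((2 * pi)^-1 * C ^+ 2)) mC.
- by move=> N; apply/measurable_EFinP; exact: measurable_int (iF N).1.
- move=> x _; under eq_fun do rewrite FE.
  apply: cvgM; first exact: cvg_cst.
  by apply: cvgM; [exact: cvg_cst|exact: cvg_sqr_norm_fourier hC].
- have := integrableZr mC ((2 * pi)^-1 * C ^+ 2) (integrable_norm fi).
  by apply: eq_integrable.
- move=> N x _; rewrite FE normrM ler_wpM2l// normrM ger0_norm// ler_wpM2l//.
  by rewrite -[leRHS]mulr1; apply: toeplitz_form_le (hC N) => k; exact: cos_max.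
Qed.

End SpectralDensity.

(** * The bias *)

Section FourierVariation.
Context {R : realType}.
Implicit Types (phi : R -> R -> R).

Lemma total_variation_Re_le (a b : R) (f : R -> R[i]) :
  (total_variation a b (fun u => complex.Re (f u)) <= ctotal_variation a b f)%E.
Proof.
apply: ub_ereal_sup => _ [_ [s ps <-] <-].
apply: (@le_trans _ _ (\sum_(0 <= i < size s)
   Normc.normc (f (nth b (a :: s) i.+1) - f (nth b (a :: s) i)))%:E).
  rewrite lee_fin; apply: ler_sum => i _; apply: le_trans (normr_Re_le _).
  by rewrite /= raddfB.
by apply: ereal_sup_ubound; exists s.
Qed.

Lemma rhoinf_ge0 phi : (0 <= rhoinf phi)%E.
Proof.
apply: esum_ge0 => k _; apply: ereal_sup_ge; exists (Normc.normc (phihat phi 0 k))%:E.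
  by exists 0 => //=; rewrite in_itv /= lexx ler01.
by rewrite lee_fin normc_ge0.
Qed.

Lemma vtilde_ge0 phi : (0 <= vtilde phi)%E.
Proof.
apply: (@le_trans _ _ (ctotal_variation 0 1 (fun u => phihat phi u 0))); last first.
  by apply: ereal_sup_ubound; exists 0.
by apply: le_trans (total_variation_Re_le _ _ _); exact: total_variation_ge0.
Qed.

Lemma vtilde_fin phi : (vtilde phi < +oo)%E -> vtilde phi \is a fin_num.
Proof. by rewrite ge0_fin_numE ?vtilde_ge0. Qed.

Lemma fourier_cos_variation phi k : (vtilde phi < +oo)%E ->
  variation_at_most (fun u => fourier_cos (phi u) k) (fine (vtilde phi)).
Proof.
move=> h; apply: total_variation_at_most => u /andP[u0 u1].
rewrite fineK ?vtilde_fin//.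
apply: (@le_trans _ _ (total_variation 0 1 (fun u => fourier_cos (phi u) k))).
  by rewrite (total_variationD _ (ltW u0) u1) leeDr// total_variation_ge0// ltW.
apply: (@le_trans _ _ (ctotal_variation 0 1 (fun u => phihat phi u k))).
  rewrite (_ : (fun u => _) = (fun u => complex.Re (phihat phi u k))).
    exact: total_variation_Re_le.
  by apply/funext => x; rewrite Re_phihat.
by apply: ereal_sup_ubound; exists k.
Qed.

End FourierVariation.

Section Bias.
Context {R : realType} {d : measure_display} {T : measurableType d}.
Variable P : probability T R.
Variables (kappa : R) (eps : int -> {RV P >-> R}) (X : nat -> int -> {RV P >-> R}).
Variables (an : nat -> int -> int -> R) (a : R -> int -> R) (K L M : R).
Hypothesis kappa0 : 0 < kappa.
Hypothesis ls : locally_stationary kappa eps X an a K.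
Hypothesis Xg : gaussian_process X.
Local Notation g j := (ell kappa j)^-1.
Hypothesis hL : forall N, zpartial (fun j => g j) N <= L.
Hypothesis hM : forall j : int, g j <= M /\ `|j|%:~R * g j <= M.
Variables (n : nat) (phi : R -> R -> R).
Hypothesis n0 : (0 < n)%N.
Hypothesis iphi : forall u : R, 0 <= u <= 1 ->
  lebesgue_measure.-integrable `[- pi, pi] (EFin \o phi u).
Hypothesis rhofin : (rhoinf phi < +oo)%E.
Hypothesis vfin : (vtilde phi < +oo)%E.
Local Notation mu := (@lebesgue_measure R).
Local Notation Xs := (@sample R d T P X n).
Local Notation Sg := (covmx P Xs).
Local Notation A := (weight_matrix n phi).
Local Notation rho := (fine (rhoinf phi)).
Local Notation v := (fine (vtilde phi)).
Local Notation r k := (fun u => fourier_cos (phi u) k).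

Lemma EempF_mxtrace : EempF X n phi = \tr (A *m Sg).
Proof.
rewrite -(Ex_quadform (fun i => measurable_funPT (Xs i)) (gaussian_linform Xg (n:=n))
   (fun i => Ex_sample ls Xg i)).
rewrite /EempF expectationE /Rintegral; congr fine; apply: eq_integral => w _.
by rewrite empF_quadform.
Qed.

(** The contributions of the coefficients of index [i] and [j] to
[2 * pi * n%:R * EempF X n phi] and to [2 * pi * specF a phi]. *)
Definition cov_term (i j : int) : R :=
  \sum_(p : 'I_n * 'I_n | lag p == i - j)
    fourier_cos (phi ((mid p)%:R / n%:R)) (i - j) *
    (an n p.1.+1%:Z i * an n p.2.+1%:Z j).

Definition spec_term (i j : int) : R :=
  \int[mu]_(u in `]0, 1]) (a u i * (a u j * fourier_cos (phi u) (i - j))).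

Lemma cvg_EempF :
  (2 * pi * n%:R)^-1 * zpartial (fun i => zpartial (cov_term i) N) N @[N --> \oo] -->
  EempF X n phi.
Proof.
rewrite EempF_mxtrace.
have -> : \tr (A *m Sg) = \sum_(p : 'I_n * 'I_n) A p.1 p.2 * Sg p.1 p.2.
  rewrite /mxtrace -(pair_bigA _ (fun i j => A i j * Sg i j)) /=.
  apply: eq_bigr => i _; rewrite mxE; apply: eq_bigr => j _.
  by congr (_ * _); have /matrixP/(_ i j) := covmx_sym P Xs; rewrite mxE.
have -> : (fun N => (2 * pi * n%:R)^-1 * zpartial (fun i => zpartial (cov_term i) N) N) =
  (fun N => \sum_(p : 'I_n * 'I_n) A p.1 p.2 *
     inner P (Xtrunc eps an n p.1.+1%:Z N) (Xtrunc eps an n p.2.+1%:Z N)).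
  apply/funext => N; under [RHS]eq_bigr do rewrite (inner_Xtrunc ls) /zpartial mulr_sumr.
  rewrite exchange_big /zpartial mulr_sumr; apply: eq_bigr => i _ /=.
  under [RHS]eq_bigr do rewrite mulr_sumr.
  rewrite exchange_big mulr_sumr; apply: eq_bigr => j _ /=.
  rewrite /cov_term mulr_sumr big_mkcond; apply: eq_bigr => -[p q] _ /=.
  rewrite mxE; set x := i%:Z - N%:Z; set y := j%:Z - N%:Z.
  have -> : (p.+1%:Z - x == q.+1%:Z - y) = (lag (p, q) == x - y).
    by rewrite /lag /=; apply/eqP/eqP; lia.
  by case: eqP => [->|_]; rewrite ?mulr1 ?mulr0// !mulrA.
apply: cvg_sumr => p; apply: cvgM; first exact: cvg_cst.
exact: (cvg_inner_Xtrunc ls Xg).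
Qed.

Lemma ls_a_variation j : variation_at_most (fun u => a u j) (K * g j).
Proof. by apply: total_variation_at_most => u u01; exact: (ls_bv ls). Qed.

Let lagsup_bound k u : 0 < u <= 1 -> `|fourier_cos (phi u) k| <= lagsup phi k.
Proof. by move=> /andP[u0 u1]; apply: lagsup_ge => //; rewrite ltW. Qed.

Lemma fourier_cos_le k u : 0 < u <= 1 -> `|fourier_cos (phi u) k| <= rho.
Proof.
move=> u01; apply: le_trans (lagsup_bound k u01) _.
by have := sum_lagsup_le rhofin (s := [:: k]) isT; rewrite big_seq1.
Qed.

Lemma zpartial_a_le u N : 0 < u <= 1 -> zpartial (fun j => `|a u j|) N <= K * L.
Proof.
move=> u01; apply: (@le_trans _ _ (zpartial (fun j => K * g j) N)).
  by apply: zpartial_ler => j; exact: (ls_a_le ls).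
by rewrite /zpartial -mulr_sumr ler_wpM2l ?(ls_K_ge0 ls)//; exact: hL.
Qed.

Let spec_integrable i j :
  mu.-integrable `]0, 1] (EFin \o (fun u => a u i * (a u j * r (i - j) u))).
Proof.
have aK k u : 0 < u <= 1 -> `|a u k| <= K * g k by exact: (ls_a_le ls).
have rM u : 0 < u <= 1 -> `|a u j * r (i - j) u| <= K * g j * lagsup phi (i - j).
  by move=> u01; rewrite normrM ler_pM// ?aK ?lagsup_bound.
apply: (@bounded_variation_integrable _ _ (K * g i * (K * g j * lagsup phi (i - j)))).
  by move=> u u01; rewrite normrM ler_pM// ?aK ?rM.
apply: variation_at_mostM (aK i) rM (ls_a_variation i) _.
exact: variation_at_mostM (aK j) (lagsup_bound (i - j)) (ls_a_variation j) (fourier_cos_variation _ vfin).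
Qed.

(** Dominated convergence in [lambda] for each [u], then in [u]; the value at
[u = 0], about which nothing is assumed, does not affect the integral. *)
Lemma cvg_specF :
  (2 * pi)^-1 * zpartial (fun i => zpartial (spec_term i) N) N @[N --> \oo] -->
  specF a phi.
Proof.
pose D := (`]0%R, 1%R]%classic : set (measurableTypeR R)).
have mD : measurable D by exact: measurable_itv.
have pi0 : 0 <= (2 * pi : R)^-1 by rewrite invr_ge0 mulr_ge0// ltW// pi_gt0.
pose F N (u : R) := (2 * pi)^-1 * zpartial (fun i => zpartial (fun j =>
   a u i * (a u j * r (i - j) u)) N) N.
have FE N u : F N u = (2 * pi)^-1 * toeplitz_form (a u) (fourier_cos (phi u)) N.
  by congr (_ * _); apply: eq_bigr => i _; apply: eq_bigr => j _; rewrite mulrA.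
have iF1 N i := Rintegral_sum mD (index_enum 'I_N.*2.+1) xpredT
   (fun q => spec_integrable (i%:Z - N%:Z) (q%:Z - N%:Z)).
have iF2 N := Rintegral_sum mD (index_enum 'I_N.*2.+1) xpredT (fun i : 'I_N.*2.+1 => (iF1 N i).1).
have iF N : mu.-integrable D (EFin \o F N).
  by have := integrableZl mD (2 * pi)^-1 (iF2 N).1.
have <- : (fun N => \int[mu]_(u in D) F N u) =
    (fun N => (2 * pi)^-1 * zpartial (fun i => zpartial (spec_term i) N) N).
  apply/funext => N; rewrite RintegralZl//; last exact: (iF2 N).1.
  congr (_ * _); rewrite (iF2 N).2; apply: eq_bigr => i _.
  by rewrite (iF1 N i).2.
pose I u := \int[mu]_(l in `[- pi, pi]) (phi u l * spectral_density a u l).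
have [||||iI c] := @cvg_Rintegral_dominated _ _ _ mu D F I (cst ((2 * pi)^-1 * ((K * L) ^+ 2 * rho))) mD.
- by move=> N; apply/measurable_EFinP; exact: measurable_int (iF N).
- move=> u; rewrite /D /= in_itv /= => u01; under eq_fun do rewrite FE.
  have u01' : 0 <= u <= 1 by case/andP: u01 => u0 ->; rewrite ltW.
  exact: (cvg_Rintegral_spectral (iphi u01') (fun N => zpartial_a_le N u01)).
- apply: (@bounded_variation_integrable _ _ `|(2 * pi)^-1 * ((K * L) ^+ 2 * rho)| 0) => //.
  by exists (cst 0); split=> [x _|x y _ _ _]; rewrite /= ?lexx ?subrr ?normr0.
- move=> N u; rewrite /D /= in_itv /= => u01; rewrite FE normrM ger0_norm// ler_wpM2l//.
  exact: toeplitz_form_le (fun k => fourier_cos_le k u01) (zpartial_a_le N u01).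
have -> : specF a phi = \int[mu]_(u in D) I u by rewrite Rintegral_itv_obnd_cbnd.
exact: c.
Qed.

(** The factor [|i - j| <= |i| + |j|] of [lag_sum_riemann] is paid for by one of
the two weights. *)
Lemma cov_term_spec_term i j :
  `|cov_term i j - n%:R * spec_term i j| <=
  K ^+ 2 * (1 + 4 * M) * (lagsup phi (i - j) * (g i + g j)) +
  K ^+ 2 * v * (g i * g j).
Proof.
have K0 := ls_K_ge0 ls.
have gi0 := inv_ell_ge0 kappa0 i; have gj0 := inv_ell_ge0 kappa0 j.
have ran t : (t < n)%N -> 1 <= t.+1%:Z <= n%:Z by lia.
have apx k : \sum_(t < n) `|an n t.+1%:Z k - a (t.+1%:R / n%:R) k| <= K.
  by have := ls_approx ls n k; rewrite big_add1 /= big_mkord.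
have := @lag_sum_riemann R n n0 (fun t => an n t.+1%:Z i) (fun t => an n t.+1%:Z j)
  (fun u => a u i) (fun u => a u j) (r (i - j)) (K * g i) (K * g j)
  (lagsup phi (i - j)) v K (i - j)
  (fun t tn => ls_an_le ls i (ran t tn)) (fun t tn => ls_an_le ls j (ran t tn))
  (fun u u01 => ls_a_le ls i u01) (fun u u01 => ls_a_le ls j u01)
  (fun u u01 => lagsup_bound (i - j) u01)
  (ls_a_variation i) (ls_a_variation j) (fourier_cos_variation _ vfin) (apx i) (apx j).
rewrite -/(cov_term i j) -/(spec_term i j) => h; apply: le_trans h _.
have r0 : 0 <= lagsup phi (i - j) := lagsup_ge0 phi (i - j).
set l := lagsup _ _ in r0 *.
have [giM iM] := hM i; have [gjM jM] := hM j.
have h1 : (absz (i - j))%:R * (g i * g j) <= M * (g i + g j).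
  have : (absz (i - j))%:R <= `|i|%:~R + `|j|%:~R :> R.
    by rewrite -intrD -[(absz _)%:R]/((absz (i - j))%:Z%:~R) ler_int; clear; lia.
  move=> /(ler_wpM2r (mulr_ge0 gi0 gj0)) h; apply: le_trans h _.
  have := ler_wpM2r gj0 iM; have := ler_wpM2r gi0 jM; lra.
have h2 : 2 * (g i * g j) <= M * (g i + g j).
  have := ler_wpM2r gj0 giM; have := ler_wpM2r gi0 gjM; lra.
have lK : 0 <= l * K ^+ 2 by rewrite mulr_ge0// sqr_ge0.
rewrite -subr_ge0 (_ : _ - _ =
  3 * (l * K ^+ 2 * (M * (g i + g j) - (absz (i - j))%:R * (g i * g j))) +
  l * K ^+ 2 * (M * (g i + g j) - 2 * (g i * g j))); last by ring.
by rewrite addr_ge0 ?mulr_ge0 ?subr_ge0.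
Qed.

(** For fixed [i] the numbers [i - j] are distinct, so that the [lagsup phi (i - j)]
sum to at most [rhoinf phi] and leave [1 / ell i] to be summed. *)
Lemma bias_le :
  `|EempF X n phi - specF a phi| <=
  (2 * pi * n%:R)^-1 * (K ^+ 2 * (1 + 4 * M) * (2 * L) + K ^+ 2 * L ^+ 2) * (rho + v).
Proof.
set c := (2 * pi * n%:R)^-1.
have npi : 0 < 2 * pi * n%:R :> R by rewrite !mulr_gt0 ?pi_gt0 ?ltr0n.
have c0 : 0 <= c by rewrite invr_ge0 ltW.
have K0 := ls_K_ge0 ls.
have L0 : 0 <= L := ls_L_ge0 kappa0 hL.
have v0 : 0 <= v by rewrite fine_ge0 ?vtilde_ge0.
have rho0 : 0 <= rho by rewrite fine_ge0 ?rhoinf_ge0.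
have M0 : 0 <= M by have [h _] := hM 0; exact: le_trans (inv_ell_ge0 kappa0 0) h.
have lagrow N (i : int) : zpartial (fun j => lagsup phi (i - j)) N <= rho.
  rewrite /zpartial -(big_map (fun j : 'I_N.*2.+1 => i - (j%:Z - N%:Z)) xpredT (lagsup phi)).
  apply: sum_lagsup_le => //; rewrite map_inj_in_uniq ?index_enum_uniq// => p q _ _ h.
  by apply/val_inj => /=; move: h; clear; lia.
have lagcol N (j : int) : zpartial (fun i => lagsup phi (i - j)) N <= rho.
  rewrite /zpartial -(big_map (fun i : 'I_N.*2.+1 => i%:Z - N%:Z - j) xpredT (lagsup phi)).
  apply: sum_lagsup_le => //; rewrite map_inj_in_uniq ?index_enum_uniq// => p q _ _ h.
  by apply/val_inj => /=; move: h; clear; lia.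
have gpos j : 0 <= g j := inv_ell_ge0 kappa0 j.
have b N : `|c * zpartial (fun i => zpartial (cov_term i) N) N -
    (2 * pi)^-1 * zpartial (fun i => zpartial (spec_term i) N) N| <=
    c * (K ^+ 2 * (1 + 4 * M) * (2 * L) + K ^+ 2 * L ^+ 2) * (rho + v).
  have -> : (2 * pi)^-1 = c * n%:R :> R.
    by rewrite /c (invfM (2 * pi)) -mulrA mulVf ?mulr1// gt_eqF// ltr0n.
  rewrite -mulrA -mulrBr normrM ger0_norm// -mulrA ler_wpM2l//.
  apply: (@le_trans _ _ (zpartial (fun i => zpartial (fun j =>
     K ^+ 2 * (1 + 4 * M) * (lagsup phi (i - j) * (g i + g j)) +
     K ^+ 2 * v * (g i * g j)) N) N)).
    rewrite /zpartial mulr_sumr -sumrB; apply: le_trans (ler_norm_sum _ _ _) _.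
    apply: ler_sum => i _; rewrite mulr_sumr -sumrB; apply: le_trans (ler_norm_sum _ _ _) _.
    by apply: ler_sum => j _; exact: cov_term_spec_term.
  pose z (F : int -> int -> R) := zpartial (fun i => zpartial (F i) N) N.
  have zD F G : z F + z G = z (fun i j => F i j + G i j).
    by rewrite /z /zpartial -big_split; apply: eq_bigr => i _; rewrite -big_split.
  have zZ (e : R) F : e * z F = z (fun i j => e * F i j).
    by rewrite /z /zpartial mulr_sumr; apply: eq_bigr => i _; rewrite mulr_sumr.
  have s1 : z (fun i j => lagsup phi (i - j) * g i) <= L * rho.
    apply: (@le_trans _ _ (zpartial (fun i => g i * rho) N)).
      apply: zpartial_ler => i; rewrite /zpartial -mulr_suml mulrC ler_wpM2l//.
      exact: lagrow.
    by rewrite /zpartial -mulr_suml ler_wpM2r//; exact: hL.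
  have s2 : z (fun i j => lagsup phi (i - j) * g j) <= L * rho.
    rewrite /z /zpartial exchange_big /=.
    apply: (@le_trans _ _ (zpartial (fun i => g i * rho) N)).
      apply: ler_sum => j _; rewrite -mulr_suml mulrC ler_wpM2l//.
      exact: (lagcol N (j%:Z - N%:Z)).
    by rewrite /zpartial -mulr_suml ler_wpM2r//; exact: hL.
  have s3 : z (fun i j => g i * g j) <= L ^+ 2.
    have -> : z (fun i j => g i * g j) = zpartial (fun i => g i) N * zpartial (fun i => g i) N.
      rewrite /z /zpartial mulr_suml; apply: eq_bigr => i _.
      by rewrite mulr_sumr.
    by rewrite expr2; apply: ler_pM; rewrite ?hL//; apply: sumr_ge0.
  rewrite -/(z (fun i j => _)).
  have -> : z (fun i j => K ^+ 2 * (1 + 4 * M) * (lagsup phi (i - j) * (g i + g j)) +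
     K ^+ 2 * v * (g i * g j)) =
     K ^+ 2 * (1 + 4 * M) * (z (fun i j => lagsup phi (i - j) * g i) +
       z (fun i j => lagsup phi (i - j) * g j)) + K ^+ 2 * v * z (fun i j => g i * g j).
    rewrite zD !zZ zD; congr z; apply/funext => i; apply/funext => j.
    by rewrite [lagsup _ _ * (_ + _)]mulrDr.
  have KM : 0 <= K ^+ 2 * (1 + 4 * M) by rewrite mulr_ge0 ?sqr_ge0// addr_ge0// mulr_ge0.
  have Kv : 0 <= K ^+ 2 * v by rewrite mulr_ge0 ?sqr_ge0.
  apply: le_trans (lerD (ler_wpM2l KM (lerD s1 s2)) (ler_wpM2l Kv s3)) _.
  rewrite -subr_ge0 (_ : _ - _ = K ^+ 2 * (1 + 4 * M) * (2 * L) * v + K ^+ 2 * L ^+ 2 * rho);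
    last by ring.
  by apply: addr_ge0; rewrite !mulr_ge0 ?sqr_ge0 ?addr_ge0 ?mulr_ge0.
pose e N := c * zpartial (fun i => zpartial (cov_term i) N) N -
    (2 * pi)^-1 * zpartial (fun i => zpartial (spec_term i) N) N.
have lim : `|e N| @[N --> \oo] --> `|EempF X n phi - specF a phi|.
  by apply: cvg_norm; apply: cvgB; [exact: cvg_EempF|exact: cvg_specF].
rewrite -(cvg_lim _ lim)//; apply: limr_le; first exact: (cvgP _ lim).
by apply: nearW => N; exact: b.
Qed.

End Bias.

(** * The tail bounds *)

Lemma inv_2pi_le {R : realType} (n : nat) : (2 * pi * n%:R)^-1 <= n%:R^-1 :> R.
Proof.
case: n => [|n]; first by rewrite mulr0.
rewrite lef_pV2 ?posrE ?mulr_gt0 ?pi_gt0// ler_peMl ?ltW//.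
by have := pi_ge2 R; lra.
Qed.

Section Tails.
Context {R : realType} {d : measure_display} {T : measurableType d}.
Variable P : probability T R.
Variables (kappa : R) (eps : int -> {RV P >-> R}) (X : nat -> int -> {RV P >-> R}).
Variables (an : nat -> int -> int -> R) (a : R -> int -> R) (K L : R).
Hypothesis kappa0 : 0 < kappa.
Hypothesis ls : locally_stationary kappa eps X an a K.
Hypothesis Xg : gaussian_process X.
Hypothesis hL : forall N, zpartial (fun j => (ell kappa j)^-1) N <= L.
Variables (n : nat) (phi : R -> R -> R).
Hypothesis n0 : (0 < n)%N.
Hypothesis iphi : forall u : R, 0 <= u <= 1 ->
  lebesgue_measure.-integrable `[- pi, pi] (EFin \o phi u).
Hypothesis rhofin : (rhoinf phi < +oo)%E.
Local Notation Xs := (@sample R d T P X n).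
Local Notation Sg := (covmx P Xs).
Local Notation A := (weight_matrix n phi).
Local Notation rho := (fine (rhoinf phi)).
Local Notation sigma := ((K * L) ^+ 2 + 1).

Let nR : 0 < n%:R :> R. Proof. by rewrite ltr0n. Qed.

Let sqn : 0 < Num.sqrt n%:R :> R. Proof. by rewrite sqrtr_gt0. Qed.

Let sigma1 : 1 <= sigma. Proof. by rewrite lerDr sqr_ge0. Qed.

Let sigma0 : 0 < sigma. Proof. exact: lt_le_trans sigma1. Qed.

Let rho0 : 0 <= rho.
Proof. by rewrite fine_ge0 ?rhoinf_ge0. Qed.

Let colsum (B : 'M[R]_n) b : B^T = B -> (forall i, \sum_j `|B i j| <= b) ->
  forall j, \sum_i `|B i j| <= b.
Proof.
move=> Bt hb j; apply: le_trans (hb j); rewrite -{1}Bt.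
by apply: ler_sum => i _; rewrite mxE.
Qed.

Let cov_rows i : \sum_j `|Sg i j| <= sigma.
Proof. by apply: le_trans (covmx_row_sum kappa0 ls Xg hL i) _; rewrite lerDl. Qed.

Lemma frob2_mul_cov (B : 'M[R]_n) : frob2 (B *m Sg) <= sigma ^+ 2 * frob2 B.
Proof.
apply: frob2_mulr; [exact: ltW|exact: cov_rows|].
exact: colsum (covmx_sym P Xs) cov_rows.
Qed.

Lemma frob2_mul_weight (B : 'M[R]_n) : frob2 (B *m A) <= (n%:R^-1 * rho) ^+ 2 * frob2 B.
Proof.
have rows i : \sum_j `|A i j| <= n%:R^-1 * rho.
  by apply: le_trans (weight_matrix_row_sum n0 rhofin i) _; rewrite ler_wpM2r ?inv_2pi_le.
apply: frob2_mulr; [by rewrite mulr_ge0// invr_ge0 ltW|exact: rows|].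
exact: colsum (weight_matrix_sym n phi) rows.
Qed.

Lemma EtildeE w :
  Etilde X n phi w = Num.sqrt n%:R * (quadform Xs A w - \tr (A *m Sg)).
Proof. by rewrite /Etilde empF_quadform// (EempF_mxtrace ls). Qed.

Lemma Etilde_event eta : [set w | (eta <= `|Etilde X n phi w|)%R] =
  [set w | (eta / Num.sqrt n%:R <= `|quadform Xs A w - \tr (A *m Sg)|)%R].
Proof.
apply/seteqP; split=> w /=;
  by rewrite EtildeE normrM (gtr0_norm sqn) ler_pdivrMr// mulrC.
Qed.

Lemma measurable_Etilde_event eta :
  measurable [set w | (eta <= `|Etilde X n phi w|)%R].
Proof.
have mE : measurable_fun setT (fun w => `|Etilde X n phi w|).
  apply/measurableT_comp => //.
  rewrite (_ : Etilde X n phi = fun w => Num.sqrt n%:R * (quadform Xs A w - \tr (A *m Sg))); last first.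
    by apply/funext => w; exact: EtildeE.
  apply: measurable_funM => //; apply: measurable_funB => //.
  apply: (@all_moments_measurable _ _ _ P).
  apply: all_moments_quadform => [i|]; first exact: measurable_funPT.
  exact: gaussian_linform.
have := mE measurableT `[eta, +oo[%classic (measurable_itv _).
by rewrite setTI; congr measurable; apply/seteqP; split=> w /=; rewrite in_itv /= andbT.
Qed.

Let q := fine (rho2 n phi).

(** [quadform_tail] at the level [eta / sqrt n], with [F2 = sigma ^+ 2 * q ^+ 2 / n].
Adding 1 to the row sums of the covariance in [sigma] gives [1 <= sigma], so that both
tail bounds hold with the same constant [c2]. *)
Lemma Etilde_tail (beta eta : R) : rho2 n phi \is a fin_num -> 0 < q -> 0 <= beta ->
  (forall B, frob2 (B *m (A *m Sg)) <= (beta / Num.sqrt n%:R) ^+ 2 * frob2 B) ->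
  0 < eta ->
  (P [set w | (eta <= `|Etilde X n phi w|)%R] <=
   (2 * expR (- (eta ^+ 2 / (8 * (sigma ^+ 2 * q ^+ 2 + beta * eta)))))%:E)%E.
Proof.
move=> qfin q0 b0 Wb e0; rewrite Etilde_event.
have F0 : 0 < sigma ^+ 2 * q ^+ 2 / n%:R by rewrite divr_gt0// mulr_gt0// exprn_gt0.
have WF : frob2 (A *m Sg) <= sigma ^+ 2 * q ^+ 2 / n%:R.
  apply: le_trans (frob2_mul_cov _) _; rewrite -[leRHS]mulrA ler_wpM2l ?sqr_ge0//.
  have := weight_matrix_frob2 n0 iphi rhofin.
  rewrite -[rho2 n phi]fineK// -/q -EFin_expe -EFinM lee_fin => h; apply: le_trans h _.
  by rewrite mulrC ler_wpM2l ?sqr_ge0 ?inv_2pi_le.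
have bs0 : 0 <= beta / Num.sqrt n%:R by rewrite divr_ge0// ltW.
have s0 : 0 < eta / Num.sqrt n%:R by rewrite divr_gt0.
have := quadform_tail (fun i => measurable_funPT (Xs i)) (gaussian_linform Xg (n:=n))
  (fun i => Ex_sample ls Xg i) (weight_matrix_sym n phi) bs0 (ltW F0) WF Wb F0 s0.
move=> h; apply: le_trans h _; rewrite lee_fin le_eqVlt; apply/orP; left; apply/eqP.
congr (2 * expR (- _)).
have e : n%:R = Num.sqrt n%:R ^+ 2 :> R by rewrite sqr_sqrtr// ltW.
rewrite {2}e; move: (Num.sqrt n%:R : R) sqn => y yp.
have D : sigma ^+ 2 * q ^+ 2 + beta * eta != 0.
  by rewrite gt_eqF// ltr_pwDl ?mulr_gt0 ?exprn_gt0// mulr_ge0// ltW.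
have y0 : y != 0 by rewrite gt_eqF.
set S := sigma ^+ 2 * q ^+ 2 in D *.
have -> : S / y ^+ 2 + beta / y * (eta / y) = (S + beta * eta) / y ^+ 2 by field.
by field; rewrite y0 D.
Qed.

Lemma rho2_ge0 : (0 <= rho2 n phi)%E. Proof. exact: sqrte_ge0. Qed.

Lemma Etilde_rho2_eq0 eta : rho2 n phi = 0%E -> 0 < eta ->
  [set w | (eta <= `|Etilde X n phi w|)%R] = set0.
Proof.
move=> r0 e0; apply/seteqP; split=> // w /=.
have := weight_matrix_frob2 n0 iphi rhofin; rewrite r0 expe2 mule0 mule0 lee_fin => A0.
have AE : A = 0.
  apply/matrixP => i j; rewrite [RHS]mxE; apply/eqP.
  rewrite -(sqrf_eq0 (A i j)) eq_le sqr_ge0 andbT.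
  apply: le_trans A0; rewrite /frob2 (bigD1 i)//= (bigD1 j)//= -addrA lerDl.
  apply: addr_ge0; first by apply: sumr_ge0 => k _; exact: sqr_ge0.
  by apply: sumr_ge0 => k _; apply: sumr_ge0 => l _; exact: sqr_ge0.
have Q0 : quadform Xs A w = 0.
  by rewrite quadform_sum big1// => i _; rewrite big1// => j _; rewrite AE mxE mul0r.
by rewrite EtildeE Q0 AE mul0mx mxtrace0 subrr mulr0 normr0 leNgt e0.
Qed.

Let c1 : R := 2 * expR 8^-1.
Let c2 : R := (8 * sigma ^+ 2)^-1.

Let c1_ge1 : 1 <= c1.
Proof.
have : 1 <= expR 8^-1 :> R by rewrite -expR0 ler_expR invr_ge0.
by rewrite /c1; lra.
Qed.

Let prob_le_c1 eta : (P [set w | (eta <= `|Etilde X n phi w|)%R] <= c1%:E)%E.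
Proof.
apply: (@le_trans _ _ 1%E); last by rewrite lee_fin.
exact: probability_le1 (measurable_Etilde_event eta).
Qed.

Let c1_exp_ge0 x : (0 <= c1%:E * expeR x)%E.
Proof. by rewrite mule_ge0 ?expeR_ge0// lee_fin (le_trans _ c1_ge1). Qed.

(** The operator norms of the weight matrix and of the covariance are bounded by
their row sums, [rhoinf phi / n] and [sigma]. *)
Lemma Etilde_tail_bernstein eta : 0 < eta ->
  (P [set w | (eta <= `|Etilde X n phi w|)%R] <=
   c1%:E * expeR (- c2%:E * ((eta ^+ 2)%:E /
     (rho2 n phi ^+ 2 + eta%:E * rhoinf phi / (Num.sqrt n%:R)%:E))))%E.
Proof.
move=> e0.
have rE : (eta%:E * rhoinf phi / (Num.sqrt n%:R)%:E)%E = (eta * rho / Num.sqrt n%:R)%:E.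
  by rewrite -[in LHS](fineK (rhoinf_fin rhofin)) inver (gt_eqF sqn) -!EFinM.
rewrite rE.
have [roo|rfin] := eqVneq (rho2 n phi) +oo%E.
  rewrite roo expe2 mulyy addye// invey mule0 mule0 expeR0 mule1.
  exact: prob_le_c1.
have qfin : rho2 n phi \is a fin_num by rewrite ge0_fin_numE ?rho2_ge0// ltey.
have [qz|qnz] := eqVneq (rho2 n phi) 0%E.
  by rewrite (Etilde_rho2_eq0 qz e0) measure0.
have q0 : 0 < q by rewrite /q fine_gt0// lt0e qnz rho2_ge0 ltey.
have b0 : 0 <= sigma * rho / Num.sqrt n%:R by rewrite divr_ge0 ?mulr_ge0// ltW.
apply: le_trans (Etilde_tail qfin q0 b0 _ e0) _.
  move=> B; rewrite mulmxA; apply: le_trans (frob2_mul_cov _) _.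
  rewrite -[X in _ <= X * _](_ : sigma ^+ 2 * (n%:R^-1 * rho) ^+ 2 = _).
    by rewrite -[leRHS]mulrA; apply: ler_wpM2l; [exact: sqr_ge0|exact: frob2_mul_weight].
  rewrite -exprMn -mulrA -invfM -expr2 sqr_sqrtr; last exact: ltW.
  by rewrite mulrA [sigma * rho / _]mulrAC.
rewrite -[rho2 n phi]fineK// -/q -EFin_expe -EFinD.
have D0 : 0 < q ^+ 2 + eta * rho / Num.sqrt n%:R.
  by rewrite ltr_pwDl ?exprn_gt0// divr_ge0 ?mulr_ge0// ltW.
rewrite inver gt_eqF//; move: D0; set y := eta * rho / Num.sqrt n%:R => D0.
have -> : (c1%:E * expeR (- c2%:E * ((eta ^+ 2)%:E * ((q ^+ 2 + y)^-1)%:E)) =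
  (c1 * expR (- c2 * (eta ^+ 2 / (q ^+ 2 + y))))%:E)%E by [].
rewrite lee_fin.
rewrite (_ : sigma * rho / Num.sqrt n%:R * eta = sigma * y); last by rewrite /y; ring.
have y0 : 0 <= y by rewrite divr_ge0 ?mulr_ge0// ltW.
apply: ler_pM; rewrite ?expR_ge0//.
  by rewrite /c1 ler_peMr// -expR0 ler_expR invr_ge0.
rewrite ler_expR mulNr lerN2 /c2 mulrA mulrC mulrA -invfM [leLHS]mulrC.
rewrite ler_wpM2l ?sqr_ge0// lef_pV2 ?posrE ?mulr_gt0 ?exprn_gt0//; last first.
  by rewrite ltr_pwDl ?mulr_gt0 ?exprn_gt0// mulr_ge0// ltW.
rewrite [leRHS]mulrC -[leRHS]mulrA ler_pM2l// [leRHS]mulrDr lerD2l ler_wpM2r//.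
by rewrite expr2 ler_peMr// ltW.
Qed.

(** The operator norm is now bounded by the Hilbert-Schmidt norm, so that the
exponent depends on [x = eta / (sigma * q)] only; [x ^+ 2 >= x ^+ 2 - 1] makes it linear
in [x] at the price of the factor [expR 8^-1] in [c1]. *)
Lemma Etilde_tail_exponential eta : 0 < eta ->
  (P [set w | (eta <= `|Etilde X n phi w|)%R] <=
   c1%:E * expeR (- c2%:E * (eta%:E / rho2 n phi)))%E.
Proof.
move=> e0.
have [roo|rfin] := eqVneq (rho2 n phi) +oo%E.
  rewrite roo invey mule0 mule0 expeR0 mule1; exact: prob_le_c1.
have qfin : rho2 n phi \is a fin_num by rewrite ge0_fin_numE ?rho2_ge0// ltey.
have [qz|qnz] := eqVneq (rho2 n phi) 0%E.
  by rewrite (Etilde_rho2_eq0 qz e0) measure0.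
have q0 : 0 < q by rewrite /q fine_gt0// lt0e qnz rho2_ge0 ltey.
have b0 : 0 <= sigma * q by rewrite mulr_ge0// ltW.
apply: le_trans (Etilde_tail qfin q0 b0 _ e0) _.
  move=> B; apply: le_trans (frob2M _ _) _; rewrite mulrC ler_wpM2r ?frob2_ge0//.
  apply: le_trans (frob2_mul_cov _) _.
  rewrite expr_div_n sqr_sqrtr; last exact: ltW.
  rewrite (exprMn _ sigma) -[leRHS]mulrA ler_wpM2l ?sqr_ge0//.
  have := weight_matrix_frob2 n0 iphi rhofin.
  rewrite -[rho2 n phi]fineK// -/q -EFin_expe -EFinM lee_fin => h; apply: le_trans h _.
  by rewrite mulrC ler_wpM2l ?sqr_ge0 ?inv_2pi_le.
rewrite -[rho2 n phi]fineK// -/q inver gt_eqF//.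
have -> : (c1%:E * expeR (- c2%:E * (eta%:E * (q^-1)%:E)) =
  (c1 * expR (- c2 * (eta / q)))%:E)%E by [].
rewrite lee_fin.
rewrite /c1 -[leRHS]mulrA ler_pM2l// -expRD ler_expR.
have sq0 : 0 < sigma * q by rewrite mulr_gt0.
pose x := eta / (sigma * q).
have x0 : 0 < x by rewrite divr_gt0.
have -> : eta ^+ 2 / (8 * (sigma ^+ 2 * q ^+ 2 + sigma * q * eta)) = x ^+ 2 / (8 * (1 + x)).
  rewrite /x -exprMn; move: (sigma * q) sq0 => z z0; field.
  have zz : z + eta != 0 by rewrite gt_eqF// addr_gt0.
  by rewrite gt_eqF// zz gt_eqF// addr_gt0// ?exprn_gt0// mulr_gt0.
have h1 : (x - 1) / 8 <= x ^+ 2 / (8 * (1 + x)).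
  rewrite ler_pdivlMr ?mulr_gt0 ?addr_gt0//.
  have -> : (x - 1) / 8 * (8 * (1 + x)) = x ^+ 2 - 1 by field.
  by rewrite gerBl.
have h2 : c2 * (eta / q) <= x / 8.
  have -> : x / 8 = (8 * sigma)^-1 * (eta / q) by rewrite /x; field; rewrite !gt_eqF.
  rewrite ler_wpM2r ?(divr_ge0 (ltW _) (ltW _))// /c2 lef_pV2 ?posrE ?mulr_gt0 ?exprn_gt0//.
  by rewrite ler_pM2l// expr2 ler_peMr// ltW.
rewrite mulNr; lra.
Qed.

End Tails.

(** * Exponential inequalities and bias for the empirical spectral process *)

(* In \bar R, x / 0 = +oo for x > 0 and expeR -oo = 0: both tail bounds are 0
   when their denominators vanish. *)
Theorem theorem4p1 (R : realType) (d : measure_display) (T : measurableType d)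
    (P : probability T R) (kappa : R) (eps : int -> {RV P >-> R})
    (X : nat -> int -> {RV P >-> R}) (an : nat -> int -> int -> R)
    (a : R -> int -> R) (K : R) :
  0 < kappa ->
  locally_stationary kappa eps X an a K ->
  gaussian_process X ->
  exists c1 c2 c3 : R, [/\ 0 < c1, 0 < c2, 0 < c3 &
    forall (n : nat) (phi : R -> R -> R), (0 < n)%N ->
      (forall u : R, 0 <= u <= 1 ->
         lebesgue_measure.-integrable `[- pi, pi] (EFin \o phi u)) ->
      (rhoinf phi < +oo)%E ->
      (vtilde phi < +oo)%E ->
      [/\ forall eta : R, 0 < eta ->
            (P [set w | (eta <= `|Etilde X n phi w|)%R] <=
             c1%:E * expeR (- c2%:E * ((eta ^+ 2)%:E /
               (rho2 n phi ^+ 2 +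
                eta%:E * rhoinf phi / (Num.sqrt n%:R)%:E))))%E,
          forall eta : R, 0 < eta ->
            (P [set w | (eta <= `|Etilde X n phi w|)%R] <=
             c1%:E * expeR (- c2%:E * (eta%:E / rho2 n phi)))%E
        & ((Num.sqrt n%:R * `|EempF X n phi - specF a phi|)%:E <=
           (c3 / Num.sqrt n%:R)%:E * (rhoinf phi + vtilde phi))%E]].
Proof.
move=> kappa0 ls Xg.
have [L [L0 hL]] := zpartial_inv_ell_le kappa0.
have [M [M0 hM]] := norm_inv_ell_le kappa0.
have K0 := ls_K_ge0 ls.
pose C := K ^+ 2 * (1 + 4 * M) * (2 * L) + K ^+ 2 * L ^+ 2.
have C0 : 0 <= C.
  have M1 : 0 <= 1 + 4 * M by rewrite addr_ge0 ?mulr_ge0// ltW.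
  by rewrite addr_ge0 ?mulr_ge0 ?sqr_ge0// ltW.
exists (2 * expR 8^-1), (8 * ((K * L) ^+ 2 + 1) ^+ 2)^-1, (C + 1); split.
- by rewrite mulr_gt0// expR_gt0.
- by rewrite invr_gt0 mulr_gt0// exprn_gt0// ltr_wpDl ?sqr_ge0.
- by rewrite ltr_wpDl.
move=> n phi n0 iphi rhofin vfin; split.
- by move=> eta; exact: (Etilde_tail_bernstein kappa0 ls Xg hL n0 iphi rhofin).
- by move=> eta; exact: (Etilde_tail_exponential kappa0 ls Xg hL n0 iphi rhofin).
have b := bias_le kappa0 ls Xg hL hM n0 iphi rhofin vfin.
have nR : 0 < n%:R :> R by rewrite ltr0n.
have sqn : 0 < Num.sqrt n%:R :> R by rewrite sqrtr_gt0.
rewrite -[rhoinf phi]fineK ?rhoinf_fin// -[vtilde phi]fineK ?vtilde_fin//.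
rewrite -EFinD -EFinM lee_fin.
set S := fine (rhoinf phi) + _ in b *; rewrite -/C in b.
have S0 : 0 <= S.
  by rewrite addr_ge0 ?fine_ge0 ?rhoinf_ge0 ?vtilde_ge0.
apply: le_trans (ler_wpM2l (ltW sqn) b) _.
rewrite !mulrA ler_wpM2r//; set s := Num.sqrt n%:R in sqn *.
have -> : (C + 1) / s = s * n%:R^-1 * (C + 1).
  by rewrite -[n%:R](sqr_sqrtr (ltW nR)) -/s; field; rewrite gt_eqF.
have h := ler_wpM2l (ltW sqn) (inv_2pi_le n : (2 * pi * n%:R)^-1 <= n%:R^-1 :> R).
apply: ler_pM => //; last by rewrite lerDl.
by rewrite mulr_ge0 ?invr_ge0 ?mulr_ge0 ?pi_ge0// ltW.
Qed.
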